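(* Let $n$ be an even positive integer and let $A$ be an architecture on $n$ qubits with $R$ gates which is the sequential concatenation of $T=R/L$ causal slices, each consisting of $L$ gates. Let $U\in\mathrm{SU}(2^n)$ be the unitary implemented by a random quantum circuit with architecture $A$ (each gate drawn independently Haar-randomly from $\mathrm{SU}(4)$). If $T=R/L<4^n-1$, then with probability $1$, $$\mathcal{C}_{\mathrm{u}}(U)\geq \frac{R}{9L}-\frac{n}{3}.$$ Moreover, if $T=R/L<2^{n+1}-1$, then with probability $1$, $$\mathcal{C}_{\mathrm{state}}(U|0^n\rangle)\geq \frac{R}{9L}-\frac{n}{3}.$$
   Context: Qubits are labeled $1,\dots,n$, and $|0^n\rangle=|0\rangle^{\otimes n}$. An architecture is a directed acyclic graph with $R\in\mathbb{Z}_{>0}$ vertices (gates), where two edges (qubit wires) enter and two edges exit each vertex; it specifies an arrangement of $R$ two-qubit gates (not necessarily on neighboring qubits) in an $n$-qubit circuit. A random quantum circuit with architecture $A$ is obtained by placing at each vertex an independent Haar-random element of $\mathrm{SU}(4)$ and contracting along the edges, yielding an element of $\mathrm{SU}(2^n)$. A slice of an architecture is the set of gates lying between two cuts of the circuit (so the architecture is a sequential composition of consecutive slices); a slice is causal if there is a qubit $t$ such that every other qubit $t'$ is connected to $t$ by a directed path (possibly depending on $t'$) passing only through gates of the slice. The exact circuit complexity $\mathcal{C}_{\mathrm{u}}(U)$ of $U\in\mathrm{SU}(2^n)$ is the least number of two-qubit gates in any circuit (any architecture) that implements $U$ exactly. The exact state complexity $\mathcal{C}_{\mathrm{state}}(|\psi\rangle)$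 is the least number $r$ of two-qubit gates $U_1,\dots,U_r$, arranged in any architecture, such that $U_1U_2\cdots U_r|0^n\rangle=|\psi\rangle$. *)

(* Defs.v *)
From HB Require Import structures.
From mathcomp Require Import all_boot all_order all_algebra.
From mathcomp Require Import complex.
From mathcomp Require Import all_classical all_reals all_analysis.
Set Implicit Arguments.
Unset Strict Implicit.
Unset Printing Implicit Defensive.
Import Order.TTheory GRing.Theory Num.Theory.
Local Open Scope ring_scope.
Local Open Scope classical_set_scope.

Definition adjmx (R : realType) (k : nat) (U : 'M[R[i]]_k) : 'M[R[i]]_k :=
  \matrix_(x, y) (U y x)^*.

Definition is_SU (R : realType) (k : nat) (U : 'M[R[i]]_k) : bool :=
  (U *m adjmx U == 1%:M) && (\det U == 1).

(* Qubits are labeled by 'I_n (i.e. 0..n-1 instead of 1..n).  The computational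
   basis state |x_0 x_1 ... x_{n-1}> is the index x : 'I_(2^n) whose binary digit
   of weight 2^q is x_q. *)
Definition bit (n : nat) (x : 'I_(2 ^ n)) (q : 'I_n) : bool := odd (x %/ 2 ^ q).

Definition loc_idx (n : nat) (a b : 'I_n) (x : 'I_(2 ^ n)) : 'I_4 :=
  inord (2 * bit x a + bit x b).

(* the 2^n x 2^n matrix of the two-qubit gate g acting on qubits (a, b),
   tensored with the identity on all other qubits *)
Definition embed_gate (R : realType) (n : nat) (a b : 'I_n) (g : 'M[R[i]]_4)
  : 'M[R[i]]_(2 ^ n) :=
  \matrix_(x, y)
    if [forall q : 'I_n, ((q != a) && (q != b)) ==> (bit x q == bit y q)]
    then g (loc_idx a b x) (loc_idx a b y) else 0.

(* An architecture on n qubits with R gates is represented by a topological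
   ordering of its gates: a sequence of R ordered pairs of distinct qubits
   (the two wires entering/leaving each gate). *)
Definition architecture (n : nat) := seq ('I_n * 'I_n).

Definition wf_arch (n : nat) (A : architecture n) : bool :=
  all (fun p => p.1 != p.2) A.

Definition circuit (R : realType) (n : nat) := seq (('I_n * 'I_n) * 'M[R[i]]_4).

(* unitary implemented by the circuit; the first gate of the list acts first *)
Definition circuit_unitary (R : realType) (n : nat) (c : circuit R n)
  : 'M[R[i]]_(2 ^ n) :=
  foldr (fun pg M => M *m embed_gate pg.1.1 pg.1.2 pg.2) 1%:M c.

Definition valid_circuit (R : realType) (n : nat) (c : circuit R n) : bool :=
  all (fun pg => (pg.1.1 != pg.1.2) && is_SU pg.2) c.

Definition ket0 (R : realType) (n : nat) : 'cV[R[i]]_(2 ^ n) :=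
  \col_x (if nat_of_ord x == 0%N then 1 else 0).

(* ---------- exact complexities (inf over an empty set would be +oo) ---------- *)
Definition Cu (R : realType) (n : nat) (U : 'M[R[i]]_(2 ^ n)) : \bar R :=
  ereal_inf [set ((size c)%:R)%:E | c in
     [set c : circuit R n | valid_circuit c /\ circuit_unitary c = U]].

Definition Cstate (R : realType) (n : nat) (psi : 'cV[R[i]]_(2 ^ n)) : \bar R :=
  ereal_inf [set ((size c)%:R)%:E | c in
     [set c : circuit R n | valid_circuit c /\ circuit_unitary c *m ket0 R n = psi]].

(* qubits reachable from qubit s by a directed path through the gates of S
   (the forward light cone of s within S) *)
Definition light_cone (n : nat) (S : architecture n) (s : 'I_n) : {set 'I_n} :=
  foldl (fun (X : {set 'I_n}) p =>
           if (p.1 \in X) || (p.2 \in X) then p.1 |: (p.2 |: X) else X) [set s]%SET S.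

Definition causal_slice (n : nat) (S : architecture n) : Prop :=
  exists t : 'I_n, forall t' : 'I_n, t' != t -> t \in light_cone S t'.

Definition slice (n : nat) (A : architecture n) (L k : nat) : architecture n :=
  take L (drop (k * L) A).

(* Borel sigma-algebra on 4x4 complex matrices (= Borel sets of C^16 = R^32),
   generated by the real and imaginary parts of the entries. *)
Definition borel_M4 (R : realType) : set (set 'M[R[i]]_4) :=
  <<s [set A : set 'M[R[i]]_4 | exists (x y : 'I_4) (B : set R), measurable B /\
          (A = [set M : 'M[R[i]]_4 | B (complex.Re (M x y))] \/ A = [set M : 'M[R[i]]_4 | B (complex.Im (M x y))])] >>.

Definition indep_gates (R : realType) d (Omega : measurableType d)
  (P : probability Omega R) (m : nat) (G : 'I_m -> Omega -> 'M[R[i]]_4) : Prop :=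
  forall (S : {set 'I_m}) (B : 'I_m -> set 'M[R[i]]_4),
    (forall k, @borel_M4 R (B k)) ->
    P (\bigcap_(k in [set k | k \in S]) (G k @^-1` B k)) =
      (\prod_(k in S) P (G k @^-1` B k))%E.

Definition haar_gate (R : realType) d (Omega : measurableType d)
  (P : probability Omega R) (X : Omega -> 'M[R[i]]_4) : Prop :=
  (forall B, @borel_M4 R B -> measurable (X @^-1` B)) /\
  (forall w, is_SU (X w)) /\
  (forall (g : 'M[R[i]]_4) B, is_SU g -> @borel_M4 R B ->
     P (X @^-1` [set g *m M | M in B]) = P (X @^-1` B)).

Definition random_circuit (R : realType) (n : nat) (A : architecture n)
  d (Omega : measurableType d) (G : 'I_(size A) -> Omega -> 'M[R[i]]_4)
  (w : Omega) : circuit R n :=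
  zip A [seq G k w | k <- enum 'I_(size A)].
Arguments random_circuit {R n} A {d Omega} G w.

(* Main.v *)
(** The proof compares dimensions. In a causal slice, Clifford gates can move any Pauli string P to
    a single gate, so one slice realises V (1 + i x P) up to a scalar for some fixed unitary V.
    Choosing the T strings one after the other, and x-dependent weights x^(w j), gives circuits of
    the given architecture whose unitary (or output state) has leading coefficients along T + 1
    linearly independent directions; this is possible as long as T is below the dimension of
    SU(2^n) (or of the sphere of states). On the other hand, by the KAK decomposition a circuit
    with s gates depends polynomially on 9 s + 3 n parameters up to homogeneity. If
    9 s + 3 n < T, counting monomials yields a nonzero homogeneous polynomial in the T + 1 linear
    coordinates dual to these directions that vanishes on all circuits of a given architecture with
    s gates, and choosing the weights as in Kronecker's substitution shows that it does not vanish
    identically on the given architecture. Its zero set is then Haar-null, which is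
    derived from left invariance of the measure only, using roots in SU(4) instead of
    analyticity. There are countably many competing architectures. *)

Require Import Defs.
From HB Require Import structures.
From mathcomp Require Import all_boot all_order all_algebra.
From mathcomp Require Import complex mxtens spectral.
From mathcomp Require Import all_classical all_reals all_analysis measurable_realfun.
From mathcomp Require Import ring lra zify.
Set Implicit Arguments.
Unset Strict Implicit.
Unset Printing Implicit Defensive.
Import Order.TTheory GRing.Theory Num.Theory.
Local Open Scope ring_scope.

(** * Tensor products and embedded gates *)

(** Rotations are kept in the unnormalised form 1 + i x P because this is polynomial in x; the price
    is an unknown scalar on every circuit. Hence the count is projective: the polynomials are
    homogeneous, a block of d + 1 coordinates counts as d, and the T directions contributed by the
    slices are joined by the radial one, the point itself. All linear algebra of directions is over
    the reals. The obstacle to evaluating a polynomial on a product of T rotations is the cross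
    terms, in which strings get multiplied and independence is lost. If all exponents w j lie in an
    interval [N, 2N), every cross term is of higher order than every single term, and there is still
    room in the interval to give distinct monomials distinct weights. The polynomial relations avoid
    semialgebraic dimension theory: a set parametrised by D parameters satisfies a relation in T > D
    coordinates because k^T eventually exceeds any constant times k^D. For nullity, what matters
    about polynomials in the gates is that they lie in finite-dimensional spaces stable under left
    translation. *)

Lemma nat_bits_inj n x y : (x < 2 ^ n)%N -> (y < 2 ^ n)%N ->
  (forall q, (q < n)%N -> odd (x %/ 2 ^ q) = odd (y %/ 2 ^ q)) -> x = y.
Proof.
elim: n x y => [|n IH] x y; first by rewrite expn0 !ltnS !leqn0 => /eqP-> /eqP->.
move=> xlt ylt H; rewrite -[x]odd_double_half -[y]odd_double_half.
have /= := H 0%N isT; rewrite expn0 !divn1 => ->; congr (_ + _.*2)%N.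
apply: IH => [||q qn]; rewrite -?divn2.
- by rewrite ltn_divLR // -expnSr.
- by rewrite ltn_divLR // -expnSr.
- by rewrite -!divnMA -!expnS H.
Qed.

Section Kronecker.
Variables (R : realType) (n : nat).
Local Notation C := R[i].
Implicit Types (u v : 'I_n -> 'M[C]_2) (a b : 'I_n) (g h : 'M[C]_4).

Definition i2 (c : bool) : 'I_2 := inord c.

Lemma val_i2 (c : bool) : i2 c = c :> nat.
Proof. by rewrite /i2 inordK //; case: c. Qed.

Lemma i2_inj : injective i2.
Proof. by move=> b c /(congr1 (@nat_of_ord 2)); rewrite !val_i2; case: b; case: c. Qed.

(** Values in ['I_2] index 2 x 2 matrices, and sums over basis states become sums over functions,
    where products of sums distribute. *)
Definition bits (x : 'I_(2 ^ n)) : {ffun 'I_n -> 'I_2} := [ffun q => i2 (bit x q)].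

Lemma bit_inj (x y : 'I_(2 ^ n)) : (forall q, bit x q = bit y q) -> x = y.
Proof.
move=> H; apply/val_inj/(@nat_bits_inj n) => [||q qn]; [exact: ltn_ord..|].
exact: (H (Ordinal qn)).
Qed.

Lemma bits_bij : bijective bits.
Proof.
apply: inj_card_bij => [x y /ffunP H|].
  by apply: bit_inj => q; have := H q; rewrite !ffunE => /i2_inj.
by rewrite card_ffun !card_ord.
Qed.

(** The tensor product of all [u q], given entrywise, so that no iterated Kronecker product with
    nested indices is needed. *)
Definition kron_layer u : 'M[C]_(2 ^ n) :=
  \matrix_(x, y) \prod_q u q (bits x q) (bits y q).

Lemma kron_layerM u v :
  kron_layer u *m kron_layer v = kron_layer (fun q => u q *m v q).
Proof.
apply/matrixP => x y; rewrite !mxE.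
under [RHS]eq_bigr do rewrite mxE.
rewrite bigA_distr_bigA (reindex bits) /=; last exact/onW_bij/bits_bij.
by apply: eq_bigr => z _; rewrite !mxE big_split.
Qed.

Lemma eq_kron_layer u v : u =1 v -> kron_layer u = kron_layer v.
Proof.
by move=> H; apply/matrixP => x y; rewrite !mxE; apply: eq_bigr => q _; rewrite H.
Qed.

Lemma prod_delta (I : finType) (P Q : pred I) :
  \prod_(q | P q) (Q q)%:R = ([forall q, P q ==> Q q])%:R :> C.
Proof.
have [/forallP H|] := boolP [forall q, P q ==> Q q].
  by rewrite big1 // => q Pq; have /implyP/(_ Pq)-> := H q.
rewrite negb_forall => /existsP[q]; rewrite negb_imply => /andP[Pq /negbTE Qq].
by rewrite (bigD1 q) //= Qq mul0r.
Qed.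

Lemma bits_eq (x y : 'I_(2 ^ n)) q : (bits x q == bits y q) = (bit x q == bit y q).
Proof. by rewrite !ffunE (inj_eq i2_inj). Qed.

Lemma kron_layer1 u : (forall q, u q = 1%:M) -> kron_layer u = 1%:M.
Proof.
move=> u1; apply/matrixP => x y; rewrite !mxE.
under eq_bigr do rewrite u1 mxE bits_eq.
rewrite (prod_delta predT); congr (nat_of_bool _)%:R.
apply/idP/eqP => [/forallP H|->]; last by apply/forallP => q /=.
by apply: bit_inj => q; apply/eqP/H.
Qed.

Definition kron2 (p q : 'M[C]_2) : 'M[C]_4 := p *t q.

Definition on_pair a b (p q : 'M[C]_2) : 'I_n -> 'M[C]_2 :=
  fun r => if r == a then p else if r == b then q else 1%:M.

Definition pair4 : 'I_2 * 'I_2 -> 'I_4 := @mxtens_index 2 2.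

Definition unpair4 : 'I_4 -> 'I_2 * 'I_2 := @mxtens_unindex 2 2.

Lemma pair4K : cancel pair4 unpair4. Proof. exact: mxtens_indexK. Qed.

Lemma unpair4K : cancel unpair4 pair4. Proof. exact: mxtens_unindexK. Qed.

Lemma loc_idxE a b x : loc_idx a b x = pair4 (bits x a, bits x b).
Proof.
apply/ord_inj; rewrite /loc_idx !ffunE inordK /=; last by case: (bit x a); case: (bit x b).
by rewrite !val_i2 mulnC.
Qed.

Lemma kron2E p q i j k l :
  kron2 p q (pair4 (i, j)) (pair4 (k, l)) = p i k * q j l.
Proof. exact: tensmxE. Qed.

Lemma embed_kron2 a b p q : a != b ->
  embed_gate a b (kron2 p q) = kron_layer (on_pair a b p q).
Proof.
move=> ab; apply/matrixP => x y; rewrite !mxE !loc_idxE.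
rewrite (bigD1 a) //= (bigD1 b) 1?eq_sym //= {1 2}/on_pair eqxx eq_sym (negbTE ab) eqxx.
have -> : \prod_(i | (i != a) && (i != b)) on_pair a b p q i (bits x i) (bits y i) =
  \prod_(i | (i != a) && (i != b)) (bit x i == bit y i)%:R.
  by apply: eq_bigr => i /andP[/negbTE ia /negbTE ib]; rewrite /on_pair ia ib mxE bits_eq.
rewrite (prod_delta (fun i => (i != a) && (i != b))) mulrA.
by case: ifP => _; rewrite ?mulr1 ?mulr0 // -(kron2E p q (bits x a)) !mxE.
Qed.

Lemma embed_is_linear a b : linear (@embed_gate R n a b).
Proof.
move=> c M N; apply/matrixP => x y; rewrite !mxE.
by case: ifP => _; rewrite ?mxE // mulr0 addr0.
Qed.

HB.instance Definition _ a b := GRing.isLinear.Build C 'M[C]_4 'M[C]_(2 ^ n) _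
  (@embed_gate R n a b) (embed_is_linear a b).

(** Matrix units are Kronecker products, so an identity linear in the gate need only be checked on
    product gates, whose embedding is a [kron_layer]. *)
Lemma kron2_ind (Q : 'M[C]_4 -> Prop) : Q 0 ->
  (forall c M N, Q M -> Q N -> Q (c *: M + N)) -> (forall p q, Q (kron2 p q)) ->
  forall g, Q g.
Proof.
move=> Q0 QL Qk g; rewrite [g]matrix_sum_delta.
have QD M N : Q M -> Q N -> Q (M + N) by move=> QM QN; rewrite -[M]scale1r; exact: QL.
apply: big_ind => // i _; apply: big_ind => // j _.
rewrite -[X in Q X]addr0; apply: QL => //.
rewrite -(unpair4K i) -(unpair4K j); case: (unpair4 i) (unpair4 j) => [i1 j1] [i0 j2].
suff -> : delta_mx (pair4 (i1, j1)) (pair4 (i0, j2)) =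
  kron2 (delta_mx i1 i0) (delta_mx j1 j2) by exact: Qk.
apply/matrixP => k l; rewrite -(unpair4K k) -(unpair4K l).
case: (unpair4 k) (unpair4 l) => [k1 k2] [l1 l2].
rewrite kron2E !mxE !(can_eq pair4K) -natrM mulnb !xpair_eqE.
by congr (nat_of_bool _)%:R; rewrite andbACA.
Qed.

Lemma kron2M p q p' q' : kron2 p q *m kron2 p' q' = kron2 (p *m p') (q *m q').
Proof. exact (tensmx_mul p q p' q'). Qed.

Lemma kron2_11 : kron2 1%:M 1%:M = 1%:M.
Proof.
apply/matrixP => k l; rewrite -(unpair4K k) -(unpair4K l).
case: (unpair4 k) (unpair4 l) => [k1 k2] [l1 l2].
by rewrite kron2E !mxE (can_eq pair4K) -natrM mulnb.
Qed.

Lemma embedM a b g h : a != b ->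
  embed_gate a b g *m embed_gate a b h = embed_gate a b (g *m h).
Proof.
move=> ab; elim/kron2_ind: g => [|c M N IM IN|p q]; rewrite ?linear0 ?mul0mx ?linear0 //.
  by rewrite linearP mulmxDl -scalemxAl IM IN mulmxDl -scalemxAl linearP.
elim/kron2_ind: h => [|c M N IM IN|p' q']; rewrite ?linear0 ?mulmx0 ?linear0 //.
  by rewrite linearP mulmxDr -scalemxAr IM IN mulmxDr -scalemxAr linearP.
rewrite kron2M !embed_kron2 // kron_layerM; apply: eq_kron_layer => r.
by rewrite /on_pair; do 2?case: ifP => _ //; rewrite mulmx1.
Qed.

Lemma embed1 a b : a != b -> embed_gate a b (1%:M : 'M[C]_4) = 1%:M.
Proof.
move=> ab; rewrite -kron2_11 embed_kron2 // kron_layer1 // => r.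
by rewrite /on_pair; do 2?case: ifP => _ //.
Qed.

Lemma embed_comm a b g u : a != b -> u a = 1%:M -> u b = 1%:M ->
  embed_gate a b g *m kron_layer u = kron_layer u *m embed_gate a b g.
Proof.
move=> ab ua ub; elim/kron2_ind: g => [|c M N IM IN|p q].
- by rewrite linear0 mul0mx mulmx0.
- by rewrite linearP mulmxDl mulmxDr -scalemxAl -scalemxAr IM IN.
- rewrite embed_kron2 // !kron_layerM; apply: eq_kron_layer => r.
  rewrite /on_pair; have [->|_] := eqVneq r a; first by rewrite ua mul1mx mulmx1.
  by have [->|_] := eqVneq r b; rewrite ?ub mul1mx mulmx1.
Qed.

Lemma embed_adj a b g : adjmx (embed_gate a b g) = embed_gate a b (adjmx g) :> 'M[C]_(2 ^ n).
Proof.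
apply/matrixP => x y; rewrite !mxE.
under eq_forallb do rewrite [bit y _ == _]eq_sym.
by case: ifP => _; rewrite ?mxE ?conjC0.
Qed.

Lemma kron_layer_split a b u : a != b ->
  kron_layer u = embed_gate a b (kron2 (u a) (u b)) *m
    kron_layer (fun q => if (q == a) || (q == b) then 1%:M else u q).
Proof.
move=> ab; rewrite embed_kron2 // kron_layerM; apply: eq_kron_layer => r.
rewrite /on_pair; have [->|_] := eqVneq r a; first by rewrite mulmx1.
by have [->|_] := eqVneq r b; rewrite ?mulmx1 ?mul1mx.
Qed.

End Kronecker.

(** * Pauli matrices and Clifford gates *)

Section Adjoint.
Variable R : realType.
Local Notation C := R[i].

Lemma adjmxM k (A B : 'M[C]_k) : adjmx (A *m B) = adjmx B *m adjmx A.
Proof.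
apply/matrixP => x y; rewrite !mxE rmorph_sum; apply: eq_bigr => z _.
by rewrite !mxE rmorphM mulrC.
Qed.

Lemma adjmxK k : involutive (@adjmx R k).
Proof. by move=> A; apply/matrixP => x y; rewrite !mxE conjCK. Qed.

Lemma adjmxD k (A B : 'M[C]_k) : adjmx (A + B) = adjmx A + adjmx B.
Proof. by apply/matrixP => x y; rewrite !mxE rmorphD. Qed.

Lemma adjmxZ k a (A : 'M[C]_k) : adjmx (a *: A) = a^* *: adjmx A.
Proof. by apply/matrixP => x y; rewrite !mxE rmorphM. Qed.

Lemma adjmx1 k : adjmx 1%:M = 1%:M :> 'M[C]_k.
Proof. by apply/matrixP => x y; rewrite !mxE rmorph_nat eq_sym. Qed.

Lemma det_adjmx k (A : 'M[C]_k) : \det (adjmx A) = (\det A)^*.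
Proof.
rewrite -det_map_mx -det_tr; congr (\det _).
by apply/matrixP => x y; rewrite !mxE.
Qed.

Lemma is_SUM k (A B : 'M[C]_k) : is_SU A -> is_SU B -> is_SU (A *m B).
Proof.
move=> /andP[/eqP A1 /eqP dA] /andP[/eqP B1 /eqP dB].
rewrite /is_SU adjmxM det_mulmx dA dB mulr1 eqxx andbT.
by rewrite mulmxA -(mulmxA A) B1 mulmx1 A1.
Qed.

Lemma is_SU1 k : is_SU (1%:M : 'M[C]_k).
Proof. by rewrite /is_SU adjmx1 mulmx1 det1 !eqxx. Qed.

Lemma is_SU_adj k (A : 'M[C]_k) : is_SU A -> is_SU (adjmx A).
Proof.
move=> /andP[/eqP A1 /eqP dA].
by rewrite /is_SU adjmxK (mulmx1C A1) det_adjmx dA conjC1 !eqxx.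
Qed.

(** A root of the inverse determinant has modulus 1. Conjugation relations do not see this phase, so
    Clifford gates may be built as mere unitaries. *)
Lemma unitary_phase k (A : 'M[C]_k.+1) : A *m adjmx A = 1%:M ->
  exists z : C, z * z^* = 1 /\ is_SU (z *: A).
Proof.
move=> A1; set d := \det A.
have dd : d * d^* = 1 by rewrite /d -det_adjmx -det_mulmx A1 det1.
have d0 : d != 0 by apply: contra_eq_neq dd => ->; rewrite mul0r eq_sym oner_eq0.
pose z := k.+1.-root d^-1.
have zk : z ^+ k.+1 = d^-1 by rewrite rootCK.
have zz : z * z^* = 1.
  rewrite -normCK; suff -> : `|z| = 1 by rewrite expr1n.
  apply: (@pexpIrn _ k.+1) => //; rewrite ?nnegrE ?normr_ge0 ?ler01 //.
  rewrite -normrX zk expr1n normrV ?unitfE //.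
  suff -> : `|d| = 1 by rewrite invr1.
  by apply: (@pexpIrn _ 2) => //; rewrite ?nnegrE ?normr_ge0 ?ler01 // normCK dd expr1n.
exists z; split=> //; apply/andP; split; apply/eqP.
  by rewrite adjmxZ -scalemxAr -scalemxAl scalerA A1 mulrC zz scale1r.
by rewrite detZ zk mulVf.
Qed.

End Adjoint.

Section Pauli1.
Variable R : realType.
Local Notation C := R[i].
Local Notation ltr := (bool * bool)%type.

(* The letter (x, z) encodes the Pauli matrix X^x Z^z, with a factor i when x = z = 1 to
   make it Hermitian, so that anticommutation is a symplectic form. *)
Definition sigma (s : ltr) : 'M[C]_2 := \matrix_(i, j)
  if (i != j) == s.1 then
    (if s.2 && (j == 1) then -1 else 1) * (if s.1 && s.2 then Complex 0 1 else 1)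
  else 0.

Definition anti (s t : ltr) : bool := (s.1 && t.2) (+) (s.2 && t.1).

Lemma ord2P (k : 'I_2) : k = 0 \/ k = 1.
Proof. by case: k => [[|[|//]] H]; [left|right]; apply/val_inj. Qed.

Lemma mx2P (A B : 'M[C]_2) : A 0 0 = B 0 0 -> A 0 1 = B 0 1 -> A 1 0 = B 1 0 ->
  A 1 1 = B 1 1 -> A = B.
Proof.
move=> h1 h2 h3 h4; apply/matrixP => i j.
by case: (ord2P i) (ord2P j) => -> [] ->.
Qed.

Lemma sum_ord2 (V : nmodType) (F : 'I_2 -> V) : \sum_i F i = F 0 + F 1.
Proof. by rewrite !big_ord_recl big_ord0 addr0; congr (_ + F _); apply/val_inj. Qed.

Lemma sigma1 : sigma (false, false) = 1%:M.
Proof. by apply: mx2P; rewrite !mxE /= ?mulr1. Qed.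

Lemma sigmaK s : sigma s *m sigma s = 1%:M.
Proof.
by case: s => [[] []]; apply: mx2P; rewrite !mxE sum_ord2 !mxE /=; apply/eqP;
  rewrite eq_complex /=; apply/andP; split; apply/eqP; ring.
Qed.

Lemma sigma_adj s : adjmx (sigma s) = sigma s.
Proof.
by case: s => [[] []]; apply: mx2P; rewrite !mxE /=; apply/eqP;
  rewrite eq_complex /=; apply/andP; split; apply/eqP; rewrite /=; ring.
Qed.

Lemma sigma_anti s t : sigma s *m sigma t = (-1) ^+ anti s t *: (sigma t *m sigma s).
Proof.
by case: s => [[] []]; case: t => [[] []]; apply: mx2P; rewrite !mxE !sum_ord2 !mxE /=;
 apply/eqP; rewrite eq_complex /=; apply/andP; split; apply/eqP; ring.
Qed.

Lemma sum_ltr (V : nmodType) (F : ltr -> V) :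
  \sum_s F s = F (true, true) + F (true, false) + (F (false, true) + F (false, false)).
Proof.
rewrite (eq_bigr (fun p => F (p.1, p.2))); last by case.
by rewrite -(pair_bigA _ (fun a b => F (a, b))) /= !big_bool.
Qed.

(** Completeness and, next, orthogonality of the Pauli basis for the Hilbert-Schmidt product; both
    factor over qubits, which yields the relations for Pauli strings. *)
Lemma sigma_complete i j k l :
  \sum_s sigma s i j * (sigma s k l)^* = 2%:R * (i == k)%:R * (j == l)%:R.
Proof.
rewrite sum_ltr.
by case: (ord2P i) (ord2P j) (ord2P k) (ord2P l) => -> [] -> [] -> [] ->; rewrite !mxE /=;
 apply/eqP; rewrite eq_complex /=; apply/andP; split; apply/eqP; rewrite /=; ring.
Qed.

Lemma sigma_orth s t :
  \sum_i \sum_j sigma s i j * (sigma t i j)^* = 2%:R * (s == t)%:R.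
Proof.
by rewrite !sum_ord2; case: s => [[] []]; case: t => [[] []]; rewrite !mxE /=;
 apply/eqP; rewrite eq_complex /=; apply/andP; split; apply/eqP; rewrite /=; ring.
Qed.

End Pauli1.

Section Clifford.
Variable R : realType.
Local Notation C := R[i].
Local Notation ltr := (bool * bool)%type.
Implicit Types s t d : ltr * ltr.

Definition pauli2 s : 'M[C]_4 := kron2 (sigma R s.1) (sigma R s.2).

Definition anti2 s t : bool := anti s.1 t.1 (+) anti s.2 t.2.

Definition ltr0 : ltr := (false, false).

Lemma adj_kron2 (p q : 'M[C]_2) : adjmx (kron2 p q) = kron2 (adjmx p) (adjmx q).
Proof.
apply/matrixP => k l; rewrite -(unpair4K k) -(unpair4K l).
case: (unpair4 k) (unpair4 l) => [k1 k2] [l1 l2].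
by rewrite mxE !kron2E !mxE rmorphM.
Qed.

Lemma kron2Zl (a : C) p q : kron2 (a *: p) q = a *: kron2 p q.
Proof.
apply/matrixP => k l; rewrite -(unpair4K k) -(unpair4K l).
case: (unpair4 k) (unpair4 l) => [k1 k2] [l1 l2].
by rewrite [RHS]mxE !kron2E !mxE mulrA.
Qed.

Lemma kron2Zr (a : C) p q : kron2 p (a *: q) = a *: kron2 p q.
Proof.
apply/matrixP => k l; rewrite -(unpair4K k) -(unpair4K l).
case: (unpair4 k) (unpair4 l) => [k1 k2] [l1 l2].
by rewrite [RHS]mxE !kron2E !mxE mulrCA.
Qed.

Lemma pauli2K s : pauli2 s *m pauli2 s = 1%:M.
Proof. by rewrite kron2M !sigmaK kron2_11. Qed.

Lemma pauli2_adj s : adjmx (pauli2 s) = pauli2 s.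
Proof. by rewrite adj_kron2 !sigma_adj. Qed.

Lemma pauli2_anti s t :
  pauli2 s *m pauli2 t = (-1) ^+ anti2 s t *: (pauli2 t *m pauli2 s).
Proof.
rewrite !kron2M sigma_anti [sigma R s.2 *m _]sigma_anti kron2Zl kron2Zr scalerA.
by rewrite -signr_addb.
Qed.

(* The Clifford gate is (1 + ts)/sqrt 2, rescaled by a phase to have determinant 1. *)
Lemma clifford_step s t : anti2 s t -> exists2 c : 'M[C]_4, is_SU c &
  c *m pauli2 s = pauli2 t *m c.
Proof.
move=> st; set A := pauli2 s; set B := pauli2 t.
have AB : A *m B = - (B *m A) by rewrite /A /B pauli2_anti st scaleN1r.
have AA : A *m A = 1%:M := pauli2K s. have BB : B *m B = 1%:M := pauli2K t.
pose k : C := (sqrtC 2)^-1; pose c := k *: (1%:M + B *m A).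
have k0 : 0 <= k by rewrite invr_ge0 sqrtC_ge0 ler0n.
have kk : k * k^* *+ 2 = 1.
  by rewrite (CrealP (ger0_real k0)) -expr2 exprVn sqrtCK -mulr_natr mulVf ?pnatr_eq0.
have c1 : c *m adjmx c = 1%:M.
  rewrite /c adjmxZ adjmxD adjmx1 adjmxM !pauli2_adj -/A -/B.
  rewrite -scalemxAr -scalemxAl scalerA mulmxDl mul1mx mulmxDr mulmx1.
  rewrite -mulmxA (mulmxA A) AA mul1mx BB AB addrA subrK.
  by rewrite -mulr2n -scaler_nat scalerA mulr_natr [k^* * k]mulrC kk scale1r.
have [z [_ zc]] := unitary_phase c1.
exists (z *: c) => //; rewrite -scalemxAl -scalemxAr; congr (_ *: _).
rewrite /c -scalemxAl -scalemxAr; congr (_ *: _).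
by rewrite mulmxDl mulmxDr mul1mx mulmx1 -mulmxA AA mulmx1 mulmxA BB mul1mx addrC.
Qed.

(** [anti2] is a nondegenerate symplectic form on F_2^4. For distinct nonzero s and t the
    functionals it defines are independent, so both can be given the value 1; for s = t they
    coincide. Two commuting strings are thus linked by two Clifford steps. *)
Lemma common_anti s t : s != (ltr0, ltr0) -> t != (ltr0, ltr0) ->
  exists d, anti2 s d && anti2 d t.
Proof.
suff : forall s1 s2 s3 s4 t1 t2 t3 t4 : bool,
    let s := ((s1, s2), (s3, s4)) in let t := ((t1, t2), (t3, t4)) in
    s != (ltr0, ltr0) -> t != (ltr0, ltr0) ->
    has (fun d => anti2 s d && anti2 d t)
      [seq (x, y) | x <- [:: ltr0; (true, false); (false, true); (true, true)],
                    y <- [:: ltr0; (true, false); (false, true); (true, true)]].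
  case: s => [[s1 s2] [s3 s4]]; case: t => [[t1 t2] [t3 t4]] H h1 h2.
  by have /hasP[d _ Hd] := H _ _ _ _ _ _ _ _ h1 h2; exists d.
by do 8!case.
Qed.

Lemma clifford_move s t : s != (ltr0, ltr0) -> t != (ltr0, ltr0) ->
  exists2 c : 'M[C]_4, is_SU c & c *m pauli2 s = pauli2 t *m c.
Proof.
move=> s0 t0; have [d /andP[/clifford_step[c c1 cE] /clifford_step[c' c1' cE']]] :=
  common_anti s0 t0.
exists (c' *m c); first exact: is_SUM.
by rewrite -mulmxA cE mulmxA cE' mulmxA.
Qed.

(** This is exp(i theta P) with tan theta = x: up to a positive scalar, the rotation is polynomial
    in x. *)
Lemma rotation_SU s (x : R) : s != (ltr0, ltr0) ->
  is_SU ((Num.sqrt (1 + x ^+ 2))^-1%:C%C *: (1%:M + Complex 0 x *: pauli2 s)).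
Proof.
move=> s0; set k := (_^-1)%R.
have x1 : 0 < 1 + x ^+ 2 by rewrite ltr_wpDr ?ltr01 ?sqr_ge0.
have kk : k ^+ 2 * (1 + x ^+ 2) = 1 by rewrite exprVn sqr_sqrtr ?ltW // mulVf ?gt_eqF.
apply/andP; split; apply/eqP.
  rewrite adjmxZ adjmxD adjmx1 adjmxZ pauli2_adj -scalemxAr -scalemxAl scalerA.
  rewrite mulmxDl mul1mx mulmxDr mulmx1 -scalemxAl -scalemxAr pauli2K addrACA.
  rewrite addrA addrAC.
  have -> : (Complex 0 x)^* = - Complex 0 x :> C by apply/eqP; rewrite eq_complex /= oppr0 !eqxx.
  rewrite !scaleNr addrAC addrK scalerN scalerA.
  have -> : 1%:M - (Complex 0 x * Complex 0 x) *: 1%:M = (1 + x ^+ 2)%:C%C *: 1%:M :> 'M[C]_4.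
    rewrite -{1}[1%:M]scale1r -scalerBl; congr (_ *: _).
    by apply/eqP; rewrite eq_complex /=; apply/andP; split; apply/eqP; ring.
  rewrite scalerA -{2}[1%:M]scale1r; congr (_ *: _).
  apply/eqP; rewrite eq_complex /=; apply/andP; split; apply/eqP; last ring.
  by rewrite -[RHS]kk; ring.
(* A Clifford conjugation reduces the determinant to that of Z on the first qubit, where the matrix
   is diagonal with entries 1 + i x and 1 - i x, each twice. *)
have [c cU cE] := clifford_move s0 (isT : ((false, true), ltr0) != (ltr0, ltr0)).
have /andP[/eqP c1 /eqP dc] := cU.
rewrite detZ.
have -> : \det (1%:M + Complex 0 x *: pauli2 s) =
  \det (1%:M + Complex 0 x *: pauli2 ((false, true), ltr0)).
  have E : c *m (1%:M + Complex 0 x *: pauli2 s) =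
      (1%:M + Complex 0 x *: pauli2 ((false, true), ltr0)) *m c.
    by rewrite mulmxDr mulmxDl mulmx1 mul1mx -scalemxAr -scalemxAl cE.
  by have := congr1 determinant E; rewrite !det_mulmx dc mul1r mulr1.
set D := (1%:M + _)%R.
have -> : D = diag_mx (\row_j (if (j < 2)%N then Complex 1 x else Complex 1 (- x))).
  apply/matrixP => k' l; rewrite -(unpair4K k') -(unpair4K l).
  case: (unpair4 k') (unpair4 l) => [k1 k2] [l1 l2].
  rewrite /D /pauli2 [LHS]mxE [X in _ + X]mxE kron2E !mxE (can_eq pair4K).
  case: (ord2P k1) (ord2P k2) (ord2P l1) (ord2P l2) => -> [] -> [] -> [] -> /=;
  by apply/eqP; rewrite eq_complex /=; apply/andP; split; apply/eqP; ring.
rewrite det_diag !big_ord_recl big_ord0 !mxE /=.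
apply/eqP; rewrite eq_complex; apply/andP; split; apply/eqP; last by rewrite /=; ring.
by rewrite /= -[RHS](expr1n _ 2) -[in RHS]kk /=; ring.
Qed.

End Clifford.

(** * Pauli rotations implemented by causal slices *)

Section Slice.
Variables (R : realType) (n : nat).
Local Notation C := R[i].
Local Notation ltr := (bool * bool)%type.
Implicit Types (s : {ffun 'I_n -> ltr}) (t a b : 'I_n) (S : architecture n).

Definition pauli s : 'M[C]_(2 ^ n) := kron_layer (fun q => sigma R (s q)).

(** A directed path starts at one qubit, so what is reached from a union is reached from one of its
    parts. *)
Lemma light_cone_catU S (X Y : {set 'I_n}) t :
  let lc := foldl (fun (X : {set 'I_n}) (p : 'I_n * 'I_n) =>
     if (p.1 \in X) || (p.2 \in X) then (p.1 |: (p.2 |: X))%SET else X) in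
  t \in lc (X :|: Y)%SET S -> (t \in lc X S) || (t \in lc Y S).
Proof.
elim: S X Y => [|p S IH] X Y /=; first by rewrite inE.
rewrite -/foldl => H; apply: IH; move: H; rewrite !inE.
have [pX|pX] := boolP ((p.1 \in X) || (p.2 \in X));
  have [pY|pY] := boolP ((p.1 \in Y) || (p.2 \in Y)).
- by rewrite orbACA pX /= finset.setUACA finset.setUid finset.setUACA finset.setUid.
- by rewrite orbACA pX /= !finset.setUA.
- by rewrite orbACA pY orbT /= (finset.setUCA X) (finset.setUCA X [set p.2]%SET).
- by rewrite orbACA (negbTE pX) (negbTE pY).
Qed.

Lemma light_cone_self S t : t \in light_cone S t.
Proof.
rewrite /light_cone; have : t \in [set t]%SET by rewrite inE.
move: ([set t]%SET) => X; elim: S X => //= p S IH X tX.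
by apply: IH; case: ifP => // _; rewrite !inE tX !orbT.
Qed.

(** Past the gate, the cone of either input is that of both outputs, so [t] remains reachable from
    one of them. The Pauli string will be moved to that output. *)
Lemma light_cone_cons_hit S a b t :
  (t \in light_cone ((a, b) :: S) a) || (t \in light_cone ((a, b) :: S) b) ->
  (t \in light_cone S a) || (t \in light_cone S b).
Proof.
rewrite /light_cone /= !inE !eqxx orbT /= => H; apply: light_cone_catU.
move: H; rewrite finset.setUid; have -> : (a |: (b |: [set a]) = a |: [set b])%SET.
  by apply/setP => q; rewrite !inE orbCA orbb orbC.
by rewrite orbb.
Qed.

Lemma light_cone_cons_miss S a b q : q != a -> q != b ->
  light_cone ((a, b) :: S) q = light_cone S q.
Proof.
by move=> qa qb; rewrite /light_cone /= !inE eq_sym (negbTE qa) eq_sym (negbTE qb).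
Qed.

Lemma circuit_unitary_cons a b (g : 'M[C]_4) (c : circuit R n) :
  circuit_unitary (((a, b), g) :: c) = circuit_unitary c *m embed_gate a b g.
Proof. by []. Qed.

Lemma circuit_unitary_id S : wf_arch S ->
  circuit_unitary (zip S (nseq (size S) (1%:M : 'M[C]_4))) = 1%:M.
Proof.
elim: S => [|[a b] S IH] //= /andP[ab wS].
by rewrite ?circuit_unitary_cons IH // mul1mx embed1.
Qed.

Lemma pauli_split s a b : a != b -> pauli s =
  embed_gate a b (pauli2 R (s a, s b)) *m
    kron_layer (fun q => if (q == a) || (q == b) then 1%:M else sigma R (s q)).
Proof. by move=> ab; rewrite /pauli (kron_layer_split _ ab). Qed.

(* A gate touching the support of the current Pauli string shrinks that support inside the
   gate to one qubit still connected to t, by a Clifford gate; the rotation is performed at the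
   first gate that contains the whole support. Each circuit unitary is only proportional to
   the stated one because 1 + ixP is not normalised. *)
Lemma slice_rotation t S s : wf_arch S -> (exists q, s q != ltr0) ->
  (forall q, s q != ltr0 -> t \in light_cone S q) ->
  has (fun p => (p.1 == t) || (p.2 == t)) S || [exists q, (q != t) && (s q != ltr0)] ->
  exists2 V : 'M[C]_(2 ^ n), V *m adjmx V = 1%:M &
  forall x : R, exists (gs : seq 'M[C]_4) (r : R),
    [/\ size gs = size S, all (@is_SU R 4) gs, r != 0 &
    circuit_unitary (zip S gs) = r%:C%C *: (V *m (1%:M + Complex 0 x *: pauli s))].
Proof.
elim: S s => [|[a b] S IH] s /=.
  (* The last disjunction keeps the induction from running out of gates: with none left, a supported
     qubit other than [t] would have to reach [t] through no gate. *)
  move=> _ _ H /existsP[q /andP[qt sq]].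
  by have := H q sq; rewrite /light_cone /= inE eq_sym (negbTE qt).
move=> /andP[ab wS] [q0 sq0] reach hit.
have [/forallP local|] := boolP [forall q, (s q != ltr0) ==> ((q == a) || (q == b))].
  exists 1%:M; first by rewrite adjmx1 mulmx1.
  move=> x; have s0 : (s a, s b) != (ltr0, ltr0).
    rewrite xpair_eqE negb_and; have /implyP/(_ sq0)/orP[/eqP<-|/eqP<-] := local q0;
    by rewrite sq0 ?orbT.
  exists ((Num.sqrt (1 + x ^+ 2))^-1%:C%C *: (1%:M + Complex 0 x *: pauli2 R (s a, s b))
     :: nseq (size S) 1%:M), (Num.sqrt (1 + x ^+ 2))^-1.
  split; rewrite /= ?size_nseq //.
  - by rewrite rotation_SU //= all_nseq is_SU1 orbT.
  - by rewrite invr_eq0 gt_eqF // sqrtr_gt0 ltr_wpDr ?ltr01 ?sqr_ge0.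
  - rewrite ?circuit_unitary_cons circuit_unitary_id // !mul1mx linearZ linearD linearZ /=.
    rewrite (@embed1 R n a b ab) (pauli_split _ ab) [kron_layer _]kron_layer1 ?mulmx1 => [//|q].
    case: ifP => // /negbT qab; have := local q; rewrite (negbTE qab) implybF negbK.
    by move=> /eqP->; rewrite sigma1.
rewrite negb_forall => /existsP[q1]; rewrite negb_imply negb_or.
move=> /andP[sq1 /andP[q1a q1b]].
(* Here the gate misses the support and is set to the identity. If it acts on [t], then the support
   avoids [t], so the disjunction survives. *)
have [/andP[/eqP sa /eqP sb]|sab] := boolP ((s a == ltr0) && (s b == ltr0)).
  have miss q : s q != ltr0 -> q != a /\ q != b.
    by split; apply: contraNneq H => ->; rewrite ?sa ?sb.
  have [|q sq||V V1 HV] := IH s wS; first by exists q0.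
  - by have [qa qb] := miss q sq; rewrite -(light_cone_cons_miss S qa qb) reach.
  - case/orP: hit => [/orP[tab|->//]|->]; last by rewrite orbT.
    apply/orP; right; apply/existsP; exists q0; rewrite sq0 andbT.
    by have [qa qb] := miss _ sq0; case/orP: tab => /eqP<-.
  exists V => // x; have [gs [r [sz SU r0 E]]] := HV x.
  exists (1%:M :: gs), r; split; rewrite /= ?sz //; first by rewrite is_SU1.
  by rewrite ?circuit_unitary_cons E embed1 // mulmx1.
have [e [eab te]] : exists e, ((e == a) || (e == b)) /\ t \in light_cone S e.
  have /orP[?|?] : (t \in light_cone S a) || (t \in light_cone S b).
  - apply: light_cone_cons_hit; move: sab; rewrite negb_and.
    by case/orP => /reach ->; rewrite ?orbT.
  - by exists a; rewrite eqxx.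
  - by exists b; rewrite eqxx orbT.
(* The part of the string inside the gate becomes a single Z on the output [e] that still reaches
   [t]. *)
pose s' := [ffun q => if q == e then (false, true) else
  if (q == a) || (q == b) then ltr0 else s q].
have s'ab : (s' a, s' b) != (ltr0, ltr0).
  rewrite xpair_eqE negb_and !ffunE; by case/orP: eab => /eqP->; rewrite !eqxx /= ?orbT.
have sab' : (s a, s b) != (ltr0, ltr0) by rewrite xpair_eqE.
have [c cU cE] := clifford_move R sab' s'ab.
have [|q||V V1 HV] := IH s' wS.
- by exists e; rewrite ffunE eqxx.
- rewrite ffunE; have [->//|_] := eqVneq q e; case: ifP => // /negbT.
  by rewrite negb_or => /andP[qa qb] sq; rewrite -(light_cone_cons_miss S qa qb) reach.
(* [q1] is supported outside the gate and witnesses the disjunction, unless it is [t]; in that case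
   [e], which lies inside the gate, differs from [t]. *)
- apply/orP; right; apply/existsP.
  have [q1t|q1t] := eqVneq q1 t.
    exists e; rewrite ffunE eqxx andbT -q1t.
    by case/orP: eab => /eqP->; rewrite eq_sym.
  exists q1; rewrite q1t ffunE; case: ifP => // _.
  by rewrite (negbTE q1a) (negbTE q1b).
exists (V *m embed_gate a b c).
  have /andP[/eqP c1 _] := cU.
  by rewrite adjmxM mulmxA -(mulmxA V) embed_adj embedM // c1 embed1 // mulmx1.
move=> x; have [gs [r [sz SU r0 E]]] := HV x.
exists (c :: gs), r; split; [by rewrite /= sz|by rewrite /= cU|by []|].
rewrite /= -/(circuit_unitary _) E -scalemxAl -!mulmxA; congr (_ *: (_ *m _)).
rewrite mulmxDl mulmxDr mul1mx mulmx1 -scalemxAl -scalemxAr; congr (_ + _ *: _).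
rewrite !(pauli_split _ ab) mulmxA embedM // cE -embedM // -!mulmxA.
congr (_ *m _); rewrite embed_comm //=; rewrite ?eqxx ?orbT //.
congr (_ *m _); apply: eq_kron_layer => q; case: ifP => // /negbT.
rewrite negb_or ffunE => /andP[qa qb].
by case/orP: eab => /eqP->; rewrite (negbTE qa) (negbTE qb).
Qed.

Lemma causal_rotation S s : (1 < n)%N -> wf_arch S -> causal_slice S ->
  (exists q, s q != ltr0) ->
  exists2 V : 'M[C]_(2 ^ n), V *m adjmx V = 1%:M &
  forall x : R, exists (gs : seq 'M[C]_4) (r : R),
    [/\ size gs = size S, all (@is_SU R 4) gs, r != 0 &
    circuit_unitary (zip S gs) = r%:C%C *: (V *m (1%:M + Complex 0 x *: pauli s))].
Proof.
move=> n1 wS [t Ht] s0; apply: (@slice_rotation t) => //.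
  by move=> q _; have [->|qt] := eqVneq q t; [exact: light_cone_self|exact: Ht].
(* Another qubit exists and must reach [t], so some gate of the slice acts on [t]. *)
apply/orP; left; have [t' t't] : exists t' : 'I_n, t' != t.
  have [t0|t0] := eqVneq (val t) 0%N; [exists (Ordinal n1)|exists (Ordinal (ltnW n1))];
  by rewrite -(inj_eq val_inj) /= ?t0 // eq_sym.
have := Ht t' t't; rewrite /light_cone; have : t \notin [set t']%SET by rewrite inE eq_sym.
move: [set t']%SET; elim: {wS Ht} S => [|p S IH] X /= tX; first by rewrite (negbTE tX).
have [//|/= pt] := boolP ((p.1 == t) || (p.2 == t)).
apply: IH; case: ifP => // _; rewrite !inE (negbTE tX) orbF.
by rewrite eq_sym [t == _]eq_sym.
Qed.

End Slice.

(** * Tangent directions and families of circuits *)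

Section RealSpace.
Variables (R : realType) (p m : nat).
Local Notation C := R[i].
Local Notation E := 'M[C]_(p, m).

Definition real_linear (f : E -> R) : Prop :=
  (forall A B, f (A + B) = f A + f B) /\ (forall (x : R) A, f (x%:C%C *: A) = x * f A).

(** Real coordinates: independence over the reals becomes a statement about ranks of real
    matrices. *)
Definition rvec (A : E) : 'rV[R]_(p * m + p * m) :=
  row_mx (mxvec (map_mx (@complex.Re R) A)) (mxvec (map_mx (@complex.Im R) A)).

Lemma rvecD A B : rvec (A + B) = rvec A + rvec B.
Proof.
rewrite /rvec add_row_mx -!linearD; congr (row_mx (mxvec _) (mxvec _));
by apply/matrixP => i j; rewrite !mxE; case: (A i j) (B i j) => ? ? [].
Qed.

Lemma rvecZ (x : R) A : rvec (x%:C%C *: A) = x *: rvec A.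
Proof.
rewrite /rvec scale_row_mx -!linearZ; congr (row_mx (mxvec _) (mxvec _));
by apply/matrixP => i j; rewrite !mxE; case: (A i j) => ? ? /=; ring.
Qed.

Lemma rvec_eq0 A : rvec A = 0 -> A = 0.
Proof.
rewrite /rvec -[0]row_mx0 => /eq_row_mx[/eqP H1 /eqP H2].
move: H1 H2; rewrite !mxvec_eq0 => /eqP/matrixP H1 /eqP/matrixP H2.
apply/matrixP => i j; have := H1 i j; have := H2 i j; rewrite !mxE.
by case: (A i j) => x y /= -> ->.
Qed.

Lemma rvec_sum (I : finType) (c : I -> R) (v : I -> E) :
  rvec (\sum_j (c j)%:C%C *: v j) = \sum_j c j *: rvec (v j).
Proof.
elim/big_rec2: _ => [|j x y _ <-]; last by rewrite rvecD rvecZ.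
by rewrite -[RHS](scale0r (rvec 0)) -rvecZ scaler0.
Qed.

Lemma real_linear_rvec (F : 'cV[R]_(p * m + p * m)) :
  real_linear (fun A => (rvec A *m F) 0 0).
Proof.
by split=> [A B|x A]; rewrite ?rvecD ?mulmxDl ?rvecZ -?scalemxAl mxE.
Qed.

Lemma real_linear_sum f (I : finType) (c : I -> R) (v : I -> E) : real_linear f ->
  f (\sum_j (c j)%:C%C *: v j) = \sum_j c j * f (v j).
Proof.
move=> [fD fZ]; elim/big_rec2: _ => [|j x y _ <-]; last by rewrite fD fZ.
by rewrite -[RHS](mul0r (f 0)) -fZ scaler0.
Qed.

Definition real_free k (v : nat -> E) : Prop := forall c : 'I_k -> R,
  \sum_j (c j)%:C%C *: v j = 0 -> forall j, c j = 0.

(** The columns of a right inverse of the coordinate matrix are the dual functionals. *)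
Lemma real_free_dual k v : real_free k v ->
  exists f : 'I_k -> E -> R, (forall i, real_linear (f i)) /\
    forall i j : 'I_k, f i (v j) = (i == j)%:R.
Proof.
move=> vfree; pose V := \matrix_(j < k) rvec (v j).
have /row_freeP[F VF] : row_free V.
  apply: inj_row_free => c cV; apply/rowP => j; rewrite mxE.
  apply: (vfree (fun j => c 0 j)); apply: rvec_eq0.
  rewrite rvec_sum; transitivity (c *m V); last exact: cV.
  by rewrite mulmx_sum_row; apply: eq_bigr => j' _; rewrite rowK.
exists (fun i A => (rvec A *m col i F) 0 0); split=> [i|i j].
  exact: real_linear_rvec.
have -> : rvec (v j) = row j V by rewrite rowK.
have /matrixP/(_ j i) := VF; rewrite !mxE eq_sym => <-.
by apply: eq_bigr => l _; rewrite [row _ _ _ _]mxE [col _ _ _ _]mxE.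
Qed.

Lemma real_dim_bound k N (v : 'I_k -> E) (t : 'I_N -> E) :
  (forall s, exists c : 'I_k -> R, t s = \sum_j (c j)%:C%C *: v j) ->
  (\rank (\matrix_s rvec (t s)) <= k)%N.
Proof.
move=> H; pose c s := sval (cid (H s)).
have -> : \matrix_s rvec (t s) = (\matrix_(s, j) c s j) *m (\matrix_j rvec (v j)).
  apply/row_matrixP => s; rewrite rowK row_mul mulmx_sum_row.
  rewrite [in LHS](svalP (cid (H s))) rvec_sum; apply: eq_bigr => j _.
  by rewrite !mxE rowK.
exact: leq_trans (mxrankM_maxl _ _) (rank_leq_col _).
Qed.

Lemma rvec_surj z : exists A, rvec A = z.
Proof.
exists (\matrix_(i, j) Complex (vec_mx (lsubmx z) i j) (vec_mx (rsubmx z) i j)).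
rewrite -[RHS]hsubmxK /rvec; congr row_mx; rewrite -[RHS]vec_mxK; congr mxvec;
by apply/matrixP => i j; rewrite 2!mxE.
Qed.

Lemma mxvec_dot (A B : 'M[R]_(p, m)) :
  \sum_l mxvec A 0 l * mxvec B 0 l = \sum_i \sum_j A i j * B i j.
Proof.
rewrite pair_big /= (reindex _ (curry_mxvec_bij _ _)) /=.
by apply: eq_bigr => [[i j]] _; rewrite !mxvecE.
Qed.

Lemma rvec_dot A B :
  (rvec A *m (rvec B)^T) 0 0 = complex.Re (\sum_i \sum_j (A i j)^* * B i j).
Proof.
have ReD (I : finType) (F : I -> C) : complex.Re (\sum_i F i) = \sum_i complex.Re (F i).
  by elim/big_rec2: _ => [//|i x y _ <-]; case: (F i) y => ? ? [].
rewrite /rvec tr_row_mx mul_row_col mxE !mxE.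
have E (M N : 'M[R]_(p, m)) : \sum_l mxvec M 0 l * (mxvec N)^T l 0 =
   \sum_i \sum_j M i j * N i j.
  by rewrite -mxvec_dot; apply: eq_bigr => l _; rewrite [_^T _ _]mxE.
rewrite !E ReD -big_split; apply: eq_bigr => i _.
rewrite ReD -big_split; apply: eq_bigr => j _; rewrite !mxE.
by case: (A i j) (B i j) => ? ? [? ?] /=; ring.
Qed.

End RealSpace.

(** * Pauli strings as a basis, and real dimensions of orbit cones *)

Section PauliSpan.
Variables (R : realType) (n : nat).
Local Notation C := R[i].
Local Notation ltr := (bool * bool)%type.
Local Notation string := {ffun 'I_n -> ltr}.
Implicit Types s t : string.

Lemma pauli_complete (x y u v : 'I_(2 ^ n)) :
  \sum_(s : string) pauli R s x y * (pauli R s u v)^* = (2 ^ n)%:R * (x == u)%:R * (y == v)%:R.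
Proof.
transitivity (\prod_(q < n) \sum_(a : ltr)
    sigma R a (bits x q) (bits y q) * (sigma R a (bits u q) (bits v q))^*).
  rewrite bigA_distr_bigA; apply: eq_bigr => s _.
  by rewrite !mxE rmorph_prod -big_split.
under eq_bigr do rewrite sigma_complete.
rewrite !big_split /= prodr_const card_ord natrX.
under [X in _ * X * _]eq_bigr do rewrite bits_eq.
under [X in _ * _ * X]eq_bigr do rewrite bits_eq.
have H (z z' : 'I_(2 ^ n)) : \prod_(q < n) (bit z q == bit z' q)%:R = (z == z')%:R :> C.
  rewrite (prod_delta R predT); congr (nat_of_bool _)%:R.
  apply/idP/eqP => [/forallP H|->]; last by apply/forallP => q /=.
  by apply: bit_inj => q; apply/eqP/H.
by rewrite !H.
Qed.

Lemma pauli_orth s t :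
  \sum_x \sum_y pauli R s x y * (pauli R t x y)^* = (2 ^ n)%:R * (s == t)%:R.
Proof.
transitivity (\prod_(q < n) \sum_i \sum_j
    sigma R (s q) i j * (sigma R (t q) i j)^*).
  rewrite bigA_distr_bigA (reindex (@bits n)) /=; last exact/onW_bij/bits_bij.
  apply: eq_bigr => x _; rewrite bigA_distr_bigA.
  rewrite (reindex (@bits n)) /=; last exact/onW_bij/bits_bij.
  by apply: eq_bigr => y _; rewrite !mxE rmorph_prod -big_split.
under eq_bigr do rewrite sigma_orth.
rewrite big_split /= prodr_const card_ord natrX; congr (_ * _).
rewrite (prod_delta R predT); congr (nat_of_bool _)%:R.
apply/idP/eqP => [/forallP H|->]; last by apply/forallP => q /=.
by apply/ffunP => q; apply/eqP/H.
Qed.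

Lemma pauli_adj s : adjmx (pauli R s) = pauli R s.
Proof.
apply/matrixP => x y; rewrite !mxE rmorph_prod; apply: eq_bigr => q _.
by rewrite -[in RHS]sigma_adj [RHS]mxE.
Qed.

Definition string0 : string := [ffun=> ltr0].

Lemma pauli0 : pauli R string0 = 1%:M.
Proof. by apply: kron_layer1 => q; rewrite ffunE sigma1. Qed.

Definition tangent s : 'M[C]_(2 ^ n) :=
  (if s == string0 then 1 else Complex 0 1) *: pauli R s.

(* Real dimension of the cone over the orbit of B, at each of its points: the identity string
   contributes the radial direction, the other strings the skew-Hermitian ones. *)
Definition orbit_dim m (B : 'M[C]_(2 ^ n, m)) (D : nat) : Prop :=
  forall U : 'M[C]_(2 ^ n), U *m adjmx U = 1%:M ->
  forall k (v : 'I_k -> 'M[C]_(2 ^ n, m)),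
  (forall s, exists c : 'I_k -> R, tangent s *m (U *m B) = \sum_j (c j)%:C%C *: v j) ->
  (D <= k)%N.

(** Pauli strings are orthogonal and right multiplication by [U] is injective, so all 4^n tangent
    vectors are independent over the reals. *)
Lemma orbit_dim_unitary : orbit_dim (1%:M : 'M[C]_(2 ^ n)) (4 ^ n).
Proof.
move=> U U1 k v span.
have := @real_dim_bound R _ _ k #|string| v (fun r => tangent (enum_val r) *m (U *m 1%:M))
  (fun r => span (enum_val r)).
apply: leq_trans; set Y := (\matrix_r _)%R.
have -> : (4 ^ n = #|string|)%N by rewrite card_ffun card_prod card_bool card_ord.
suff /eqP -> : row_free Y by [].
apply: inj_row_free => c cY; apply/rowP => s0; rewrite mxE.
have c0 : \sum_r (c 0 r)%:C%C *: tangent (enum_val r) = 0.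
  rewrite -[LHS]mulmx1 -U1 mulmxA mulmx_suml.
  suff -> : \sum_r ((c 0 r)%:C%C *: tangent (enum_val r)) *m U = 0 by rewrite mul0mx.
  apply: rvec_eq0; transitivity (c *m Y); last exact: cY.
  rewrite mulmx_sum_row.
  under [in LHS]eq_bigr do rewrite -scalemxAl.
  rewrite (rvec_sum (fun r => c 0 r)); apply: eq_bigr => s _.
  by rewrite rowK mulmx1.
pose t0 := enum_val s0.
have /(congr1 (fun M : 'M[C]_(2 ^ n) => \sum_x \sum_y M x y * (pauli R t0 x y)^*)) := c0.
have -> : \sum_x \sum_y (\sum_r (c 0 r)%:C%C *: tangent (enum_val r)) x y * (pauli R t0 x y)^*
  = \sum_r (c 0 r)%:C%C * (if enum_val r == string0 then 1 else Complex 0 1) *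
     ((2 ^ n)%:R * (enum_val r == t0)%:R).
  under [RHS]eq_bigr do rewrite -pauli_orth mulr_sumr.
  rewrite [RHS]exchange_big; apply: eq_bigr => x _.
  under [RHS]eq_bigr do rewrite mulr_sumr.
  rewrite [RHS]exchange_big; apply: eq_bigr => y _.
  rewrite summxE mulr_suml; apply: eq_bigr => s _.
  by rewrite 2![in LHS]mxE !mulrA.
rewrite (bigD1 s0) //= eqxx big1 => [|s ss0]; last first.
  by rewrite (inj_eq enum_val_inj) (negbTE ss0) !mulr0.
rewrite addr0 mulr1 big1 => [|x _]; last by rewrite big1 // => y _; rewrite mxE mul0r.
have N0 : (2 ^ n)%:R != 0 :> C by rewrite pnatr_eq0 expn_eq0.
move=> /eqP; rewrite !mulf_eq0 (negbTE N0) orbF.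
case/orP => [/eqP[]//|]; case: ifP => _; rewrite ?oner_eq0 // => /eqP[] /eqP.
by rewrite oner_eq0.
Qed.

(* A vector Z which is real-orthogonal to all tangent vectors makes conj(Z) psi^T - conj(psi) Z^T
   orthogonal to every non-identity Pauli string, hence scalar; having rank at most 2, it is 0. *)
Lemma orbit_dim_state : (1 < n)%N -> orbit_dim (ket0 R n) (2 ^ n.+1).
Proof.
move=> n1 U U1 k v span.
have := @real_dim_bound R _ _ k #|string| v (fun r => tangent (enum_val r) *m (U *m ket0 R n))
  (fun r => span (enum_val r)).
apply: leq_trans; set Y := (\matrix_r _)%R; rewrite -mxrank_tr.
have {1}-> : (2 ^ n.+1 = 2 ^ n * 1 + 2 ^ n * 1)%N by rewrite expnS muln1; lia.
suff /eqP -> : row_free Y^T by [].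
apply: inj_row_free => z zY.
have [Z ZE] := rvec_surj z; rewrite -ZE in zY *.
pose x0 : 'I_(2 ^ n) := Ordinal (expn_gt0 2 n : (0 < 2 ^ n)%N).
pose psi x : C := U x x0.
have psiE x : (U *m ket0 R n) x 0 = psi x.
  rewrite mxE (bigD1 x0) //= mxE mulr1 big1 ?addr0 // => y yx0.
  rewrite mxE ifF ?mulr0 //; apply: contraNF yx0 => /eqP y0; exact/eqP/val_inj.
have psi1 : \sum_x psi x * (psi x)^* = 1.
  have /matrixP/(_ x0 x0) := mulmx1C U1; rewrite [RHS]mxE eqxx mulr1n => <-.
  by rewrite mxE; apply: eq_bigr => x _; rewrite [adjmx _ _ _]mxE mulrC.
have orth s : complex.Re (\sum_x (Z x 0)^* * (tangent s *m (U *m ket0 R n)) x 0) = 0.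
  have /rowP/(_ (enum_rank s)) := zY; rewrite [RHS]mxE => <-.
  transitivity ((rvec Z *m (rvec (tangent s *m (U *m ket0 R n)))^T) 0 0).
    rewrite rvec_dot; congr complex.Re.
    by apply: eq_bigr => x _; rewrite big_ord_recl big_ord0 addr0.
  rewrite [LHS]mxE [RHS]mxE; apply: eq_bigr => l _; congr (_ * _).
  by rewrite [LHS]mxE [RHS]mxE [RHS]mxE enum_rankK.
pose L s := \sum_x \sum_y (Z x 0)^* * (pauli R s x y * psi y).
have LE s : \sum_x (Z x 0)^* * (pauli R s *m (U *m ket0 R n)) x 0 = L s.
  apply: eq_bigr => x _; rewrite mxE mulr_sumr.
  by apply: eq_bigr => y _; rewrite psiE.
have conjE (c : C) : c^* = Complex (complex.Re c) (- complex.Im c) by case: c.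
(* Orthogonality to the radial vector psi makes [L string0] imaginary; orthogonality to i P_s psi
   makes [L s] real for every other string. *)
have L0 : complex.Re (L string0) = 0.
  have := orth string0; rewrite /tangent eqxx.
  by under eq_bigr do rewrite scale1r; rewrite LE.
have Lconj s : s != string0 -> (L s)^* = L s.
  move=> s0; have := orth s; rewrite /tangent (negbTE s0).
  under eq_bigr do rewrite -scalemxAl mxE mulrCA.
  rewrite -mulr_sumr LE conjE; case: (L s) => a b /=.
  by rewrite mul0r mul1r sub0r => /eqP; rewrite oppr_eq0 => /eqP->; rewrite oppr0.
pose N : 'M[C]_(2 ^ n) := \matrix_(x, y) ((Z x 0)^* * psi y - (psi x)^* * Z y 0).
have PN s : s != string0 -> \sum_x \sum_y pauli R s x y * N x y = 0.
  move=> s0; transitivity (L s - (L s)^*); last by rewrite Lconj // subrr.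
  have -> : (L s)^* = \sum_x \sum_y pauli R s x y * ((psi x)^* * Z y 0).
    rewrite /L rmorph_sum; under [LHS]eq_bigr do rewrite rmorph_sum.
    rewrite exchange_big; apply: eq_bigr => x _; apply: eq_bigr => y _.
    rewrite !rmorphM /= conjCK -[in RHS](pauli_adj s) [adjmx _ _ _]mxE.
    by rewrite mulrC -mulrA.
  rewrite -sumrB; apply: eq_bigr => x _; rewrite -sumrB; apply: eq_bigr => y _.
  by rewrite [N _ _]mxE mulrBr; congr (_ - _); rewrite mulrCA.
have N0 : (2 ^ n)%:R != 0 :> C by rewrite pnatr_eq0 expn_eq0.
pose tau := (\sum_x \sum_y pauli R string0 x y * N x y) / (2 ^ n)%:R.
(* By completeness [N] is recovered from its Pauli coefficients, and only the one of the identity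
   string survives. *)
have NE : N = tau%:M.
  apply/matrixP => u w; apply: (mulfI N0).
  transitivity (\sum_(s : string) (\sum_x \sum_y pauli R s x y * N x y) * (pauli R s u w)^*).
    transitivity (\sum_x \sum_y N x y * ((2 ^ n)%:R * (x == u)%:R * (y == w)%:R)).
      rewrite (bigD1 u) //= (bigD1 w) //= !eqxx !mulr1 big1 => [|y /negbTE->]; last by rewrite !mulr0.
      rewrite addr0 big1 => [|x /negbTE xu]; first by rewrite addr0 mulrC.
      by apply: big1 => y _; rewrite xu mulr0 mul0r mulr0.
    under eq_bigr do under eq_bigr do rewrite -pauli_complete mulr_sumr.
    under eq_bigr do rewrite exchange_big.
    rewrite exchange_big; apply: eq_bigr => s _; rewrite mulr_suml.
    apply: eq_bigr => x _; rewrite mulr_suml; apply: eq_bigr => y _.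
    by rewrite mulrCA mulrA.
  rewrite (bigD1 string0) //= [X in _ + X]big1 => [|s s0]; last by rewrite PN ?mul0r.
  rewrite addr0 pauli0 [tau%:M _ _]mxE -pauli0 mulrnAr /tau [_ * (_ / _)]mulrC divfK // pauli0.
  by rewrite mxE rmorph_nat mulr_natr.
have N_eq0 : N = 0.
  have [t0|tn0] := eqVneq tau 0; first by rewrite NE t0 raddf0.
  have : (\rank N <= 2)%N.
    have -> : N = (\col_x (Z x 0)^*) *m (\row_y psi y) - (\col_x (psi x)^*) *m (\row_y Z y 0).
      by apply/matrixP => x y; rewrite !mxE !big_ord_recl !big_ord0 !addr0 !mxE.
    apply: leq_trans (mxrank_add _ _) _; rewrite mxrank_opp -[2%N]/(1 + 1)%N.
    by apply: leq_add; apply: leq_trans (mxrankM_maxr _ _) (rank_leq_row _).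
  (* A nonzero scalar matrix has full rank 2^n, which exceeds 2 since n > 1. *)
  have n4 : (4 <= 2 ^ n)%N by rewrite -[4%N]/(2 ^ 2)%N leq_exp2l.
  by rewrite NE -scalemx1 mxrank_scale_nz // mxrank1 => /(leq_trans n4).
(* Contract the vanishing [N x y] with [psi x] and use that psi has norm 1. *)
have Zpsi y : Z y 0 = L string0 * psi y.
  rewrite -[LHS]mul1r -psi1 mulr_suml /L.
  have -> : \sum_x \sum_y0 (Z x 0)^* * (pauli R string0 x y0 * psi y0) =
    \sum_x (Z x 0)^* * psi x.
    apply: eq_bigr => x _; rewrite (bigD1 x) //= pauli0 mxE eqxx mul1r big1 ?addr0 //.
    by move=> y' yx; rewrite mxE eq_sym (negbTE yx) mul0r mulr0.
  rewrite mulr_suml; apply: eq_bigr => x _.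
  have /matrixP/(_ x y) := N_eq0; rewrite [N _ _]mxE [RHS]mxE => /eqP; rewrite subr_eq0 => /eqP E.
  by rewrite -mulrA -E mulrCA mulrA.
(* Substituting the proportionality of Z and psi into the conjugate of [L string0] shows that it is
   real as well as imaginary. *)
have L00 : L string0 = 0.
  have LR : (L string0)^* = L string0.
    rewrite {1}/L rmorph_sum -[RHS]mulr1 -psi1 mulr_sumr; apply: eq_bigr => x _.
    rewrite (bigD1 x) //= pauli0 mxE eqxx mul1r big1 => [|y' yx]; last first.
      by rewrite mxE eq_sym (negbTE yx) mul0r mulr0.
    by rewrite addr0 rmorphM /= conjCK Zpsi mulrA.
  move: LR L0; rewrite conjE; case: (L string0) => a b /= [/eqP].
  rewrite -subr_eq0 -opprD oppr_eq0 -mulr2n mulrn_eq0 /= => /eqP-> ->.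
  by [].
suff -> : Z = 0.
  by rewrite -(scale0r (rvec 0)) -rvecZ scaler0.
by apply/matrixP => y j; rewrite (ord1 j) Zpsi L00 mul0r mxE.
Qed.

End PauliSpan.

Section PolyValued.
Variables (R : realType) (p m : nat).
Local Notation C := R[i].
Local Notation E := 'M[C]_(p, m).

(** Phrased through functionals because the remainder of a family is only ever seen through the dual
    functionals of its directions. *)
Definition poly_valued (F : R -> E) : Prop :=
  forall f, real_linear f -> exists P : {poly R}, forall x, f (F x) = P.[x].

Lemma poly_valued_cst A : poly_valued (fun=> A).
Proof. by move=> f _; exists (f A)%:P => x; rewrite hornerC. Qed.

Lemma poly_valuedD F G : poly_valued F -> poly_valued G ->
  poly_valued (fun x => F x + G x).
Proof.
move=> HF HG f fl; have [[P PE] [Q QE]] := (HF f fl, HG f fl).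
by exists (P + Q) => x; rewrite hornerD -PE -QE fl.1.
Qed.

Lemma poly_valued_sum (I : finType) (F : I -> R -> E) :
  (forall j, poly_valued (F j)) -> poly_valued (fun x => \sum_j F j x).
Proof.
move=> HF; elim: (index_enum I) => [|j s IH].
  move=> f fl; have [P PE] := poly_valued_cst 0 fl.
  by exists P => x; rewrite big_nil -PE.
move=> f fl; have [P PE] := poly_valuedD (HF j) IH fl.
by exists P => x; rewrite big_cons -PE.
Qed.

Lemma poly_valuedXZ k F : poly_valued F -> poly_valued (fun x => (x ^+ k)%:C%C *: F x).
Proof.
move=> HF f fl; have [P PE] := HF f fl.
by exists ('X^k * P) => x; rewrite hornerM hornerXn -PE fl.2.
Qed.

Lemma poly_valued_mulmxl (V : 'M[C]_p) F :
  poly_valued F -> poly_valued (fun x => V *m F x).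
Proof.
move=> HF f [fD fZ]; apply: (HF (fun A => f (V *m A))); split=> [A B|x A].
  by rewrite mulmxDr fD.
by rewrite -scalemxAr fZ.
Qed.

End PolyValued.

(** * One-parameter families realised by consecutive slices *)

Section Family.
Variables (R : realType) (n m : nat).
Local Notation C := R[i].

Lemma circuit_unitary_cat (c1 c2 : circuit R n) :
  circuit_unitary (c1 ++ c2) = circuit_unitary c2 *m circuit_unitary c1.
Proof.
elim: c1 => [|[[a b] g] c1 IH]; first by rewrite mulmx1.
by rewrite cat_cons !circuit_unitary_cons IH mulmxA.
Qed.

(* The slice with index j implements 1 + i x^(w j) P_j, with P_j chosen so that the new direction
   v j = P_j v 0 is independent of the earlier ones; cross terms have order at least x^(2 N). *)
Lemma slices_family (B : 'M[C]_(2 ^ n, m)) (D N : nat) (w : nat -> nat)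
    (sl : seq (architecture n)) :
  (1 < n)%N -> orbit_dim B D -> w 0%N = 0%N -> (forall j, (0 < j)%N -> (N <= w j)%N) ->
  (forall S, S \in sl -> wf_arch S /\ causal_slice S) -> (size sl < D)%N ->
  exists (v : nat -> 'M[C]_(2 ^ n, m)) (Rest : R -> 'M[C]_(2 ^ n, m)),
    [/\ real_free (size sl).+1 v, poly_valued Rest,
      exists2 U : 'M[C]_(2 ^ n), U *m adjmx U = 1%:M & v 0%N = U *m B &
      forall x : R, exists (gs : seq 'M[C]_4) (r : R),
        [/\ size gs = size (flatten sl), all (@is_SU R 4) gs, r != 0 &
          circuit_unitary (zip (flatten sl) gs) *m B =
          r%:C%C *: (\sum_(j < (size sl).+1) (x ^+ w j)%:C%C *: v j +
                     (x ^+ (2 * N))%:C%C *: Rest x)]].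
Proof.
move=> n1 HB w0 wN; elim/last_ind: sl => [|sl S IH] Hsl szD.
  exists (fun=> B), (fun=> 0); split.
  - move=> c; rewrite big_ord_recl big_ord0 addr0 => /eqP; rewrite scaler_eq0.
    case/orP => [/eqP[c0] j|/eqP B0]; first by rewrite (ord1 j).
    (* If [B] were 0, the empty family would span all its tangent vectors. *)
    have : (D <= 0)%N.
      apply: (HB 1%:M _ 0%N (fun=> 0)); first by rewrite adjmx1 mulmx1.
      by move=> s; exists (fun=> 0); rewrite big_ord0 B0 !mulmx0.
    by rewrite leqNgt szD.
  - exact: poly_valued_cst.
  - by exists 1%:M; rewrite ?mul1mx // adjmx1.
  - move=> x; exists [::], 1; split; rewrite ?oner_eq0 //= mul1mx scaler0 addr0.
    by rewrite big_ord_recl big_ord0 addr0 w0 expr0 !scale1r.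
move: szD; rewrite size_rcons => szD.
have [|v [Rest [vfree Rpoly [U U1 v0] Hx]]] := IH _ (ltnW szD).
  by move=> S' S'in; apply: Hsl; rewrite mem_rcons inE S'in orbT.
set t := size sl in szD vfree Hx *.
(* Only t + 1 < D vectors have been chosen. The leading vector [v 0] has stayed on the unitary orbit
   of [B], so [orbit_dim] applies at it and yields a direction outside their span. *)
have [s Hs] : exists s, forall c : 'I_t.+1 -> R,
    tangent R s *m (U *m B) <> \sum_j (c j)%:C%C *: v j.
  apply: contrapT => H; have := HB U U1 t.+1 (fun j => v j); rewrite leqNgt szD.
  suff H' : forall s, exists c : 'I_t.+1 -> R, tangent R s *m (U *m B) = \sum_j (c j)%:C%C *: v j.
    by move=> /(_ H').
  move=> s; apply: contrapT => Hs; apply: H; exists s => c cE.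
  by apply: Hs; exists c.
have s0 : s != string0 n.
  apply: contra_notN (Hs (fun j => (j == ord0)%:R)) => /eqP->.
  rewrite /tangent eqxx pauli0 scale1r mul1mx -v0 (bigD1 ord0) //= scale1r.
  by rewrite big1 ?addr0 // => j /negbTE->; rewrite scale0r.
have [q sq] : exists q, s q != ltr0.
  apply: contrapT => H; move/negP: s0; apply; apply/eqP/ffunP => q; rewrite ffunE.
  by apply/eqP; apply: contrapT => /negP sq; apply: H; exists q.
have [wS cS] : wf_arch S /\ causal_slice S by apply: Hsl; rewrite mem_rcons inE eqxx.
have [V V1 HV] := @causal_rotation R n S s n1 wS cS (ex_intro _ q sq).
set T := tangent R s in Hs.
have TE y : Complex 0 y *: pauli R s = y%:C%C *: T.
  rewrite /T /tangent (negbTE s0) scalerA; congr (_ *: _).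
  by apply/eqP; rewrite eq_complex /=; apply/andP; split; apply/eqP; ring.
(* Multiply the old family by 1 + x^w T, where w is the new weight. The term T v_0 is the new
   direction; each T v_j with j > 0 has weight at least 2 N and joins the remainder, where the
   subtraction of 2 N is therefore exact. [V] is a common unitary change of frame. *)
pose v' j := V *m (if j == t.+1 then T *m v 0%N else v j).
pose Rest' x := V *m (Rest x + (x ^+ w t.+1)%:C%C *: (T *m Rest x) +
  \sum_(j < t) (x ^+ (w t.+1 + w j.+1 - 2 * N))%:C%C *: (T *m v j.+1)).
exists v', Rest'; split.
- move=> c; rewrite big_ord_recr /= {2}/v' eqxx => E.
  have E2 : \sum_(j < t.+1) (c (widen_ord (leqnSn t.+1) j))%:C%C *: v j
      + (c ord_max)%:C%C *: (T *m v 0%N) = 0.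
    rewrite -[LHS]mul1mx -(mulmx1C V1) -mulmxA; apply/eqP.
    suff -> : V *m (\sum_(j < t.+1) (c (widen_ord (leqnSn t.+1) j))%:C%C *: v j
      + (c ord_max)%:C%C *: (T *m v 0%N)) = 0 by rewrite mulmx0.
    apply: etrans E; rewrite mulmxDr mulmx_sumr -scalemxAr; congr (_ + _).
    by apply: eq_bigr => j _; rewrite -scalemxAr /v' ltn_eqF.
  have c0 : c ord_max = 0.
    apply/eqP; apply: contrapT => /negP cm.
    apply: (Hs (fun j => - (c (widen_ord (leqnSn t.+1) j)) / c ord_max)).
    rewrite -v0; have cC : (c ord_max)%:C%C != 0 :> C by rewrite eq_complex /= eqxx andbT.
    apply: (scalerI cC); rewrite scaler_sumr; move/eqP: E2; rewrite addrC addr_eq0 => /eqP->.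
    rewrite -sumrN; apply: eq_bigr => j _; rewrite scalerA -scaleNr; congr (_ *: _).
    by apply/eqP; rewrite eq_complex /=; apply/andP; split; apply/eqP; field.
  move: E2; rewrite c0 scale0r addr0 => /vfree H j.
  have [jt|] := ltnP j t.+1; first by rewrite -(H (Ordinal jt)); congr c; apply/val_inj.
  by move=> tj; rewrite -c0; congr c; apply/val_inj/eqP; rewrite eqn_leq tj -ltnS ltn_ord.
- apply/poly_valued_mulmxl/poly_valuedD; first apply/poly_valuedD => //.
    exact/poly_valuedXZ/poly_valued_mulmxl.
  by apply: poly_valued_sum => j; apply/poly_valuedXZ/poly_valued_cst.
- exists (V *m U); last by rewrite /v' /= v0 mulmxA.
  by rewrite adjmxM mulmxA -(mulmxA V) U1 mulmx1.
move=> x; have [gs [r [sz SU r0 E]]] := Hx x.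
have [gs' [r' [sz' SU' r'0 E']]] := HV (x ^+ w t.+1).
exists (gs ++ gs'), (r' * r); split.
- by rewrite size_cat flatten_rcons size_cat sz sz'.
- by rewrite all_cat SU.
- by rewrite mulf_neq0.
rewrite flatten_rcons zip_cat // circuit_unitary_cat -mulmxA E E' TE.
rewrite -scalemxAr -scalemxAl scalerA.
have -> : r%:C%C * r'%:C%C = (r' * r)%:C%C :> C by rewrite mulrC rmorphM.
congr (_ *: _).
rewrite [in RHS]big_ord_recr /= [v' t.+1]/v' eqxx /Rest'.
have -> : \sum_(j < t.+1) (x ^+ w j)%:C%C *: v' j = V *m \sum_(j < t.+1) (x ^+ w j)%:C%C *: v j.
  by rewrite mulmx_sumr; apply: eq_bigr => j _; rewrite -scalemxAr /v' ltn_eqF.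
rewrite -!mulmxA 2!(scalemxAr _ V) -!mulmxDr; congr (_ *m _).
have -> : T *m v 0%N = T *m (\sum_(j < t.+1) (x ^+ w j)%:C%C *: v j)
    - \sum_(j < t) (x ^+ w j.+1)%:C%C *: (T *m v j.+1).
  rewrite mulmx_sumr big_ord_recl w0 expr0 scale1r /=.
  by under [in RHS]eq_bigr do rewrite -scalemxAr; rewrite addrK.
have E3 : (x ^+ w t.+1)%:C%C *: (\sum_(j < t) (x ^+ w j.+1)%:C%C *: (T *m v j.+1)) =
    (x ^+ (2 * N))%:C%C *:
    (\sum_(j < t) (x ^+ (w t.+1 + w j.+1 - 2 * N))%:C%C *: (T *m v j.+1)).
  rewrite !scaler_sumr; apply: eq_bigr => j _; rewrite !scalerA -!rmorphM -!exprD.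
  by rewrite subnKC // mul2n -addnn leq_add // wN.
clearbody T; rewrite scalerBr E3 !scalerDr mulmxDl mul1mx -!scalemxAl mulmxDr scalerDr -!scalemxAr.
have swap (a b : C) (X : 'M[C]_(2 ^ n, m)) : a *: (b *: X) = b *: (a *: X).
  by rewrite !scalerA mulrC.
rewrite [in LHS](swap (x ^+ w t.+1)%:C%C) -!addrA; congr (_ + _).
by rewrite [LHS]addrCA; congr (_ + _); rewrite !addrA [RHS]addrC !addrA subrr add0r.
Qed.

End Family.

(** * The KAK decomposition *)

Section Orthogonal.
Variables (R : realType).
Local Notation C := R[i].

Definition cmx m n (A : 'M[R]_(m, n)) : 'M[C]_(m, n) := map_mx (real_complex R) A.

Definition householder n (u : 'cV[R]_n) : 'M[R]_n := 1%:M - 2 *: (u *m u^T).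

Definition unit_vec n (u : 'cV[R]_n) : Prop := u^T *m u = 1%:M.

Lemma householder_sym n (u : 'cV[R]_n) : (householder u)^T = householder u.
Proof. by rewrite /householder linearB linearZ /= trmx1 trmx_mul trmxK. Qed.

Lemma householderK n (u : 'cV[R]_n) : unit_vec u ->
  householder u *m householder u = 1%:M.
Proof.
move=> u1; rewrite /householder; set P := u *m u^T.
have PP : P *m P = P by rewrite /P mulmxA -(mulmxA u) u1 mulmx1.
rewrite mulmxBl mul1mx -scalemxAl mulmxBr mulmx1 -scalemxAr PP.
have -> : P - 2 *: P = - P by rewrite -[X in X - _]scale1r -scalerBl -[RHS]scaleN1r; congr (_ *: _); ring.
by rewrite scalerN opprK subrK.
Qed.

Lemma col_dot_gt0 n (u : 'cV[R]_n) : u != 0 -> 0 < (u^T *m u) 0 0.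
Proof.
move=> u0; rewrite mxE lt_def; apply/andP; split; last first.
  by apply: sumr_ge0 => i _; rewrite mxE -expr2 sqr_ge0.
apply: contraNneq u0 => /eqP H; apply/eqP/colP => i; rewrite mxE.
move: H; rewrite psumr_eq0 => [/allP/(_ i)|j _]; last by rewrite mxE -expr2 sqr_ge0.
by rewrite mem_index_enum mxE -expr2 sqrf_eq0 => /(_ isT)/eqP.
Qed.

Lemma householder_swap n (a b : 'cV[R]_n) : a^T *m a = b^T *m b -> a != b ->
  exists u, [/\ unit_vec u, householder u *m a = b &
    forall c : 'cV[R]_n, (a - b)^T *m c = 0 -> householder u *m c = c].
Proof.
move=> ab neq; set d := a - b; have d0 : d != 0 by rewrite subr_eq0.
have dd := col_dot_gt0 d0; set s := (d^T *m d) 0 0 in dd.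
have dE : d^T *m d = s%:M by rewrite [LHS]mx11_scalar.
pose u := (Num.sqrt s)^-1 *: d.
have ss : (Num.sqrt s)^-1 * (Num.sqrt s)^-1 = s^-1 by rewrite -invfM -expr2 sqr_sqrtr ?ltW.
have uT : u^T = (Num.sqrt s)^-1 *: d^T by rewrite /u linearZ.
have uu : u *m u^T = s^-1 *: (d *m d^T).
  by rewrite uT /u -scalemxAl -scalemxAr scalerA ss.
exists u; split.
- rewrite /unit_vec uT /u -scalemxAl -scalemxAr scalerA ss dE.
  by rewrite scale_scalar_mx mulVf ?gt_eqF.
- rewrite /householder mulmxBl mul1mx uu -!scalemxAl -mulmxA.
  have -> : d^T *m a = (s / 2)%:M.
    have E : d^T *m d = d^T *m a + d^T *m a.
      have H : d^T *m b = - (d^T *m a).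
        rewrite /d linearB /= !mulmxBl ab opprB; congr (_ - _).
        have <- : (a^T *m b)^T = b^T *m a by rewrite trmx_mul trmxK.
        by apply/matrixP => i j; rewrite [RHS]mxE !ord1.
      by rewrite {2}/d mulmxBr H opprK.
    rewrite [LHS]mx11_scalar; congr (_%:M); move/matrixP/(_ 0 0): E.
    rewrite -/s [RHS]mxE => E; rewrite E -/s.
    by field.
  rewrite mul_mx_scalar !scalerA /d.
  have -> : 2 * s^-1 * (s / 2) = 1 by field; rewrite gt_eqF.
  by rewrite scale1r opprB addrC subrK.
- move=> c dc; rewrite /householder mulmxBl mul1mx uu -!scalemxAl -mulmxA dc.
  by rewrite mulmx0 !scaler0 subr0.
Qed.

(** The Cartan-Dieudonne theorem. Reflections are the generators that can be matched with quaternion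
    multiplications, hence with local gates. *)
Lemma orthogonal_householders n (O : 'M[R]_n) : O *m O^T = 1%:M ->
  exists us : seq 'cV[R]_n, (forall u, u \in us -> unit_vec u) /\
    O = foldr (fun u A => householder u *m A) 1%:M us.
Proof.
move=> O1; pose e (j : 'I_n) : 'cV[R]_n := delta_mx j 0.
(* The first n - d basis vectors are already fixed. A reflection swapping O e_k and e_k leaves them
   fixed, since [O] is an isometry and they are orthogonal to O e_k - e_k. *)
suff : forall d (O : 'M[R]_n), O *m O^T = 1%:M ->
    (forall j : 'I_n, (j + d < n)%N -> O *m e j = e j) ->
  exists us : seq 'cV[R]_n, (forall u, u \in us -> unit_vec u) /\
    O = foldr (fun u A => householder u *m A) 1%:M us.
  move=> /(_ n O O1); apply=> j; by rewrite ltnNge leq_addl.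
elim=> [|d IH] {O1}O O1 fixO.
  exists [::]; split=> //=; apply/matrixP => i j.
  have := fixO j; rewrite addn0 ltn_ord => /(_ isT)/matrixP/(_ i 0).
  by rewrite -colE !mxE eqxx andbT.
have [nd|dn] := ltnP n d.+1.
  by apply: IH => // j jd; exfalso; lia.
have kn : (n - d.+1 < n)%N by lia.
pose k := Ordinal kn.
have step (j : 'I_n) : (j + d < n)%N -> j = k \/ (j + d.+1 < n)%N.
  move=> jd; have [|nj] := ltnP (j + d.+1) n; first by right.
  by left; apply/val_inj => /=; lia.
have [Oe|neq] := eqVneq (O *m e k) (e k).
  by apply: IH => // j /step[->|/fixO].
have norm : (O *m e k)^T *m (O *m e k) = (e k)^T *m e k.
  by rewrite trmx_mul mulmxA -(mulmxA _ _ O) (mulmx1C O1) mulmx1.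
have [u [u1 uO ufix]] := householder_swap norm neq.
have [||us [usU usE]] := IH (householder u *m O).
- by rewrite trmx_mul mulmxA -(mulmxA _ O) O1 mulmx1 householder_sym householderK.
- move=> j /step[->|jd]; first by rewrite -mulmxA.
  rewrite -mulmxA fixO // ufix // linearB /= mulmxBl trmx_mul -{1}(fixO j jd).
  rewrite mulmxA -(mulmxA _ _ O) (mulmx1C O1) mulmx1 subrr.
  by [].
exists (u :: us); split=> [v|/=]; last by rewrite -usE mulmxA householderK // mul1mx.
by rewrite inE => /orP[/eqP->|/usU].
Qed.

End Orthogonal.

(** * Real orthogonal diagonalisation of symmetric unitaries *)

Section SymmetricUnitary.
Variable R : realType.
Local Notation C := R[i].

Lemma cmxM m n p (A : 'M[R]_(m, n)) (B : 'M[R]_(n, p)) : cmx (A *m B) = cmx A *m cmx B.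
Proof. exact: map_mxM. Qed.

Lemma cmx1 n : cmx (1%:M : 'M[R]_n) = 1%:M.
Proof. exact: map_mx1. Qed.

Lemma cmx_tr m n (A : 'M[R]_(m, n)) : cmx A^T = (cmx A)^T.
Proof. exact/esym/map_trmx. Qed.

Lemma conj_cmx m n (A : 'M[R]_(m, n)) : map_mx Num.conj (cmx A) = cmx A.
Proof.
by apply/matrixP => i j; rewrite !mxE; apply/eqP; rewrite eq_complex /= oppr0 !eqxx.
Qed.

Lemma adjmxE n (A : 'M[C]_n) : adjmx A = (map_mx Num.conj A)^T.
Proof. by apply/matrixP => i j; rewrite !mxE. Qed.

Lemma adj_cmx n (A : 'M[R]_n) : adjmx (cmx A) = (cmx A)^T.
Proof. by rewrite adjmxE conj_cmx. Qed.

(* If v is an eigenvector of the symmetric unitary S, so is its conjugate, for the same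
   eigenvalue; hence so are the real and imaginary parts of v. *)
Lemma real_eigenvector n (S : 'M[C]_n.+1) : S^T = S -> S *m adjmx S = 1%:M ->
  exists (r : 'rV[R]_n.+1) (a : C), r != 0 /\ cmx r *m S = a *: cmx r.
Proof.
move=> Ssym S1; have [a /eigenvalueP[v vS v0]] := eigenvalue_closed S (ltn0Sn n).
pose vc := map_mx Num.conj v.
have ScE : adjmx S = map_mx Num.conj S by rewrite adjmxE map_trmx Ssym.
have ScT : (map_mx Num.conj S)^T = map_mx Num.conj S by rewrite map_trmx Ssym.
have SSc : S *m map_mx Num.conj S = 1%:M by rewrite -ScE.
have vcS : vc = a^* *: (vc *m S).
  have : v = a *: (v *m map_mx Num.conj S) by rewrite scalemxAl -vS -mulmxA SSc mulmx1.
  move=> /(congr1 (map_mx Num.conj)); rewrite map_mxZ map_mxM -map_mx_comp.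
  by rewrite (_ : map_mx _ S = S) //; apply/matrixP => i j; rewrite mxE /= conjCK.
have aa : a^* * a = 1.
  have N : v *m vc^T = (a * a^*) *: (v *m vc^T).
    have -> : (a * a^*) *: (v *m vc^T) = (a *: v) *m (a^* *: vc)^T.
      by rewrite linearZ /= -scalemxAl -scalemxAr scalerA.
    have -> : a^* *: vc = map_mx Num.conj (v *m S) by rewrite vS map_mxZ.
    by rewrite -vS map_mxM trmx_mul ScT -mulmxA (mulmxA S) SSc mul1mx.
  have N0 : (v *m vc^T) 0 0 != 0.
    apply: contraNneq v0 => H; apply/eqP/rowP => i; rewrite mxE.
    move/eqP: H; rewrite mxE psumr_eq0 => [/allP/(_ i)|j _]; last by rewrite !mxE -normCK exprn_ge0.
    by rewrite mem_index_enum !mxE -normCK expf_eq0 normr_eq0 => /(_ isT)/eqP.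
  apply: (mulIf N0); move/matrixP/(_ 0 0): N; rewrite [RHS]mxE => N.
  by rewrite mul1r mulrC [a^* * a]mulrC mulrC -N.
have vcS' : vc *m S = a *: vc by rewrite [in RHS]vcS scalerA mulrC aa scale1r.
pose vr := map_mx (@complex.Re R) v; pose vi := map_mx (@complex.Im R) v.
have vrE : cmx vr = 2^-1 *: (v + vc).
  apply/matrixP => i j; rewrite !mxE; case: (v i j) => x y.
  apply: (mulfI (_ : 2 != 0 :> C)); first by rewrite pnatr_eq0.
  rewrite mulrA divff ?pnatr_eq0 // mul1r.
  by apply/eqP; rewrite eq_complex /=; apply/andP; split; apply/eqP; ring.
have viE : cmx vi = (2 * Complex 0 1)^-1 *: (v - vc).
  have i0 : 2 * Complex 0 1 != 0 :> C.
    by rewrite mulf_eq0 pnatr_eq0 /= eq_complex /= oner_eq0 andbF.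
  apply/matrixP => i j; rewrite !mxE; case: (v i j) => x y.
  apply: (mulfI i0); rewrite mulrA divff // mul1r.
  by apply/eqP; rewrite eq_complex /=; apply/andP; split; apply/eqP; ring.
have [vr0|vr0] := eqVneq vr 0; last first.
  exists vr, a; split=> //.
  by rewrite vrE -scalemxAl mulmxDl vS vcS' -scalerDr !scalerA mulrC.
exists vi, a; split; last first.
  by rewrite viE -scalemxAl mulmxBl vS vcS' -scalerBr !scalerA mulrC.
apply: contraNneq v0 => vi0; apply/eqP/matrixP => i j.
have /matrixP/(_ i j) := vr0; have /matrixP/(_ i j) := vi0; rewrite !mxE.
by case: (v i j) => x y /= -> ->.
Qed.

(** Deflation along a real eigenvector: symmetry clears the first column together with the first
    row, and the remaining block is again symmetric and unitary. *)
Lemma sym_unitary_diag n (S : 'M[C]_n) : S^T = S -> S *m adjmx S = 1%:M ->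
  exists (O : 'M[R]_n) (D : 'rV[C]_n), O *m O^T = 1%:M /\
    S = cmx O *m diag_mx D *m (cmx O)^T.
Proof.
elim: n S => [|n IH] S Ssym S1.
  by exists 1%:M, 0; split; [rewrite trmx1 mulmx1|apply/matrixP => [[]]].
have [r [a [r0 rS]]] := real_eigenvector Ssym S1.
pose e : 'cV[R]_n.+1 := delta_mx 0 0.
(* [P] is the identity or the reflection taking e to the normalised eigenvector, so e becomes an
   eigenvector of P S P. *)
have [P [Psym P1 Pr]] : exists P : 'M[R]_n.+1, [/\ P^T = P, P *m P = 1%:M &
    exists k, r = k *: (e^T *m P)].
  have rr := col_dot_gt0 (_ : r^T != 0); rewrite -(inj_eq trmx_inj) trmxK trmx0 in rr.
  have {rr} := rr r0; set s := (r *m r^T) 0 0 => s0.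
  pose u := (Num.sqrt s)^-1 *: r^T.
  have uu : u^T *m u = e^T *m e.
    rewrite /u; have -> : ((Num.sqrt s)^-1 *: r^T)^T = (Num.sqrt s)^-1 *: r.
      by rewrite linearZ /= trmxK.
    rewrite -scalemxAl -scalemxAr scalerA -invfM -expr2 sqr_sqrtr ?ltW //.
    rewrite [r *m _]mx11_scalar -/s scale_scalar_mx mulVf ?gt_eqF //.
    by rewrite trmx_delta mul_delta_mx; apply/matrixP => i j; rewrite !mxE !ord1.
  have rE : r = Num.sqrt s *: u^T.
    by rewrite /u linearZ /= trmxK scalerA divff ?scale1r // gt_eqF // sqrtr_gt0.
  have [eu|neq] := eqVneq e u.
    by exists 1%:M; rewrite trmx1 mulmx1; split=> //; exists (Num.sqrt s); rewrite mulmx1 eu.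
  have [h [h1 he _]] := householder_swap (esym uu) neq.
  exists (householder h); rewrite householder_sym householderK //; split=> //.
  exists (Num.sqrt s); rewrite -{1}(householder_sym h) -trmx_mul he.
  exact: rE.
have [k rE] := Pr; have k0 : k != 0 by apply: contraNneq r0 => k0; rewrite rE k0 scale0r.
have [S2 S2E] : exists M, M = cmx P *m S *m cmx P by eexists.
have PP : cmx P *m cmx P = 1%:M by rewrite -cmxM P1 cmx1.
have S2sym : S2^T = S2 by rewrite S2E !trmx_mul -cmx_tr Psym Ssym mulmxA.
have S21 : S2 *m adjmx S2 = 1%:M.
  rewrite S2E !adjmxM adj_cmx -cmx_tr Psym !mulmxA -(mulmxA (_ *m S)) PP mulmx1.
  by rewrite -(mulmxA _ S) S1 mulmx1 PP.
have eS2 : cmx e^T *m S2 = a *: cmx e^T.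
  have eP : cmx e^T *m cmx P = (k^-1)%:C%C *: cmx r.
    rewrite -cmxM; apply/matrixP => i j; rewrite rE !mxE -rmorphM mulrA mulVf //.
    by rewrite mul1r.
  rewrite S2E !mulmxA eP -!scalemxAl rS -scalemxAl scalerA mulrC -scalerA scalemxAl -eP.
  by rewrite -mulmxA PP mulmx1.
have row0 j : S2 0 j = a * (j == 0)%:R.
  have /matrixP/(_ 0 j) := eS2; rewrite [in RHS]mxE.
  have -> : (cmx e^T *m S2) 0 j = S2 0 j.
    rewrite mxE (bigD1 0) //= big1 => [|l l0]; last by rewrite !mxE (negbTE l0) mul0r.
    by rewrite !mxE !eqxx mul1r addr0.
  by move=> ->; rewrite !mxE; congr (a * _); case: eqVneq => _; rewrite ?eqxx.
pose S3 : 'M[C]_(1 + n) := S2; pose S' := drsubmx S3.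
have S3E : S3 = block_mx a%:M 0 0 S'.
  rewrite -[LHS]submxK; congr block_mx.
  - apply/matrixP => i j; rewrite !ord1 !mxE; have := row0 0.
    rewrite eqxx mulr1 mulr1n => <-; congr (S2 _ _); exact/val_inj.
  - apply/matrixP => i j; rewrite !ord1 !mxE; have := row0 (rshift 1 j).
    rewrite (_ : (_ == 0) = false) ?mulr0 // => <-; congr (S2 _ _); exact/val_inj.
  - apply/matrixP => i j; rewrite !ord1 !mxE; have := row0 (rshift 1 i).
    rewrite (_ : (_ == 0) = false) ?mulr0 // -{1}S2sym mxE => <-; congr (S2 _ _); exact/val_inj.
have S'sym : S'^T = S'.
  have : S3^T = S3 by [].
  by rewrite S3E tr_block_mx => /eq_block_mx[_ _ _].
have S'1 : S' *m adjmx S' = 1%:M.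
  have : S3 *m adjmx S3 = 1%:M by [].
  rewrite adjmxE S3E map_block_mx tr_block_mx mulmx_block scalar_mx_block.
  by move=> /eq_block_mx[_ _ _]; rewrite mul0mx add0r -adjmxE.
have [W2 [D2 [W21 S'E]]] := IH S' S'sym S'1.
pose Q : 'M[R]_(1 + n) := block_mx 1%:M 0 0 W2.
have QQ : Q *m Q^T = 1%:M.
  rewrite /Q tr_block_mx mulmx_block !trmx0 trmx1 !mulmx0 !mul0mx !addr0 !add0r mulmx1 W21.
  by rewrite -(scalar_mx_block 1 n).
exists (P *m Q), (row_mx a%:M D2); split.
  by rewrite trmx_mul mulmxA -(mulmxA P) QQ mulmx1 Psym P1.
have QE : cmx Q *m diag_mx (row_mx a%:M D2) *m (cmx Q)^T = S3.
  rewrite S3E diag_mx_row /Q /cmx map_block_mx !map_mx0 map_mx1 tr_block_mx.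
  rewrite !mulmx_block !trmx0 trmx1 !(mulmx0, mul0mx, addr0, add0r, mul1mx, mulmx1).
  rewrite [in RHS]S'E /cmx; congr block_mx.
  by apply/matrixP => i j; rewrite !ord1 !mxE eqxx.
have cPT : (cmx P)^T = cmx P by rewrite -cmx_tr Psym.
transitivity (cmx P *m S3 *m cmx P); last by rewrite -QE cmxM trmx_mul cPT !mulmxA.
by rewrite /S3 S2E !mulmxA PP mul1mx -mulmxA PP mulmx1.
Qed.

End SymmetricUnitary.

(** * Unitary diagonalisation, and SU(2) as unit quaternions *)

Section SpectralSU.
Variable R : realType.
Local Notation C := R[i].

Lemma unitary_diag n (A : 'M[C]_n) : A *m adjmx A = 1%:M ->
  exists (V : 'M[C]_n) (D : 'rV[C]_n), V *m adjmx V = 1%:M /\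
    A = adjmx V *m diag_mx D *m V.
Proof.
have tcE (M : 'M[C]_n) : (M ^t* )%sesqui = adjmx M.
  by apply/matrixP => i j; rewrite !mxE.
move=> A1; have /orthomx_spectralP AE : A \is normalmx.
  by apply/normalmxP; rewrite tcE A1 (mulmx1C A1).
exists (spectralmx A), (spectral_diag A); have := spectral_unitarymx A.
move=> /[dup] /invmx_unitary; rewrite tcE => VV /unitarymxP; rewrite tcE => V1.
by split=> //; rewrite -VV.
Qed.

Lemma diag_adj n (D : 'rV[C]_n) : adjmx (diag_mx D) = diag_mx (map_mx Num.conj D).
Proof. by rewrite adjmxE map_diag_mx tr_diag_mx. Qed.

Lemma ord4P (k : 'I_4) : [\/ k = @Ordinal 4 0 isT, k = @Ordinal 4 1 isT,
   k = @Ordinal 4 2 isT | k = @Ordinal 4 3 isT].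
Proof.
case: k => [[|[|[|[|//]]]] H]; [constructor 1|constructor 2|constructor 3|constructor 4];
exact/val_inj.
Qed.

Lemma big_ord4 (T : Type) (idx : T) (op : Monoid.law idx) (F : 'I_4 -> T) :
  \big[op/idx]_i F i = op (F (@Ordinal 4 0 isT)) (op (F (@Ordinal 4 1 isT))
    (op (F (@Ordinal 4 2 isT)) (F (@Ordinal 4 3 isT)))).
Proof.
rewrite !big_ord_recl big_ord0 Monoid.mulm1.
by congr (op (F _) (op (F _) (op (F _) (F _)))); apply/val_inj.
Qed.

Lemma unpair4E : [/\ unpair4 (@Ordinal 4 0 isT) = (0, 0), unpair4 (@Ordinal 4 1 isT) = (0, 1),
  unpair4 (@Ordinal 4 2 isT) = (1, 0) & unpair4 (@Ordinal 4 3 isT) = (1, 1)].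
Proof. by split; apply: (can_inj pair4K); rewrite unpair4K; apply/val_inj. Qed.

(** Write it as (p ⊗ 1)(1 ⊗ q) and diagonalise; each eigenvalue of p or q then occurs twice. *)
Lemma det_kron2 (p q : 'M[C]_2) : is_SU p -> is_SU q -> \det (kron2 p q) = 1.
Proof.
have [u0 u1 u2 u3] := unpair4E.
have det2 (D : 'rV[C]_2) : \det (diag_mx D) = D 0 0 * D 0 1.
  by rewrite det_diag !big_ord_recl big_ord0 mulr1; congr (_ * D 0 _); apply/val_inj.
have main (s : bool) (A : 'M[C]_2) : is_SU A ->
    \det (if s then kron2 A 1%:M else kron2 1%:M A) = 1.
  move=> /andP[/eqP A1 /eqP dA]; have [V [D [V1 AE]]] := unitary_diag A1.
  pose K (B : 'M[C]_2) := if s then kron2 B 1%:M else kron2 1%:M B.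
  have KM B B' : K (B *m B') = K B *m K B' by rewrite /K; case: (s); rewrite kron2M mulmx1.
  have K1 : K 1%:M = 1%:M by rewrite /K kron2_11 if_same.
  have dD : D 0 0 * D 0 1 = 1.
    rewrite -det2 -dA AE !det_mulmx mulrAC -det_mulmx.
    by rewrite (mulmx1C V1) det1 mul1r.
  rewrite -/(K A) AE !KM !det_mulmx mulrAC -det_mulmx -KM (mulmx1C V1) K1 det1 mul1r.
  have -> : K (diag_mx D) = diag_mx (\row_r D 0 (if s then (unpair4 r).1 else (unpair4 r).2)).
    apply/matrixP => k l; rewrite -(unpair4K k) -(unpair4K l) /K.
    case: (unpair4 k) (unpair4 l) => [k1 k2] [l1 l2].
    rewrite [RHS]mxE (can_eq pair4K) mxE pair4K xpair_eqE.
    by case: (s); rewrite kron2E !mxE /=;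
      do 2!case: (_ == _); rewrite ?mulr1n ?mulr0n ?mulr0 ?mul0r ?mulr1 ?mul1r.
  rewrite det_diag big_ord4 !mxE u0 u1 u2 u3 /=.
  by case: (s) => /=; rewrite -[RHS](mulr1 1) -{1}dD -dD; ring.
move=> pS qS; have := main true p pS; have := main false q qS => /= dq dp.
have -> : kron2 p q = kron2 p 1%:M *m kron2 1%:M q by rewrite kron2M mulmx1 mul1mx.
by rewrite det_mulmx dp dq mulr1.
Qed.

Lemma kron2_SU (p q : 'M[C]_2) : is_SU p -> is_SU q -> is_SU (kron2 p q).
Proof.
move=> pS qS; rewrite /is_SU det_kron2 // eqxx andbT adj_kron2 kron2M.
by have /andP[/eqP-> _] := pS; have /andP[/eqP-> _] := qS; rewrite kron2_11.
Qed.

(** The quaternion with coordinates v in the basis 1, iX, iY, iZ. *)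
Definition quat (v : 'I_4 -> R) : 'M[C]_2 :=
  let x := v (@Ordinal 4 0 isT) in let y := v (@Ordinal 4 1 isT) in
  let z := v (@Ordinal 4 2 isT) in let t := v (@Ordinal 4 3 isT) in
  \matrix_(i, j) if i == 0 then if j == 0 then Complex x t else Complex z y
                 else if j == 0 then Complex (- z) y else Complex x (- t).

Lemma det_mx2 (A : 'M[C]_2) : \det A = A 0 0 * A 1 1 - A 0 1 * A 1 0.
Proof.
rewrite (expand_det_row _ 0) !big_ord_recl big_ord0 addr0 /cofactor !det_mx11 !mxE /=.
rewrite expr0 mul1r expr1 mulN1r mulrN; congr (_ * A _ _ - A _ _ * A _ _); exact/val_inj.
Qed.

Lemma quat_SU v : \sum_i v i ^+ 2 = 1 -> is_SU (quat v).
Proof.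
rewrite big_ord4 /= => v1; apply/andP; split; apply/eqP.
  apply: mx2P; rewrite !mxE sum_ord2 !mxE /=; apply/eqP; rewrite eq_complex /=;
  apply/andP; split; apply/eqP; move: v1; lra.
rewrite det_mx2 !mxE /=; apply/eqP; rewrite eq_complex /=.
by apply/andP; split; apply/eqP; move: v1; lra.
Qed.

Lemma SU2_quat p : is_SU p -> exists2 v : 'I_4 -> R, \sum_i v i ^+ 2 = 1 & p = quat v.
Proof.
move=> /andP[/eqP p1 /eqP]; rewrite det_mx2 => dp.
have E00 : p 0 0 * (p 0 0)^* + p 0 1 * (p 0 1)^* = 1.
  by have /matrixP/(_ 0 0) := p1; rewrite !mxE sum_ord2 !mxE.
have E10 : p 1 0 * (p 0 0)^* + p 1 1 * (p 0 1)^* = 0.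
  by have /matrixP/(_ 1 0) := p1; rewrite !mxE sum_ord2 !mxE.
have p11 : p 1 1 = (p 0 0)^*.
  rewrite -[LHS]mulr1 -E00 -[RHS]mulr1 -dp.
  have -> : p 1 1 * (p 0 0 * (p 0 0)^* + p 0 1 * (p 0 1)^*) =
     (p 0 0)^* * (p 0 0 * p 1 1 - p 0 1 * p 1 0) +
     p 0 1 * (p 1 0 * (p 0 0)^* + p 1 1 * (p 0 1)^*) by ring.
  by rewrite E10 mulr0 addr0.
have p10 : p 1 0 = - (p 0 1)^*.
  rewrite -[LHS]mulr1 -E00 -[RHS]mulr1 -dp.
  have -> : p 1 0 * (p 0 0 * (p 0 0)^* + p 0 1 * (p 0 1)^*) =
     - (p 0 1)^* * (p 0 0 * p 1 1 - p 0 1 * p 1 0) +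
     p 0 0 * (p 1 0 * (p 0 0)^* + p 1 1 * (p 0 1)^*) by ring.
  by rewrite E10 mulr0 addr0.
exists (fun k => nth 0 [:: complex.Re (p 0 0); complex.Im (p 0 1); complex.Re (p 0 1);
   complex.Im (p 0 0)] k).
  rewrite big_ord4 /=; move: E00; case: (p 0 0) (p 0 1) => x t [z y] /(congr1 (@complex.Re R)) /=.
  by move=> <-; ring.
apply: mx2P; rewrite ?p11 ?p10 !mxE /=; case: (p 0 0) (p 0 1) => x t [z y] //.
by apply/eqP; rewrite eq_complex /= opprK !eqxx.
Qed.

End SpectralSU.

(** * The magic basis and SO(4) as the group of local gates *)

Section CartanDecomposition.
Variable R : realType.
Local Notation C := R[i].
Local Notation quat := (@quat R).

Definition qbasis (k : 'I_4) : 'M[C]_2 := quat (fun l => (l == k)%:R).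

(* sqrt 2 times the unitary change to the magic basis; the columns are the quaternion units. *)
Definition magic : 'M[C]_4 :=
  \matrix_(r, k) qbasis k (unpair4 r).1 (unpair4 r).2.

(** Quaternion conjugation. A reflection has determinant -1, so it corresponds to a local gate only
    after composition with this matrix. *)
Definition qconj : 'M[R]_4 := diag_mx (\row_k (if k == 0 :> 'I_4 then 1 else -1)).

Definition local_gate (g : 'M[C]_4) : Prop :=
  exists p q : 'M[C]_2, [/\ is_SU p, is_SU q & g = kron2 p q].

Lemma local_gate_SU g : local_gate g -> is_SU g.
Proof. by move=> [p [q [pS qS ->]]]; apply: kron2_SU. Qed.

Lemma local_gateM g h : local_gate g -> local_gate h -> local_gate (g *m h).
Proof.
move=> [p [q [pS qS ->]]] [p' [q' [p'S q'S ->]]]; exists (p *m p'), (q *m q').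
by split; rewrite ?is_SUM // kron2M.
Qed.

Lemma local_gate_adj g : local_gate g -> local_gate (adjmx g).
Proof.
move=> [p [q [pS qS ->]]]; exists (adjmx p), (adjmx q).
by rewrite adj_kron2; split; rewrite ?is_SU_adj.
Qed.

Lemma mulmx2E (A B : 'M[C]_2) i j : (A *m B) i j = A i 0 * B 0 j + A i 1 * B 1 j.
Proof. by rewrite mxE sum_ord2. Qed.

Lemma sum_pair4 (V : nmodType) (F : 'I_4 -> V) :
  \sum_r F r = \sum_i \sum_j F (pair4 (i, j)).
Proof.
rewrite (reindex pair4) /=; last by exists unpair4 => x _; rewrite ?pair4K ?unpair4K.
by rewrite pair_bigA /=; apply: eq_bigr; case.
Qed.

(** Columns of [magic] are 2 x 2 matrices read as vectors, on which p ⊗ q acts by x -> p x q^T. *)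
Lemma kron2_magicE p q i j k :
  (kron2 p q *m magic) (pair4 (i, j)) k = (p *m qbasis k *m q^T) i j.
Proof.
rewrite mxE sum_pair4 !sum_ord2 !kron2E.
have E a b : magic (pair4 (a, b)) k = qbasis k a b by rewrite mxE pair4K.
by rewrite !E !mulmx2E ![q^T _ _]mxE; ring.
Qed.

Lemma magic_mulE (A : 'M[C]_4) i j k :
  (magic *m A) (pair4 (i, j)) k = \sum_l qbasis l i j * A l k.
Proof. by rewrite mxE; apply: eq_bigr => l _; rewrite mxE pair4K. Qed.

Lemma mx4_pairP (A B : 'M[C]_4) :
  (forall i j k, A (pair4 (i, j)) k = B (pair4 (i, j)) k) -> A = B.
Proof.
move=> H; apply/matrixP => r k; rewrite -(unpair4K r).
by case: (unpair4 r) => i j; apply: H.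
Qed.

Lemma magic_unit : magic *m adjmx magic = 2%:M.
Proof.
apply/matrixP => r s; rewrite -(unpair4K r) -(unpair4K s).
case: (unpair4 r) (unpair4 s) => [i j] [k l].
rewrite magic_mulE [RHS]mxE (can_eq pair4K) xpair_eqE.
have -> : \sum_a qbasis a i j * adjmx magic a (pair4 (k, l)) =
   \sum_a qbasis a i j * (qbasis a k l)^*.
  by apply: eq_bigr => a _; rewrite [adjmx _ _ _]mxE [magic _ _]mxE pair4K.
rewrite big_ord4.
by case: (ord2P i) (ord2P j) (ord2P k) (ord2P l) => -> [] -> [] -> [] ->;
  rewrite !mxE /=; apply/eqP; rewrite eq_complex /=; apply/andP; split; apply/eqP;
  rewrite /=; ring.
Qed.

(* x |-> v x v is minus the reflection along v, up to quaternion conjugation. *)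
Lemma quat_sandwich (v : 'I_4 -> R) k : \sum_l v l ^+ 2 = 1 ->
  quat v *m qbasis k *m quat v =
  (if k == 0 :> 'I_4 then 1 else -1) *: ((2 * v k)%:C%C *: quat v - qbasis k).
Proof.
rewrite big_ord4 /= => v1; apply: mx2P; rewrite !mulmx2E !mxE /=.
all: by case: (ord4P k) => -> /=; apply/eqP; rewrite eq_complex /=;
 apply/andP; split; apply/eqP; nra.
Qed.

Lemma is_SU_tr n (A : 'M[C]_n) : is_SU A -> is_SU A^T.
Proof.
move=> /andP[/eqP A1 /eqP dA]; rewrite /is_SU det_tr dA eqxx andbT.
have -> : adjmx A^T = (adjmx A)^T by apply/matrixP => i j; rewrite !mxE.
by rewrite -trmx_mul (mulmx1C A1) trmx1.
Qed.

Lemma is_SU_opp2 (A : 'M[C]_2) : is_SU A -> is_SU (- A).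
Proof.
move=> /andP[/eqP A1 /eqP dA]; rewrite /is_SU -scaleN1r adjmxZ detZ dA.
by rewrite -scalemxAl -scalemxAr A1 scalerA rmorphN1 mulrNN mulr1 scale1r sqrrN expr1n mulr1 !eqxx.
Qed.

Lemma unit_vec_sum n (v : 'cV[R]_n) : unit_vec v -> \sum_l v l 0 ^+ 2 = 1.
Proof.
move=> /matrixP/(_ 0 0); rewrite [LHS]mxE [RHS]mxE eqxx mulr1n => <-.
by apply: eq_bigr => l _; rewrite mxE expr2.
Qed.

(** By [quat_sandwich], x -> - v x v is conjugation followed by the reflection along v. *)
Lemma magic_reflection (v : 'cV[R]_4) : unit_vec v -> exists2 g, local_gate g &
  magic *m cmx (householder v *m qconj) = g *m magic.
Proof.
move=> /unit_vec_sum v1; have qS := quat_SU v1.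
exists (kron2 (- quat (fun l => v l 0)) (quat (fun l => v l 0))^T).
  exists (- quat (fun l => v l 0)), (quat (fun l => v l 0))^T.
  by rewrite is_SU_opp2 // is_SU_tr.
apply: mx4_pairP => i j k; rewrite kron2_magicE trmxK !mulNmx quat_sandwich //.
rewrite magic_mulE; pose r : R := if k == 0 then 1 else -1.
have E l : cmx (householder v *m qconj) l k =
    r%:C%C * ((l == k)%:R - (2 * v l 0 * v k 0)%:C%C).
  rewrite mxE /qconj mul_mx_diag mxE; have -> : (l == k)%:R = ((l == k)%:R : R)%:C%C :> C.
    by rewrite rmorph_nat.
  rewrite -rmorphB -rmorphM; congr (_%:C%C); rewrite [X in _ * X]mxE -/r mulrC.
  rewrite !mxE big_ord_recl big_ord0 addr0 [v^T _ _]mxE mulrA.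
  by case: (l == k); rewrite ?mulr1n ?mulr0n.
under eq_bigr do rewrite E mulrCA mulrBr.
rewrite -mulr_sumr sumrB.
have -> : \sum_l qbasis l i j * (l == k)%:R = qbasis k i j.
  rewrite (bigD1 k) //= eqxx mulr1 big1 ?addr0 // => l /negbTE->.
  by rewrite mulr0.
have -> : \sum_l qbasis l i j * (2 * v l 0 * v k 0)%:C%C =
   (2 * v k 0)%:C%C * quat (fun l => v l 0) i j.
  rewrite big_ord4 !mxE; case: (ord2P i) (ord2P j) => -> [] -> /=;
  by apply/eqP; rewrite eq_complex /=; apply/andP; split; apply/eqP; ring.
have rE : r%:C%C = if k == 0 then 1 else -1 :> C.
  by rewrite /r; case: ifP => _; rewrite ?rmorphN1 ?rmorph1.
have NE (A : 'M[C]_2) : (- A) i j = - A i j by rewrite mxE.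
have ZE c (A : 'M[C]_2) : (c *: A) i j = c * A i j by rewrite mxE.
have DE (A B : 'M[C]_2) : (A - B) i j = A i j - B i j by rewrite mxE NE.
by rewrite rE NE ZE DE ZE; case: (k == _); rewrite ?mul1r ?mulN1r !opprB ?opprK.
Qed.

Lemma qconj2 : qconj *m qconj = 1%:M.
Proof.
rewrite /qconj mulmx_diag -diag_const_mx; congr diag_mx.
by apply/rowP => k; rewrite !mxE; case: ifP => _; rewrite ?mulr1 ?mulrNN ?mulr1.
Qed.

Lemma magic_det : \det magic != 0.
Proof.
have /(congr1 determinant) := magic_unit; rewrite det_mulmx det_scalar => H.
apply: contraTneq isT => d0; move: H; rewrite d0 mul0r => /eqP.
by rewrite eq_sym expf_eq0 /= pnatr_eq0.
Qed.

Lemma det_cmx n (A : 'M[R]_n) : \det (cmx A) = (\det A)%:C%C.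
Proof. by rewrite det_map_mx. Qed.

Lemma det_householder (v : 'cV[R]_4) : unit_vec v -> \det (householder v) = -1.
Proof.
move=> /magic_reflection[g /local_gate_SU/andP[_ /eqP dg]] /(congr1 determinant).
rewrite !det_mulmx dg mul1r => /(canRL (mulKf magic_det)).
rewrite mulVf ?magic_det // det_cmx det_mulmx => /(congr1 (@complex.Re R)) /=.
rewrite /qconj det_diag big_ord4 !mxE /= => H; move: H; lra.
Qed.

(** Determinant 1 means an even number of reflections. With K for [qconj], a pair H_u H_v equals
    (H_u K)(K H_v), and the second factor is the inverse of H_v K; both factors are local. *)
Lemma magic_orthogonal (O : 'M[R]_4) : O *m O^T = 1%:M -> \det O = 1 ->
  exists2 g, local_gate g & magic *m cmx O = g *m magic.
Proof.
move=> /orthogonal_householders[us [usU ->]] {O}.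
have [k] := ubnP (size us); elim: k us usU => // k IH [|u [|v us]] usU sz.
- exists 1%:M; last by rewrite /= cmx1 mulmx1 mul1mx.
  by exists 1%:M, 1%:M; rewrite kron2_11; split; rewrite ?is_SU1.
- rewrite /= mulmx1 det_householder => [|]; last by apply: usU; rewrite inE.
  by lra.
have uU : unit_vec u by apply: usU; rewrite inE eqxx.
have vU : unit_vec v by apply: usU; rewrite !inE eqxx orbT.
rewrite /= !det_mulmx !det_householder // mulN1r mulN1r opprK.
have sz' : (size us < k)%N by move: sz => /=; lia.
have us' w : w \in us -> unit_vec w by move=> wu; apply: usU; rewrite !inE wu !orbT.
move=> /(IH us us' sz')[g gl gE].
have [gu gul guE] := magic_reflection uU; have [gv gvl gvE] := magic_reflection vU.
exists (gu *m adjmx gv *m g).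
  exact/local_gateM/gl/local_gateM/local_gate_adj.
have gv1 : adjmx gv *m gv = 1%:M.
  by have /local_gate_SU/andP[/eqP/mulmx1C-> _] := gvl.
have E : magic *m cmx (qconj *m householder v) = adjmx gv *m magic.
  rewrite -[LHS]mul1mx -gv1 -mulmxA mulmxA -mulmxA; congr (_ *m _).
  rewrite mulmxA -gvE -mulmxA -cmxM -mulmxA (mulmxA qconj) qconj2 mul1mx.
  by rewrite householderK // cmx1 mulmx1.
move: (foldr _ _ us) gE => W gE.
rewrite -[householder u]mulmx1 -qconj2 -!mulmxA (mulmxA (householder u)) (mulmxA qconj).
by rewrite cmxM mulmxA guE -mulmxA cmxM (mulmxA magic) E -!mulmxA gE.
Qed.

End CartanDecomposition.

Section Kak.
Variable R : realType.
Local Notation C := R[i].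
Local Notation quat := (@quat R).
Local Notation qbasis := (@qbasis R).
Local Notation magic := (@magic R).
Local Notation magic_det := (@magic_det R).
Local Notation magic_unit := (@magic_unit R).

(** The abelian factor of the KAK decomposition. Pairs replacing cosine and sine of the angles keep
    it linear in each pair, as the parameter count requires. *)
Definition cartan (x : 'I_3 -> R * R) : 'M[C]_4 :=
  let X := (true, false) in let Y := (true, true) in let Z := (false, true) in
  let f k s := (x k).1%:C%C *: 1%:M + (Complex 0 (x k).2) *: pauli2 R (s, s) in
  f (@Ordinal 3 0 isT) X *m f (@Ordinal 3 1 isT) Y *m f (@Ordinal 3 2 isT) Z.

Lemma mxZE m n (c : C) (A : 'M[C]_(m, n)) i j : (c *: A) i j = c * A i j.
Proof. by rewrite mxE. Qed.

Lemma diag_phase s (c d : R) (e : 'I_4 -> bool) :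
  (forall k : 'I_4, sigma R s *m qbasis k *m (sigma R s)^T = (-1) ^+ e k *: qbasis k) ->
  (c%:C%C *: 1%:M + Complex 0 d *: pauli2 R (s, s)) *m magic =
  magic *m diag_mx (\row_k Complex c (if e k then - d else d)).
Proof.
move=> H; apply: mx4_pairP => i j k; rewrite mulmxDl -!scalemxAl mul1mx.
rewrite mul_mx_diag [RHS]mxE [X in _ = _ * X]mxE mxE [X in _ + X]mxE.
rewrite kron2_magicE H !mxZE [magic _ _]mxE pair4K /=.
move: (qbasis k i j) => [x y]; apply/eqP; rewrite eq_complex /=.
by case: (e k) => /=; apply/andP; split; apply/eqP; ring.
Qed.

(** Signs of the eigenvalues of X ⊗ X, Y ⊗ Y and Z ⊗ Z on the magic basis, which diagonalises all
    three. *)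
Definition signX (k : 'I_4) : bool := (1 < k)%N.
Definition signY (k : 'I_4) : bool := ~~ odd k.
Definition signZ (k : 'I_4) : bool := (k == 1 :> nat) || (k == 2 :> nat).

Lemma sigma_qbasis k :
  [/\ sigma R (true, false) *m qbasis k *m (sigma R (true, false))^T =
        (-1) ^+ signX k *: qbasis k,
      sigma R (true, true) *m qbasis k *m (sigma R (true, true))^T =
        (-1) ^+ signY k *: qbasis k &
      sigma R (false, true) *m qbasis k *m (sigma R (false, true))^T =
        (-1) ^+ signZ k *: qbasis k].
Proof.
by split; case: (ord4P k) => ->; apply: mx2P; rewrite !mulmx2E !mxE /=;
  apply/eqP; rewrite eq_complex /=; apply/andP; split; apply/eqP; ring.
Qed.

Lemma cartan_magic x : cartan x *m magic = magic *m diag_mx (\row_k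
  let f j b := Complex (x j).1 (if b then - (x j).2 else (x j).2) in
  f (@Ordinal 3 0 isT) (signX k) * f (@Ordinal 3 1 isT) (signY k) *
  f (@Ordinal 3 2 isT) (signZ k)).
Proof.
have comp (A1 A2 A3 M : 'M[C]_4) (d1 d2 d3 : 'rV[C]_4) : A1 *m M = M *m diag_mx d1 ->
    A2 *m M = M *m diag_mx d2 -> A3 *m M = M *m diag_mx d3 ->
    A1 *m A2 *m A3 *m M = M *m diag_mx (\row_k (d1 0 k * d2 0 k * d3 0 k)).
  move=> E1 E2 E3; rewrite -!mulmxA E3 (mulmxA A2) E2 -(mulmxA M) (mulmxA A1) E1.
  rewrite -mulmxA !mulmx_diag; congr (_ *m diag_mx _).
  by apply/rowP => k; rewrite !mxE mulrA.
rewrite /cartan (comp _ _ _ _ _ _ _ (diag_phase _ _ (e := signX) _)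
  (diag_phase _ _ (e := signY) _) (diag_phase _ _ (e := signZ) _));
  try by move=> k; case: (sigma_qbasis k).
by congr (_ *m diag_mx _); apply/rowP => k; rewrite !mxE.
Qed.

Lemma cartan_phases (E : 'I_4 -> C) : (forall k, E k * (E k)^* = 1) -> \prod_k E k = 1 ->
  exists x : 'I_3 -> R * R, forall k, E k =
  (let f j b := Complex (x j).1 (if b then - (x j).2 else (x j).2) in
  f (@Ordinal 3 0 isT) (signX k) * f (@Ordinal 3 1 isT) (signY k) *
  f (@Ordinal 3 2 isT) (signZ k)).
Proof.
move=> E1; rewrite big_ord4 /=.
set E0 := E _; set Ea := E _; set Eb := E _; set Ec := E _ => P1.
have n0 : E0 * E0^* = 1 by apply: E1. have na : Ea * Ea^* = 1 by apply: E1.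
have nb : Eb * Eb^* = 1 by apply: E1. have nc : Ec * Ec^* = 1 by apply: E1.
have sq (u : C) : u * u^* = 1 -> exists2 z : C, z * z = u & z * z^* = 1.
  move=> u1; exists (sqrtC u); first by rewrite -expr2 sqrtCK.
  have H : (sqrtC u * (sqrtC u)^*) ^+ 2 = 1 ^+ 2.
    by rewrite exprMn -rmorphXn sqrtCK u1 expr1n.
  by apply: (@pexpIrn _ 2) => //; rewrite ?nnegrE ?ler01 // -normCK exprn_ge0.
(* The sign patterns give E_0 E_1 = z1^2 and E_0 E_3 = z3^2, after which z2 = z1 z3 / E_0. The
   equation for E_2 follows because the product of all four is 1. *)
have [z3 z3E z31] : exists2 z : C, z * z = E0 * Ec & z * z^* = 1.
  by apply: sq; rewrite rmorphM mulrACA n0 nc mulr1.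
have [z1 z1E z11] : exists2 z : C, z * z = E0 * Ea & z * z^* = 1.
  by apply: sq; rewrite rmorphM mulrACA n0 na mulr1.
pose z2 := z1 * z3 * E0^*.
have z21 : z2 * z2^* = 1.
  rewrite /z2 !rmorphM /= conjCK.
  have -> : z1 * z3 * E0^* * (z1^* * z3^* * E0) = (z1 * z1^*) * (z3 * z3^*) * (E0 * E0^*) by ring.
  by rewrite z11 z31 n0 !mulr1.
pose x (j : 'I_3) := nth (0, 0) [:: (complex.Re z1, complex.Im z1);
   (complex.Re z2, complex.Im z2); (complex.Re z3, complex.Im z3)] j.
have cE (z : C) : Complex (complex.Re z) (- complex.Im z) = z^* by case: z.
have iE (z : C) : Complex (complex.Re z) (complex.Im z) = z by case: z.
exists x => k; rewrite /x /=.
have EbE : Eb = E0^* * Ea^* * Ec^*.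
  transitivity (E0^* * Ea^* * Ec^* * (E0 * (Ea * (Eb * Ec)))); last by rewrite P1 mulr1.
  transitivity ((E0 * E0^* ) * (Ea * Ea^* ) * (Ec * Ec^* ) * Eb); last by ring.
  by rewrite n0 na nc !mul1r.
have z2C : z2^* = z1^* * z3^* * E0 by rewrite /z2 !rmorphM /= conjCK.
have z3C : z3^* * z3^* = E0^* * Ec^* by rewrite -!rmorphM /= z3E.
have z1C : z1^* * z1^* = E0^* * Ea^* by rewrite -!rmorphM /= z1E.
case: (ord4P k) => -> /=; rewrite ?cE ?iE -/E0 -/Ea -/Eb -/Ec ?z2C /z2.
- transitivity ((z1 * z1^* ) * (z3 * z3^* ) * E0); last by ring.
  by rewrite z11 z31 !mul1r.
- transitivity ((z1 * z1) * (z3 * z3^* ) * E0^*); last by ring.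
  by rewrite z1E z31 mulr1 mulrAC n0 mul1r.
- transitivity ((z1^* * z1^* ) * (z3^* * z3^* ) * E0); last by ring.
  rewrite z3C z1C EbE.
  transitivity ((E0 * E0^* ) * (E0^* * Ea^* * Ec^* )); last by ring.
  by rewrite n0 mul1r.
- transitivity ((z1 * z1^* ) * (z3 * z3) * E0^*); last by ring.
  by rewrite z3E z11 mul1r mulrAC n0 mul1r.
Qed.

(* In the magic basis local gates become SO(4), and V^T V = O D O^T diagonalises over SO(4). *)
Lemma kak g : is_SU g -> exists (k1 k2 : 'M[C]_4) (x : 'I_3 -> R * R),
  [/\ local_gate k1, local_gate k2 & g = k1 *m cartan x *m k2].
Proof.
move=> /andP[/eqP g1 /eqP dg].
have half : (2^-1 : C) * 2 = 1 by rewrite mulVf // pnatr_eq0.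
have MM : adjmx magic *m magic = 2%:M.
  have : 2^-1 *: magic *m adjmx magic = 1%:M.
    by rewrite -scalemxAl magic_unit scale_scalar_mx half.
  move=> /mulmx1C; rewrite -scalemxAr => /(congr1 (fun A => 2%:R *: A)).
  by rewrite scalerA mulrC half scale1r scalemx1.
pose V := 2^-1 *: (adjmx magic *m g *m magic).
have MV : magic *m V = g *m magic.
  by rewrite /V -scalemxAr !mulmxA magic_unit mul_scalar_mx -scalemxAl scalerA half scale1r.
have dV : \det V = 1.
  by apply: (mulfI magic_det); rewrite -det_mulmx MV det_mulmx dg mulrC.
have V1 : V *m adjmx V = 1%:M.
  have E : magic *m (V *m adjmx V) = magic.
    rewrite mulmxA MV /V adjmxZ !adjmxM adjmxK -scalemxAr !mulmxA.
    have -> : (2^-1 : C)^* = 2^-1 by rewrite fmorphV rmorph_nat.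
    rewrite -(mulmxA g) magic_unit mul_mx_scalar -!scalemxAl scalerA half scale1r.
    by rewrite g1 mul1mx.
  have /(congr1 (mulmx (adjmx magic))) := E; rewrite mulmxA MM mul_scalar_mx.
  move=> /(congr1 (fun A => 2^-1 *: A)); rewrite scalerA half scale1r => ->.
  by rewrite scale_scalar_mx half.
have [S SdE] : exists S, S = V^T *m V by eexists.
have Ssym : S^T = S by rewrite SdE trmx_mul trmxK.
have VT : V^T *m adjmx V^T = 1%:M.
  by rewrite adjmxE map_trmx trmxK -[map_mx _ _]trmxK -adjmxE -trmx_mul (mulmx1C V1) trmx1.
have S1 : S *m adjmx S = 1%:M.
  by rewrite SdE adjmxM mulmxA -(mulmxA V^T) V1 mulmx1 VT.
have [ O [D [ O1 SE]]] := sym_unitary_diag Ssym S1.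
(* Negating one column of [O] flips its determinant and does not change O D O^T. *)
wlog dO : O O1 SE / \det O = 1.
  move=> H; have dOO : \det O * \det O = 1.
    by rewrite -[X in _ * X]det_tr -det_mulmx O1 det1.
  have [dO|dO] := eqVneq (\det O) 1; first exact: (H O).
  have {}dO : \det O = -1.
    have : (\det O - 1) * (\det O + 1) = 0 by rewrite -subr_sqr expr1n expr2 dOO subrr.
    by move=> /eqP; rewrite mulf_eq0 subr_eq0 (negbTE dO) /= addr_eq0 => /eqP.
  pose F : 'M[R]_4 := diag_mx (\row_k (if k == 0 then -1 else 1)).
  have FF : F *m F = 1%:M.
    rewrite /F mulmx_diag -diag_const_mx; congr diag_mx.
    by apply/rowP => k; rewrite !mxE; case: ifP => _; rewrite ?mulr1 ?mulrNN ?mulr1.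
  have FT : F^T = F by rewrite /F tr_diag_mx.
  apply: (H (O *m F)).
  - by rewrite trmx_mul FT mulmxA -(mulmxA O) FF mulmx1.
  - rewrite SE cmxM trmx_mul -!mulmxA; congr (_ *m _).
    rewrite !mulmxA; congr (_ *m _); rewrite -cmx_tr FT /F /cmx map_diag_mx !mulmx_diag.
    congr diag_mx; apply/rowP => k; rewrite !mxE; case: ifP => _.
      by rewrite rmorphN1 mulN1r mulrN1 opprK.
    by rewrite rmorph1 mul1r mulr1.
  - rewrite det_mulmx dO det_diag big_ord4 !mxE /=; lra.
have OC1 : cmx O *m (cmx O)^T = 1%:M by rewrite -cmx_tr -cmxM O1 cmx1.
have OC2 := mulmx1C OC1.
have DE : diag_mx D = (cmx O)^T *m S *m cmx O.
  by rewrite SE !mulmxA OC2 mul1mx -mulmxA OC2 mulmx1.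
have D1 k : D 0 k * (D 0 k)^* = 1.
  have : diag_mx D *m adjmx (diag_mx D) = 1%:M.
    have OT : adjmx (cmx O)^T = cmx O by rewrite -cmx_tr adj_cmx cmx_tr trmxK.
    rewrite DE !adjmxM adj_cmx OT !mulmxA.
    by rewrite -(mulmxA _ (cmx O)) OC1 mulmx1 -(mulmxA _ S) S1 mulmx1 OC2.
  rewrite diag_adj mulmx_diag => /matrixP/(_ k k); by rewrite !mxE eqxx !mulr1n.
have dD : \prod_k D 0 k = 1.
  rewrite -det_diag DE SdE !det_mulmx det_tr dV det_cmx dO; rewrite /= !mulr1 mul1r.
  by rewrite det_tr dV.
pose e0 k := sqrtC (D 0 k).
have e0E k : e0 k * e0 k = D 0 k by rewrite -expr2 sqrtCK.
have e01 k : e0 k * (e0 k)^* = 1.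
  have H : (e0 k * (e0 k)^*) ^+ 2 = 1 ^+ 2.
    by rewrite exprMn -rmorphXn sqrtCK D1 expr1n.
  by apply: (@pexpIrn _ 2) => //; rewrite ?nnegrE ?ler01 // -normCK exprn_ge0.
(* The square roots of the entries of [D] have a product squaring to 1; multiplying one root by this
   sign makes the product 1. *)
pose pr := \prod_k e0 k.
have pr2 : pr * pr = 1.
  by rewrite /pr -big_split -[RHS]dD; apply: eq_bigr => k _; exact: e0E.
pose E k := if k == 0 then pr * e0 k else e0 k.
have prC : pr * pr^* = 1.
  rewrite /pr rmorph_prod -big_split big1 // => k _; exact: e01.
have E1 k : E k * (E k)^* = 1.
  rewrite /E; case: ifP => _; last exact: e01.
  by rewrite rmorphM mulrACA prC e01 mulr1.
have EE k : E k * E k = D 0 k.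
  by rewrite /E; case: ifP => _; rewrite ?e0E // mulrACA pr2 e0E mul1r.
have dE : \prod_k E k = 1.
  rewrite (bigD1 0) //= /E eqxx -mulrA.
  under eq_bigr => k k0 do rewrite (negbTE k0).
  by rewrite -[RHS]pr2; congr (_ * _); rewrite /pr [RHS](bigD1 0).
have [x xE] := cartan_phases E1 dE.
(* W = V O D^(-1/2) is both unitary and complex orthogonal, hence real: an element of SO(4). *)
pose W := V *m cmx O *m diag_mx (\row_k (E k)^*).
have DD : diag_mx (\row_k (E k)^*) *m diag_mx (\row_k E k) = 1%:M.
  rewrite mulmx_diag -diag_const_mx; congr diag_mx.
  by apply/rowP => k; rewrite !mxE mulrC E1.
have WE : W *m diag_mx (\row_k E k) *m (cmx O)^T = V.
  by rewrite /W -(mulmxA (V *m cmx O)) DD mulmx1 -mulmxA OC1 mulmx1.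
have Wadj : W *m adjmx W = 1%:M.
  rewrite /W 2!adjmxM diag_adj adj_cmx -!mulmxA (mulmxA (diag_mx _)).
  rewrite (_ : map_mx _ _ = \row_k E k); last by apply/rowP => k; rewrite !mxE conjCK.
  by rewrite DD mul1mx (mulmxA (cmx O)) OC1 mul1mx V1.
have WT : W^T *m W = 1%:M.
  rewrite /W !trmx_mul tr_diag_mx -!mulmxA (mulmxA V^T) -SdE (mulmxA S) (mulmxA (cmx O)^T).
  rewrite (mulmxA (cmx O)^T) -DE !mulmx_diag -diag_const_mx; congr diag_mx.
  apply/rowP => k; rewrite !mxE -EE.
  have -> : (E k)^* * (E k * E k * (E k)^*) = (E k * (E k)^*) * (E k * (E k)^*) by ring.
  by rewrite E1 mulr1.
have Wreal : map_mx Num.conj W = W.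
  have : adjmx W = W^T by rewrite -[LHS]mul1mx -WT -mulmxA Wadj mulmx1.
  by move=> /(congr1 trmx); rewrite adjmxE !trmxK.
pose Q : 'M[R]_4 := map_mx (@complex.Re R) W.
have QE : cmx Q = W.
  apply/matrixP => i j; rewrite [LHS]mxE [Q _ _]mxE; have /matrixP/(_ i j) := Wreal; rewrite mxE.
  case: (W i j) => a b [] /= /eqP; rewrite -subr_eq0 -opprD oppr_eq0 -mulr2n mulrn_eq0 /=.
  by move=> /eqP->.
have cmx_inj (A B : 'M[R]_4) : cmx A = cmx B -> A = B.
  by move=> /matrixP H; apply/matrixP => i j; have := H i j; rewrite !mxE => -[].
have Q1 : Q *m Q^T = 1%:M.
  by apply: cmx_inj; rewrite cmxM cmx_tr QE cmx1 (mulmx1C WT).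
have dQ : \det Q = 1.
  have : \det W = 1.
    rewrite /W !det_mulmx dV det_cmx dO mul1r mul1r det_diag.
    under eq_bigr do rewrite mxE.
    by rewrite -rmorph_prod dE rmorph1.
  by rewrite -QE det_cmx => -[].
have [k1 k1l k1E] := magic_orthogonal Q1 dQ.
have OT1 : O^T *m (O^T)^T = 1%:M by rewrite trmxK (mulmx1C O1).
have [k2 k2l k2E] := magic_orthogonal OT1 (etrans (det_tr O) dO).
exists k1, k2, x; split; [exact: k1l|exact: k2l|].
have := cartan_magic x; move: (cartan x) => K KM.
have M0 : magic *m (2^-1 *: adjmx magic) = 1%:M.
  by rewrite -scalemxAr magic_unit scale_scalar_mx half.
rewrite -[LHS]mulmx1 -M0 mulmxA -MV -WE -QE !mulmxA k1E -(mulmxA k1).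
have -> : diag_mx (\row_k E k) = diag_mx (\row_k
  let f j b := Complex (x j).1 (if b then - (x j).2 else (x j).2) in
  f (@Ordinal 3 0 isT) (signX k) * f (@Ordinal 3 1 isT) (signY k) *
  f (@Ordinal 3 2 isT) (signZ k)).
  by congr diag_mx; apply/rowP => k; rewrite !mxE xE.
rewrite -KM -cmx_tr mulmxA -(mulmxA _ magic) k2E.
by rewrite -!mulmxA M0 mulmx1.
Qed.

End Kak.

(** * Parameter count for circuits *)

Section Growth.
Variable R : realType.
Local Notation C := R[i].

(* Degree-K monomials in linear coordinates of phi span a space of dimension O(K^D): this
   replaces the statement that the image of phi has dimension at most D (as a cone, D + 1). *)
Definition growth p m (X : Type) (phi : X -> 'M[C]_(p, m)) (D : nat) : Prop :=
  forall K, exists (I : finType) (h : I -> X -> R), (#|I| <= K.+1 ^ D)%N /\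
    forall f : 'I_K -> 'M[C]_(p, m) -> R, (forall l, real_linear (f l)) ->
    exists a : I -> R, forall x, \prod_l f l (phi x) = \sum_i a i * h i x.

Lemma growth_cst p m (A : 'M[C]_(p, m)) : growth (fun _ : unit => A) 0.
Proof.
move=> K; exists unit, (fun _ _ => 1); rewrite card_unit; split=> // f _.
exists (fun=> \prod_l f l A) => x; by rewrite [RHS](bigD1 tt) //= mulr1 [X in _ + X]big1 ?addr0 // => -[].
Qed.

Lemma growth_mulmxr p m m' X (phi : X -> 'M[C]_(p, m)) D (B : 'M[C]_(m, m')) :
  growth phi D -> growth (fun x => phi x *m B) D.
Proof.
move=> H K; have [I [h [Ic Hh]]] := H K; exists I, h; split=> // f fl.
apply: (Hh (fun l A => f l (A *m B))) => l; split=> [A A'|x A].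
  by rewrite mulmxDl (fl l).1.
by rewrite -scalemxAl (fl l).2.
Qed.

(** A block of d + 1 homogeneous parameters costs only d: a monomial of degree K in them is
    determined by the exponents of all but one. *)
Lemma growth_block p m X (phi : X -> 'M[C]_(p, m)) D d (L : 'I_d.+1 -> 'M[C]_p) :
  growth phi D ->
  growth (fun yx : ('I_d.+1 -> R) * X => (\sum_c (yx.1 c)%:C%C *: L c) *m phi yx.2) (d + D).
Proof.
move=> H K; have [I [h [Ic Hh]]] := H K.
pose cnt (s : {ffun 'I_K -> 'I_d.+1}) : {ffun 'I_d -> 'I_K.+1} :=
  [ffun c => inord #|[set l | s l == lift ord0 c]|].
pose mono (e : {ffun 'I_d -> 'I_K.+1}) (y : 'I_d.+1 -> R) :=
  y ord0 ^+ (K - \sum_c e c) * \prod_c y (lift ord0 c) ^+ e c.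
exists ({ffun 'I_d -> 'I_K.+1} * I)%type, (fun ei yx => mono ei.1 yx.1 * h ei.2 yx.2).
split; first by rewrite card_prod card_ffun !card_ord expnD leq_mul.
have cntE s c : cnt s c = #|[set l | s l == lift ord0 c]| :> nat.
  by rewrite ffunE inordK // ltnS (leq_trans (max_card _)) ?card_ord.
have monoE (s : {ffun 'I_K -> 'I_d.+1}) (y : 'I_d.+1 -> R) : \prod_l y (s l) = mono (cnt s) y.
  rewrite (partition_big s predT) //= big_ord_recl.
  have powE c : \prod_(l < K | s l == c) y (s l) = y c ^+ #|[set l | s l == c]|.
    rewrite (eq_bigr (fun=> y c)) => [|l /eqP->//].
    by rewrite prodr_const cardsE.
  rewrite powE; congr (_ * _); last by apply: eq_bigr => c _; rewrite powE cntE.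
  congr (_ ^+ _); suff : (#|[set l | s l == ord0]| + \sum_c cnt s c = K)%N by lia.
  under eq_bigr do rewrite cntE.
  transitivity (\sum_(c < d.+1) #|[set l | s l == c]|)%N; first by rewrite big_ord_recl.
  rewrite -[RHS]card_ord -sum1_card.
  rewrite [RHS](partition_big s predT) //=; apply: eq_bigr => c _.
  by rewrite -sum1_card; apply: eq_bigl => l; rewrite inE.
move=> f fl.
have /choice[a aE] (s : {ffun 'I_K -> 'I_d.+1}) : exists a : I -> R, forall x,
    \prod_l f l (L (s l) *m phi x) = \sum_i a i * h i x.
  apply: (Hh (fun l A => f l (L (s l) *m A))) => l; split=> [A A'|x A].
    by rewrite mulmxDr (fl l).1.
  by rewrite -scalemxAr (fl l).2.
exists (fun ei => \sum_(s | cnt s == ei.1) a s ei.2) => -[y x] /=.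
transitivity (\prod_l \sum_c y c * f l (L c *m phi x)).
  apply: eq_bigr => l _; rewrite mulmx_suml -(real_linear_sum _ _ (fl l)).
  by congr (f l _); apply: eq_bigr => c _; rewrite -scalemxAl.
rewrite bigA_distr_bigA /=.
transitivity (\sum_(s : {ffun 'I_K -> 'I_d.+1}) mono (cnt s) y * \sum_i a s i * h i x).
  by apply: eq_bigr => s _; rewrite big_split /= monoE -aE.
rewrite (partition_big cnt predT) //= -(pair_bigA _ (fun e i =>
   (\sum_(s | cnt s == e) a s i) * (mono e y * h i x))) /=.
apply: eq_bigr => e _; under [RHS]eq_bigr do rewrite mulr_suml.
rewrite exchange_big /=; apply: eq_bigr => s /eqP->.
by rewrite mulr_sumr; apply: eq_bigr => i _; rewrite mulrCA.
Qed.

Lemma quatE v : quat v = \sum_c (v c)%:C%C *: qbasis R c.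
Proof.
rewrite big_ord4; apply: mx2P; rewrite !mxE /=;
by apply/eqP; rewrite eq_complex /=; apply/andP; split; apply/eqP; ring.
Qed.

End Growth.

Section CircuitGrowth.
Variables (R : realType) (n : nat).
Local Notation C := R[i].

Lemma kron2_suml (I : finType) (c : I -> C) (p : I -> 'M[C]_2) q :
  kron2 (\sum_i c i *: p i) q = \sum_i c i *: kron2 (p i) q.
Proof.
apply/matrixP => k l; rewrite -(unpair4K k) -(unpair4K l).
case: (unpair4 k) (unpair4 l) => [k1 k2] [l1 l2].
rewrite kron2E !summxE mulr_suml; apply: eq_bigr => i _.
by rewrite !mxZE kron2E mulrA.
Qed.

Lemma kron2_sumr (I : finType) (c : I -> C) (p : I -> 'M[C]_2) q :
  kron2 q (\sum_i c i *: p i) = \sum_i c i *: kron2 q (p i).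
Proof.
apply/matrixP => k l; rewrite -(unpair4K k) -(unpair4K l).
case: (unpair4 k) (unpair4 l) => [k1 k2] [l1 l2].
rewrite kron2E !summxE mulr_sumr; apply: eq_bigr => i _.
by rewrite !mxZE kron2E mulrCA.
Qed.

(* Each gate costs 9 = 15 - 6 parameters: the local factor following the Cartan part of its KAK
   decomposition is carried along in u and absorbed by the next gate on these qubits. *)
Lemma circuit_growth_modulo_layer (A : architecture n) : wf_arch A ->
  exists (X : Type) (phi : X -> 'M[C]_(2 ^ n)), growth phi (9 * size A) /\
  forall c : circuit R n, valid_circuit c -> map fst c = A ->
  exists x u, (forall q, is_SU (u q)) /\ circuit_unitary c = kron_layer u *m phi x.
Proof.
elim/last_ind: A => [|A [a b] IH].
  move=> _; exists unit, (fun=> 1%:M); split; first exact: growth_cst.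
  move=> [] // _ _; exists tt, (fun=> 1%:M); split; first by move=> q; rewrite is_SU1.
  by rewrite kron_layer1 // mulmx1.
rewrite /wf_arch all_rcons /= => /andP[ab /IH[X [phi [gphi cov]]]].
pose L s (c : 'I_2) : 'M[C]_(2 ^ n) :=
  embed_gate a b (if c == 0 then 1%:M else Complex 0 1 *: pauli2 R (s, s)).
pose Q1 (c : 'I_4) : 'M[C]_(2 ^ n) := embed_gate a b (kron2 (qbasis R c) 1%:M).
pose Q2 (c : 'I_4) : 'M[C]_(2 ^ n) := embed_gate a b (kron2 1%:M (qbasis R c)).
(* Three pairs cost 1 each and two quaternions cost 3 each, 9 in total. *)
have := growth_block (L (true, false)) (growth_block (L (true, true))
  (growth_block (L (false, true)) (growth_block Q1 (growth_block Q2 gphi)))).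
set X' := (X in growth X); move=> gX'; exists _, X'; split.
  by rewrite size_rcons mulnS; exact: gX'.
move=> c; case/lastP: c => [|c [[a' b'] g]]; first by case: (A).
rewrite /valid_circuit all_rcons map_rcons => /andP[/= /andP[_ gS] cv].
move=> /rcons_inj[cA aa bb]; rewrite {}aa {}bb in gS *.
have [x [u [uS cE]]] := cov c cv cA.
have gS' : is_SU (g *m kron2 (u a) (u b)) by rewrite is_SUM // kron2_SU.
have [k1 [k2 [y [[p [q [pS qS k1E]]] [p' [q' [p'S q'S k2E]]] gE]]]] := kak gS'.
have [v v1 p'E] := SU2_quat p'S; have [v' v'1 q'E] := SU2_quat q'S.
pose yc (j : 'I_3) (c : 'I_2) := if c == 0 then (y j).1 else (y j).2.
exists (yc (@Ordinal 3 0 isT), (yc (@Ordinal 3 1 isT), (yc (@Ordinal 3 2 isT), (v, (v', x))))).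
exists (fun r => if r == a then p else if r == b then q else u r); split.
  by move=> r; do 2?case: ifP => //.
rewrite -cats1 circuit_unitary_cat /= mul1mx cE (kron_layer_split _ ab).
set off := kron_layer _.
have offc h : embed_gate a b h *m off = off *m embed_gate a b h.
  by rewrite embed_comm //= ?eqxx ?orbT.
pose F s j : 'M[C]_4 := (y j).1%:C%C *: 1%:M + Complex 0 (y j).2 *: pauli2 R (s, s).
have cyE : cartan y = F (true, false) (@Ordinal 3 0 isT) *m
  F (true, true) (@Ordinal 3 1 isT) *m F (false, true) (@Ordinal 3 2 isT) by [].
have LE s j : \sum_c (yc j c)%:C%C *: L s c = embed_gate a b (F s j).
  rewrite sum_ord2 /L /yc /F [RHS]linearD; congr (_ + _); first by rewrite [RHS]linearZ.
  rewrite [LHS]/= linearZ [RHS]linearZ scalerA; congr (_ *: _).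
  by apply/eqP; rewrite eq_complex /=; apply/andP; split; apply/eqP; ring.
have Q1E : \sum_c (v c)%:C%C *: Q1 c = embed_gate a b (kron2 p' 1%:M).
  by rewrite p'E quatE kron2_suml linear_sum; apply: eq_bigr => k _; rewrite linearZ.
have Q2E : \sum_c (v' c)%:C%C *: Q2 c = embed_gate a b (kron2 1%:M q').
  by rewrite q'E quatE kron2_sumr linear_sum; apply: eq_bigr => k _; rewrite linearZ.
have X'E : X' (yc (@Ordinal 3 0 isT), (yc (@Ordinal 3 1 isT), (yc (@Ordinal 3 2 isT),
    (v, (v', x))))) = embed_gate a b (F (true, false) (@Ordinal 3 0 isT)) *m
  (embed_gate a b (F (true, true) (@Ordinal 3 1 isT)) *m
  (embed_gate a b (F (false, true) (@Ordinal 3 2 isT)) *m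
  (embed_gate a b (kron2 p' 1%:M) *m (embed_gate a b (kron2 1%:M q') *m phi x)))).
  have mulE (M M' : 'M[C]_(2 ^ n)) (N N' : 'M[C]_(2 ^ n)) : M = M' -> N = N' -> M *m N = M' *m N'.
    by move=> -> ->.
  exact (mulE _ _ _ _ (LE _ _) (mulE _ _ _ _ (LE _ _) (mulE _ _ _ _ (LE _ _)
    (mulE _ _ _ _ Q1E (mulE _ _ _ _ Q2E erefl))))).
rewrite {}X'E; clearbody F.
have -> : kron_layer (fun r => if r == a then p else if r == b then q else u r) =
    off *m embed_gate a b k1.
  rewrite k1E embed_kron2 // kron_layerM; apply: eq_kron_layer => r; rewrite /on_pair.
  have [->|_] := eqVneq r a; first by rewrite mul1mx.
  by have [->|_] := eqVneq r b; rewrite ?mul1mx ?mulmx1.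
rewrite cyE k2E in gE.
rewrite !mulmxA (embedM _ _ ab) gE offc; congr (_ *m _).
rewrite -!mulmxA; congr (_ *m _); rewrite !(embedM _ _ ab); congr (embed_gate a b _).
by rewrite kron2M mulmx1 mul1mx !mulmxA.
Qed.

(** Accounts for the local layer left at the end of the circuit: a unit quaternion, thus 3
    parameters, per qubit. *)
Lemma layer_growth (s : seq 'I_n) X (phi : X -> 'M[C]_(2 ^ n)) D : uniq s ->
  growth phi D ->
  exists (X' : Type) (phi' : X' -> 'M[C]_(2 ^ n)), growth phi' (3 * size s + D) /\
  forall u x, (forall q, is_SU (u q)) ->
  exists x', phi' x' = kron_layer (fun q => if q \in s then u q else 1%:M) *m phi x.
Proof.
elim: s => [|q s IH] /=.
  move=> _ gphi; exists X, phi; split=> // u x _; exists x.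
  by rewrite kron_layer1 // mul1mx.
move=> /andP[qs us] gphi; have [X' [phi' [gphi' cov]]] := IH us gphi.
pose L (c : 'I_4) : 'M[C]_(2 ^ n) :=
  kron_layer (fun r => if r == q then qbasis R c else 1%:M).
have := growth_block L gphi'; set X'' := (X in growth X) => gX''.
exists _, X''; split; first by rewrite mulnS -addnA.
move=> u x uS; have [x' x'E] := cov u x uS; have [v _ vE] := SU2_quat (uS q).
exists (v, x'); rewrite /X'' /= x'E mulmxA; congr (_ *m _).
have -> : \sum_c (v c)%:C%C *: L c = kron_layer (fun r => if r == q then u q else 1%:M).
  apply/matrixP => i j; rewrite summxE [RHS]mxE (bigD1 q) //= eqxx vE quatE summxE mulr_suml.
  apply: eq_bigr => c _; rewrite !mxZE -mulrA; congr (_ * _).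
  rewrite mxE (bigD1 q) //= eqxx; congr (_ * _).
  by apply: eq_bigr => r /negbTE->.
rewrite kron_layerM; apply: eq_kron_layer => r; rewrite inE.
have [->|_] /= := eqVneq r q; first by rewrite (negbTE qs) mulmx1.
by rewrite mul1mx.
Qed.

Lemma circuit_growth (A : architecture n) m (B : 'M[C]_(2 ^ n, m)) : wf_arch A ->
  exists (X : Type) (phi : X -> 'M[C]_(2 ^ n, m)), growth phi (9 * size A + 3 * n) /\
  forall c : circuit R n, valid_circuit c -> map fst c = A ->
  exists x, phi x = circuit_unitary c *m B.
Proof.
move=> /circuit_growth_modulo_layer[X [phi [gphi cov]]].
have [X' [phi' [gphi' cov']]] := layer_growth (enum_uniq 'I_n) gphi.
exists X', (fun x => phi' x *m B); split.
  by apply: growth_mulmxr; move: gphi'; rewrite size_enum_ord addnC.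
move=> c cv cA; have [x [u [uS cE]]] := cov c cv cA.
have [x' x'E] := cov' u x uS; exists x'; rewrite x'E cE; congr (_ *m _ *m _).
by apply: eq_kron_layer => q; rewrite mem_enum.
Qed.

End CircuitGrowth.

(** * Separating polynomials *)

Section Digits.
Variable k : nat.

Definition base_value (T : nat) (e : nat -> nat) : nat := (\sum_(i < T) e i * k ^ i)%N.

Lemma base_value_lt T e : (forall i, (i < T)%N -> (e i < k)%N) ->
  (base_value T e < k ^ T)%N.
Proof.
elim: T => [|T IH] H; first by rewrite /base_value big_ord0.
rewrite /base_value big_ord_recr /= -/(base_value T e).
have /IH : forall i, (i < T)%N -> (e i < k)%N by move=> i iT; apply/H/ltnW.
have := H T (ltnSn T) => eT lt.
apply: (@leq_trans (k ^ T + e T * k ^ T)%N); first by rewrite ltn_add2r.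
by rewrite -mulSn expnS leq_mul2r eT orbT.
Qed.

Lemma base_value_inj T e e' : (forall i, (i < T)%N -> (e i < k)%N) ->
  (forall i, (i < T)%N -> (e' i < k)%N) -> base_value T e = base_value T e' ->
  forall i, (i < T)%N -> e i = e' i.
Proof.
elim: T => [//|T IH] He He'; rewrite /base_value !big_ord_recr /= -!/(base_value T _).
have Hl i : (i < T)%N -> (e i < k)%N by move=> iT; apply/He/ltnW.
have Hl' i : (i < T)%N -> (e' i < k)%N by move=> iT; apply/He'/ltnW.
have b := base_value_lt Hl; have b' := base_value_lt Hl'.
rewrite [(base_value T e + _)%N]addnC [(base_value T e' + _)%N]addnC => E.
have kT : (0 < k ^ T)%N by apply: leq_ltn_trans b.
have ET : e T = e' T by have := congr1 (divn^~ (k ^ T)%N) E; rewrite !divnMDl // !divn_small // !addn0.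
move: E; rewrite ET => /addnI /(IH Hl Hl') H i; rewrite ltnS leq_eqVlt => /orP[/eqP->//|].
exact: H.
Qed.

End Digits.

Section Annihilator.
Variables (R : realType) (p m : nat).
Local Notation C := R[i].
Local Notation E := 'M[C]_(p, m).

(* A polynomial with exponents below k, homogenised to degree k * T by the variable ord0. *)
Definition hom_eval (T k : nat) (q : {ffun 'I_T -> 'I_k} -> R) (v : 'I_T.+1 -> R) : R :=
  \sum_e q e * (\prod_i v (lift ord0 i) ^+ e i * v ord0 ^+ (k * T - \sum_i e i)).

Lemma exponents_le T k (e : {ffun 'I_T -> 'I_k}) : (\sum_i e i <= k * T)%N.
Proof.
apply: (@leq_trans (\sum_(i < T) k)%N); first by apply: leq_sum => i _; apply/ltnW.
by rewrite sum_nat_const card_ord mulnC.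
Qed.

(** The k^T homogenised monomials, pulled back along [phi], lie in the span of at most (k T + 1)^D
    functions; a vector in the kernel of the coefficient matrix is a relation. *)
Lemma annihilator X (phi : X -> E) D T k (f : 'I_T.+1 -> E -> R) :
  growth phi D -> ((k * T).+1 ^ D < k ^ T)%N -> (forall i, real_linear (f i)) ->
  exists2 q : {ffun 'I_T -> 'I_k} -> R, exists e, q e != 0 &
    forall x, hom_eval q (fun i => f i (phi x)) = 0.
Proof.
move=> gphi lt fl; have [I [h [Ic Hh]]] := gphi (k * T)%N.
(* [growth] deals with products of k T functionals: [sq e] lists which coordinate fills each
   slot. *)
pose sq (e : {ffun 'I_T -> 'I_k}) : seq 'I_T.+1 :=
  flatten [seq nseq (e i) (lift ord0 i) | i <- enum 'I_T] ++
  nseq (k * T - \sum_i e i) ord0.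
have szsq e : size (sq e) = (k * T)%N.
  rewrite size_cat size_flatten /shape -map_comp size_nseq.
  rewrite (eq_map (g := fun i => e i : nat)) => [|i]; last by rewrite /= size_nseq.
  by rewrite sumnE big_map big_enum /= subnKC // exponents_le.
have prodE e (v : 'I_T.+1 -> R) : \prod_(l < k * T) v (nth ord0 (sq e) l) =
    \prod_i v (lift ord0 i) ^+ e i * v ord0 ^+ (k * T - \sum_i e i).
  rewrite -(szsq e) -(big_mkord predT (fun l => v (nth ord0 (sq e) l))).
  rewrite -(big_nth ord0 predT) big_cat /= big_flatten big_map big_enum /=.
  rewrite big_nseq iter_mulr_1 szsq; congr (_ * _).
  by apply: eq_bigr => i _; rewrite big_nseq iter_mulr_1.
have /choice[a aE] (e : {ffun 'I_T -> 'I_k}) : exists a : I -> R, forall x,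
    \prod_i f (lift ord0 i) (phi x) ^+ e i * f ord0 (phi x) ^+ (k * T - \sum_i e i) =
    \sum_i a i * h i x.
  have [|a aE] := Hh (fun l A => f (nth ord0 (sq e) l) A); first by move=> l; apply: fl.
  by exists a => x; rewrite -aE -(prodE e (fun i => f i (phi x))).
pose A := \matrix_(r < #|{ffun 'I_T -> 'I_k}|, s < #|I|) a (enum_val r) (enum_val s).
have kA : kermx A != 0.
  rewrite kermx_eq0 /row_free; apply: contraTneq (rank_leq_col A) => ->.
  by rewrite -ltnNge (leq_ltn_trans Ic) // card_ffun !card_ord.
pose u := nz_row (kermx A).
have uA : u *m A = 0 by apply/sub_kermxP/nz_row_sub.
have u0 : u != 0 by rewrite nz_row_eq0.
exists (fun e => u 0 (enum_rank e)).
  have [r ur] : exists r, u 0 r != 0.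
    apply: contrapT => H; move/negP: u0; apply; apply/eqP/rowP => r; rewrite mxE.
    by apply/eqP; apply: contrapT => /negP ur; apply: H; exists r.
  by exists (enum_val r); rewrite enum_valK.
move=> x; rewrite /hom_eval.
under eq_bigr do rewrite aE mulr_sumr.
rewrite exchange_big /= big1 // => i _.
have /rowP/(_ (enum_rank i)) := uA; rewrite !mxE => H.
under eq_bigr do rewrite mulrA.
rewrite -mulr_suml [X in X * _](_ : _ = 0) ?mul0r // -[RHS]H.
rewrite [RHS](reindex (@enum_rank _)) /=; last exact/onW_bij/enum_rank_bij.
by apply: eq_bigr => e _; rewrite mxE !enum_rankK.
Qed.

Lemma poly_eq0 (Q : {poly R}) : (forall x, Q.[x] = 0) -> Q = 0.
Proof.
move=> H; apply/eqP; apply: contrapT => /negP Q0.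
have := @max_poly_roots _ Q [seq i%:R | i <- iota 0 (size Q)] Q0.
rewrite size_map size_iota ltnn => F; suff : false by [].
apply: F; first by apply/allP => x _; apply/eqP.
rewrite map_inj_uniq ?iota_uniq // => i j /eqP; rewrite eqr_nat => /eqP; exact.
Qed.

(* As x tends to 0 the monomial of least weight dominates. *)
Lemma hom_eval_nonzero T k (q : {ffun 'I_T -> 'I_k} -> R) (w : 'I_T -> nat)
    (r : 'I_T.+1 -> {poly R}) :
  injective (fun e : {ffun 'I_T -> 'I_k} => \sum_i e i * w i)%N -> (exists e, q e != 0) ->
  exists x, hom_eval q (fun i => if unlift ord0 i is Some j
    then x ^+ w j * (1 + x * (r i).[x]) else 1 + x * (r i).[x]) != 0.
Proof.
move=> winj [e1 qe1]; apply: contrapT => H.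
pose W (e : {ffun 'I_T -> 'I_k}) := (\sum_i e i * w i)%N.
pose U (e : {ffun 'I_T -> 'I_k}) : {poly R} :=
  \prod_i (1 + 'X * r (lift ord0 i)) ^+ e i * (1 + 'X * r ord0) ^+ (k * T - \sum_i e i).
pose Q := \sum_e q e *: ('X^(W e) * U e).
have Q0 : Q = 0.
  apply: poly_eq0 => x; apply/eqP; apply: contrapT => /negP Qx; apply: H; exists x.
  congr (_ != 0): Qx; rewrite /hom_eval /Q horner_sum; apply: eq_bigr => e _.
  rewrite hornerZ hornerM hornerXn /U hornerM horner_exp horner_prod; congr (_ * _).
  rewrite unlift_none !(hornerD, hornerM, hornerX, hornerC) mulrA; congr (_ * _).
  rewrite /W expr_sum -big_split; apply: eq_bigr => i _ /=.
  rewrite liftK exprMn -exprM mulnC horner_exp; congr (_ * _ ^+ _).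
  by rewrite !(hornerD, hornerM, hornerX, hornerC).
pose e0 := [arg min_(e < e1 | (q e != 0)%R) W e]%N.
have [qe0 e0min] : q e0 != 0 /\ forall e, q e != 0 -> (W e0 <= W e)%N.
  by rewrite /e0; case: arg_minnP.
move/negP: qe0; apply; apply/eqP.
(* At the least weight only [e0] contributes, by injectivity of the weights, and its cofactor has
   constant term 1. *)
have /(congr1 (fun P : {poly R} => P`_(W e0))) := Q0; rewrite coef0 /Q coef_sum => <-.
rewrite (bigD1 e0) //= big1 => [|e ee0].
  rewrite addr0 coefZ coefXnM ltnn subnn -horner_coef0 /U hornerM horner_exp horner_prod.
  rewrite big1 => [|i _]; last by rewrite horner_exp !(hornerD, hornerM, hornerX, hornerC) mul0r addr0 expr1n.
  by rewrite !(hornerD, hornerM, hornerX, hornerC) mul0r addr0 expr1n !mulr1.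
rewrite coefZ coefXnM; have [->|qe] := eqVneq (q e) 0; first by rewrite mul0r.
rewrite ltn_neqAle e0min // andbT; case: eqVneq => [We|_]; last by rewrite mulr0.
by move/negP: ee0; case; apply/eqP/winj.
Qed.

End Annihilator.

Section Separating.
Variable R : realType.
Local Notation C := R[i].

(** Homogeneity makes non-vanishing insensitive to the normalising scalar of a circuit. *)
Lemma hom_eval_scale T k (q : {ffun 'I_T -> 'I_k} -> R) (c : R) (v : 'I_T.+1 -> R) :
  hom_eval q (fun i => c * v i) = c ^+ (k * T) * hom_eval q v.
Proof.
rewrite /hom_eval mulr_sumr; apply: eq_bigr => e _; rewrite [RHS]mulrCA; congr (_ * _).
under eq_bigr do rewrite exprMn.
rewrite big_split /= -expr_sum exprMn mulrACA -exprD subnKC //.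
exact: exponents_le.
Qed.

(* The summand k ^ T keeps every weight in [k ^ T, 2 k ^ T), so that products of two
   weighted terms are of higher order than any single one. *)
Lemma kronecker_weights_inj T k :
  injective (fun e : {ffun 'I_T -> 'I_k} => \sum_i e i * (k ^ T + k ^ i))%N.
Proof.
move=> e e' /= E.
pose ext (e : {ffun 'I_T -> 'I_k}) (l : nat) := if insub l is Some i then nat_of_ord (e i) else 0%N.
have extE (d : {ffun 'I_T -> 'I_k}) (i : 'I_T) : ext d i = d i by rewrite /ext valK.
have ext_lt (d : {ffun 'I_T -> 'I_k}) i : (i < T)%N -> (ext d i < k)%N.
  by move=> iT; have := extE d (Ordinal iT) => /= ->.
have WE (d : {ffun 'I_T -> 'I_k}) : (\sum_i d i * (k ^ T + k ^ i) =
    (\sum_i d i) * k ^ T + base_value k T (ext d))%N.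
  rewrite big_distrl -big_split; apply: eq_bigr => i _.
  by rewrite /= extE mulnDr.
move: E; rewrite !WE => E.
have b := base_value_lt (ext_lt e); have b' := base_value_lt (ext_lt e').
have Eb : base_value k T (ext e) = base_value k T (ext e').
  by have := congr1 (modn^~ (k ^ T)%N) E; rewrite !modnMDl !modn_small.
apply/ffunP => i; apply/val_inj; rewrite /= -!extE.
exact: (base_value_inj (ext_lt e) (ext_lt e') Eb (ltn_ord i)).
Qed.

Lemma degree_gap D T : (D < T)%N -> exists2 k, (1 < k)%N & ((k * T).+1 ^ D < k ^ T)%N.
Proof.
(* Since k > (T + 1)^D, the power (k (T + 1))^D is below k^(D + 1), hence below k^T. *)
move=> DT; exists (T.+1 ^ D).+2 => //; set k := _.+2.
have le : ((k * T).+1 ^ D <= (k * T.+1) ^ D)%N.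
  have [->|D0] := posnP D; first by rewrite !expn0.
  by rewrite leq_exp2r // mulnS -addn1 addnC leq_add2r.
apply: leq_ltn_trans le _; rewrite expnMn.
apply: (@leq_trans (k ^ D.+1)%N); last by rewrite leq_exp2l.
by rewrite expnSr ltn_pmul2l ?expn_gt0 //.
Qed.

Lemma separating_polynomial n m (B : 'M[C]_(2 ^ n, m)) D0 (sl : seq (architecture n))
    (A' : architecture n) : (1 < n)%N -> orbit_dim B D0 ->
  (forall S, S \in sl -> wf_arch S /\ causal_slice S) -> (size sl < D0)%N ->
  wf_arch A' -> (9 * size A' + 3 * n < size sl)%N ->
  exists k (q : {ffun 'I_(size sl) -> 'I_k} -> R) (f : 'I_(size sl).+1 -> 'M[C]_(2 ^ n, m) -> R),
  [/\ forall i, real_linear (f i),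
    forall c : circuit R n, valid_circuit c -> map fst c = A' ->
      hom_eval q (fun i => f i (circuit_unitary c *m B)) = 0 &
    exists gs, [/\ size gs = size (flatten sl), all (@is_SU R 4) gs &
      hom_eval q (fun i => f i (circuit_unitary (zip (flatten sl) gs) *m B)) != 0]].
Proof.
move=> n1 HB Hsl szD wA'; set T := size sl in szD *; set D := (_ + _)%N => DT.
have [k k1 gap] := degree_gap DT.
pose N := (k ^ T)%N; pose w (j : nat) := if j is i.+1 then (N + k ^ i)%N else 0%N.
have wN0 j : (0 < j)%N -> (N <= w j)%N by case: j => // j _; rewrite /w leq_addr.
have [v [Rest [vfree Rpoly _ cov]]] := slices_family n1 HB (erefl : w 0%N = 0%N) wN0 Hsl szD.
have [f [fl fv]] := real_free_dual vfree.
have [X [phi [gphi covA']]] := circuit_growth B wA'.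
have [q q0 qphi] := annihilator gphi gap fl.
exists k, q, f; split=> //.
  by move=> c cv cA; have [x <-] := covA' c cv cA; apply: qphi.
have /choice[P PE] i : exists P : {poly R}, forall x, f i (Rest x) = P.[x] := Rpoly _ (fl i).
(* As w i < 2 N, the remainder divided by x^(w i) still contains a factor x, which the last
   subtraction splits off. *)
pose r (i : 'I_T.+1) := 'X^(2 * N - w i - 1) * P i.
have [x Hx] := hom_eval_nonzero r (@kronecker_weights_inj T k) q0.
have [gs [c [sz SU c0 E]]] := cov x.
exists gs; split=> //; rewrite E.
have wN (i : 'I_T.+1) : (w i + 1 <= 2 * N)%N.
  case: i => [[|i] iT] /=; first by rewrite /w add0n mul2n -addnn addn_gt0 expn_gt0 ltnW.
  rewrite mul2n -addnn addn1 /w -addnS leq_add2l ltn_exp2l //.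
have fE i : f i (\sum_(j < T.+1) (x ^+ w j)%:C%C *: v j + (x ^+ (2 * N))%:C%C *: Rest x) =
    x ^+ w i * (1 + x * (r i).[x]).
  rewrite (fl i).1 (real_linear_sum _ _ (fl i)) (fl i).2 PE.
  rewrite (bigD1 i) //= fv eqxx mulr1 big1 => [|j ji]; last first.
    by rewrite fv eq_sym (negbTE ji) mulr0.
  rewrite addr0 mulrDr mulr1 /r hornerM hornerXn; congr (_ + _).
  rewrite !mulrA -exprSr -exprD; congr (_ ^+ _ * _).
  by have := wN i; move: (w i) (2 * N)%N => a b; lia.
have -> : (fun i => f i (c%:C%C *: (\sum_(j < T.+1) (x ^+ w j)%:C%C *: v j +
     (x ^+ (2 * N))%:C%C *: Rest x))) = (fun i => c * (x ^+ w i * (1 + x * (r i).[x]))).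
  by apply/funext => i; rewrite (fl i).2 fE.
rewrite hom_eval_scale mulf_neq0 ?expf_neq0 //; congr (_ != 0): Hx; congr hom_eval.
apply/funext => i; case: unliftP => [j ->|->]; last by rewrite expr0 mul1r.
by rewrite /w lift0.
Qed.

End Separating.

(** * Null sets for independent Haar gates *)

Local Open Scope classical_set_scope.

Section Root.
Variable R : realType.
Local Notation C := R[i].

Lemma norm1_root (z : C) N : (0 < N)%N -> z * z^* = 1 ->
  (N.-root z)%C * ((N.-root z)%C)^* = 1.
Proof.
move=> N0 z1.
have H : ((N.-root z)%C * ((N.-root z)%C)^*) ^+ N = 1 ^+ N.
  by rewrite exprMn -rmorphXn rootCK // z1 expr1n.
by apply: (@pexpIrn _ N) => //; rewrite ?nnegrE ?ler01 // -normCK exprn_ge0.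
Qed.

(** Take N-th roots of three eigenvalues; the inverse of their product is an N-th root of the
    fourth, because det g = 1. *)
Lemma is_SU_root (g : 'M[C]_4) N : (0 < N)%N -> is_SU g ->
  exists2 r : 'M[C]_4, is_SU r & r ^+ N = g.
Proof.
move=> N0 /andP[/eqP g1 /eqP dg]; have [V [D [V1 gE]]] := unitary_diag g1.
have V2 := mulmx1C V1.
have D1 k : D 0 k * (D 0 k)^* = 1.
  have : diag_mx D *m adjmx (diag_mx D) = 1%:M.
    have -> : diag_mx D = V *m g *m adjmx V by rewrite gE !mulmxA V1 mul1mx -mulmxA V1 mulmx1.
    by rewrite !adjmxM adjmxK !mulmxA -(mulmxA _ (adjmx V)) V2 mulmx1 -(mulmxA V) g1 mulmx1 V1.
  rewrite diag_adj mulmx_diag => /matrixP/(_ k k).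
  by rewrite !mxE eqxx !mulr1n.
have dD : \prod_k D 0 k = 1.
  rewrite -det_diag -dg gE !det_mulmx mulrAC -det_mulmx V2 det1 mul1r.
  by [].
pose e k := (N.-root (D 0 k))%C; pose pr := \prod_(k < 4 | k != 0) e k.
have e1 k : e k * (e k)^* = 1 by apply: norm1_root.
have pr1 : pr * pr^* = 1.
  by rewrite /pr rmorph_prod -big_split big1 // => k _; apply: e1.
pose E k := if k == 0 :> 'I_4 then pr^* else e k.
have E1 k : E k * (E k)^* = 1.
  by rewrite /E; case: ifP => _ //; rewrite conjCK mulrC.
have dE : \prod_k E k = 1.
  rewrite (bigD1 0) //= /E eqxx -[RHS]pr1 mulrC; congr (_ * _).
  by apply: eq_bigr => k /negbTE->.
have EN k : E k ^+ N = D 0 k.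
  have eN j : e j ^+ N = D 0 j by rewrite rootCK.
  rewrite /E; case: eqVneq => [->|_] //.
  have prN : pr ^+ N * D 0 0 = 1.
    rewrite -[RHS]dD (bigD1 0) //= mulrC; congr (_ * _).
    by rewrite /pr -prodrXl; apply: eq_bigr => j _; rewrite eN.
  have : (pr * pr^*) ^+ N * D 0 0 = D 0 0 by rewrite pr1 expr1n mul1r.
  by rewrite exprMn mulrAC prN mul1r.
exists (adjmx V *m diag_mx (\row_k E k) *m V).
  apply/andP; split; apply/eqP.
    rewrite !adjmxM adjmxK diag_adj !mulmxA -(mulmxA _ V) V1 mulmx1 -!mulmxA.
    rewrite (mulmxA (diag_mx _)) mulmx_diag (_ : \row_j _ = const_mx 1) ?diag_const_mx ?mul1mx ?V2 //.
    by apply/rowP => k; rewrite !mxE E1.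
  rewrite !det_mulmx mulrAC -det_mulmx V2 det1 mul1r det_diag -[RHS]dE.
  by apply: eq_bigr => k _; rewrite mxE.
have powE l : (adjmx V *m diag_mx (\row_k E k) *m V) ^+ l =
    adjmx V *m diag_mx (\row_k E k ^+ l) *m V.
  elim: l => [|l IH].
    rewrite expr0 (_ : \row_k _ = const_mx 1); last by apply/rowP => k; rewrite !mxE expr0.
    by rewrite diag_const_mx mulmx1 V2.
  rewrite exprS IH -mulmxE !mulmxA -(mulmxA _ V) V1 mulmx1 -!mulmxA.
  rewrite (mulmxA (diag_mx _)) mulmx_diag; congr (_ *m (diag_mx _ *m _)).
  by apply/rowP => k; rewrite !mxE exprS.
rewrite powE gE; congr (_ *m diag_mx _ *m _).
by apply/rowP => k; rewrite !mxE EN.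
Qed.

End Root.

(* Aliases, so that the sigma-algebras below do not compete with other structures on matrices
   and on functions. *)
Definition gates (R : realType) (m : nat) : Type := 'I_m -> 'M[R[i]]_4.
HB.instance Definition _ R m := gen_eqMixin (gates R m).
HB.instance Definition _ R m := gen_choiceMixin (gates R m).
HB.instance Definition _ R m := isPointed.Build (gates R m) (fun=> 1%:M).

Definition gate4 (R : realType) : Type := 'M[R[i]]_4.
HB.instance Definition _ R := gen_eqMixin (gate4 R).
HB.instance Definition _ R := gen_choiceMixin (gate4 R).
HB.instance Definition _ R := isPointed.Build (gate4 R) (1%:M : 'M[R[i]]_4).

(** * Measurable rectangles and functions stable under translation *)

Section Measurability.
Variables (R : realType) (m : nat).
Local Notation C := R[i].

Definition gen4 : set (set (gate4 R)) :=
  [set A : set 'M[C]_4 | exists (x y : 'I_4) (B : set R), measurable B /\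
    (A = [set M : 'M[C]_4 | B (complex.Re (M x y))] \/
     A = [set M : 'M[C]_4 | B (complex.Im (M x y))])].

Lemma measurable_Re4 x y :
  measurable_fun setT (fun M : g_sigma_algebraType gen4 => complex.Re ((M : 'M[C]_4) x y)).
Proof.
move=> _ B mB; rewrite setTI; apply: sub_sigma_algebra.
by exists x, y, B; split=> //; left.
Qed.

Lemma measurable_Im4 x y :
  measurable_fun setT (fun M : g_sigma_algebraType gen4 => complex.Im ((M : 'M[C]_4) x y)).
Proof.
move=> _ B mB; rewrite setTI; apply: sub_sigma_algebra.
by exists x, y, B; split=> //; right.
Qed.

Lemma complex_Re_sum (I : finType) (F : I -> C) :
  complex.Re (\sum_i F i) = \sum_i complex.Re (F i).
Proof. by elim/big_rec2: _ => [//|i x y _ <-]; case: (F i) y => ? ? []. Qed.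

Lemma complex_Im_sum (I : finType) (F : I -> C) :
  complex.Im (\sum_i F i) = \sum_i complex.Im (F i).
Proof. by elim/big_rec2: _ => [//|i x y _ <-]; case: (F i) y => ? ? []. Qed.

Lemma complex_ReM (a b : C) :
  complex.Re (a * b) = complex.Re a * complex.Re b - complex.Im a * complex.Im b.
Proof. by case: a b => ? ? []. Qed.

Lemma complex_ImM (a b : C) :
  complex.Im (a * b) = complex.Re a * complex.Im b + complex.Im a * complex.Re b.
Proof. by case: a b => ? ? []. Qed.

Lemma borel_M4_mul (h : 'M[C]_4) (B : set 'M[C]_4) :
  borel_M4 B -> borel_M4 [set M | B (h *m M)].
Proof.
move=> bB.
have mh : measurable_fun setT ((fun M => h *m (M : 'M[C]_4)) :
    g_sigma_algebraType gen4 -> g_sigma_algebraType gen4).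
  apply: (@measurability _ _ (g_sigma_algebraType gen4) (g_sigma_algebraType gen4) setT
    (fun M => h *m (M : 'M[C]_4)) gen4) => // _ [A [x [y [D [mD H]]]] <-].
  have mRe : measurable_fun setT (fun M : g_sigma_algebraType gen4 =>
      complex.Re ((h *m (M : 'M[C]_4)) x y)).
    under eq_fun do rewrite mxE complex_Re_sum.
    apply: measurable_sum => l; under eq_fun do rewrite complex_ReM.
    apply: measurable_funB; apply: measurable_funM => //;
      [exact: measurable_Re4|exact: measurable_Im4].
  have mIm : measurable_fun setT (fun M : g_sigma_algebraType gen4 =>
      complex.Im ((h *m (M : 'M[C]_4)) x y)).
    under eq_fun do rewrite mxE complex_Im_sum.
    apply: measurable_sum => l; under eq_fun do rewrite complex_ImM.
    apply: measurable_funD; apply: measurable_funM => //;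
      [exact: measurable_Im4|exact: measurable_Re4].
  by case: H => ->; [exact: mRe|exact: mIm].
have := mh measurableT B bB; rewrite setTI; exact.
Qed.

Definition rect : set (set (gates R m)) :=
  [set Z | exists B : 'I_m -> set 'M[C]_4, (forall k, borel_M4 (B k)) /\
    Z = [set z : gates R m | forall k, B k (z k)]].

Local Notation T := (g_sigma_algebraType rect).

Lemma borel_M4T : borel_M4 (setT : set 'M[C]_4).
Proof. exact: (@measurableT _ (g_sigma_algebraType gen4)). Qed.

Lemma measurable_coord (k : 'I_m) (A : set 'M[C]_4) : borel_M4 A ->
  rect.-sigma.-measurable [set z : gates R m | A (z k)].
Proof.
move=> bA; apply: sub_sigma_algebra.
exists (fun l => if l == k then A else setT); split.
  by move=> l; case: ifP => // _; apply: borel_M4T.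
apply/seteqP; split=> z /= H.
  by move=> l; case: eqVneq => // ->.
by have := H k; rewrite eqxx.
Qed.

Lemma measurable_ReT k x y :
  measurable_fun setT (fun z : T => complex.Re ((z : gates R m) k x y)).
Proof.
move=> _ B mB; rewrite setTI; apply: (@measurable_coord k [set M : 'M[C]_4 | B (complex.Re (M x y))]).
by apply: sub_sigma_algebra; exists x, y, B; split=> //; left.
Qed.

Lemma measurable_ImT k x y :
  measurable_fun setT (fun z : T => complex.Im ((z : gates R m) k x y)).
Proof.
move=> _ B mB; rewrite setTI; apply: (@measurable_coord k [set M : 'M[C]_4 | B (complex.Im (M x y))]).
by apply: sub_sigma_algebra; exists x, y, B; split=> //; right.
Qed.

Definition gmul (h z : gates R m) : gates R m := fun k => h k *m z k.

(* f lies in the span of finitely many measurable functions stable under left translations. *)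
Definition translation_finite (f : gates R m -> R) : Prop :=
  exists (I : finType) (phi : I -> gates R m -> R) (a : I -> R),
  [/\ forall i, measurable_fun setT (phi i : T -> R),
    forall h, exists M : I -> I -> R, forall z i,
      phi i (gmul h z) = \sum_j M i j * phi j z &
    forall z, f z = \sum_i a i * phi i z].

Lemma translation_finite_cst c : translation_finite (fun=> c).
Proof.
have H (x : R) : \sum_(i : unit) x * 1 = x.
  by rewrite (bigD1 tt) //= mulr1 big1 ?addr0 // => -[].
exists unit, (fun _ _ => 1), (fun=> c); split => //.
by move=> h; exists (fun _ _ => 1) => z i; rewrite H.
Qed.

Lemma translation_finiteD f g : translation_finite f -> translation_finite g ->
  translation_finite (fun z => f z + g z).
Proof.
move=> [I [phi [a [mphi tphi fE]]]] [J [psi [b [mpsi tpsi gE]]]].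
exists (I + J)%type, (fun s => match s with inl i => phi i | inr j => psi j end).
exists (fun s => match s with inl i => a i | inr j => b j end); split.
- by case.
- move=> h; have [M ME] := tphi h; have [M' M'E] := tpsi h.
  exists (fun s t => match s, t with inl i, inl i' => M i i' | inr j, inr j' => M' j j' | _, _ => 0 end).
  move=> z [i|j]; rewrite big_sumType /=.
    by rewrite ME [X in _ + X]big1 ?addr0 // => ? _; rewrite mul0r.
  by rewrite M'E [X in X + _]big1 ?add0r // => ? _; rewrite mul0r.
- by move=> z; rewrite fE gE big_sumType.
Qed.

Lemma translation_finiteM f g : translation_finite f -> translation_finite g ->
  translation_finite (fun z => f z * g z).
Proof.
move=> [I [phi [a [mphi tphi fE]]]] [J [psi [b [mpsi tpsi gE]]]].
have distr (u : I -> R) (v : J -> R) (p : I -> R) (q : J -> R) :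
    (\sum_i u i * p i) * (\sum_j v j * q j) =
    \sum_(s : I * J) u s.1 * v s.2 * (p s.1 * q s.2).
  rewrite big_distrlr /= pair_big; apply: eq_bigr => s _ /=.
  by rewrite mulrACA.
exists (I * J)%type, (fun s z => phi s.1 z * psi s.2 z), (fun s => a s.1 * b s.2); split.
- by move=> s; apply: measurable_funM.
- move=> h; have [M ME] := tphi h; have [M' M'E] := tpsi h.
  exists (fun s t => M s.1 t.1 * M' s.2 t.2) => z s.
  by rewrite ME M'E distr.
- by move=> z; rewrite fE gE distr.
Qed.

Lemma translation_finite_sum (I : finType) (F : I -> gates R m -> R) :
  (forall i, translation_finite (F i)) -> translation_finite (fun z => \sum_i F i z).
Proof.
move=> HF; elim: (index_enum I) => [|j s IH].
  by under eq_fun do rewrite big_nil; apply: translation_finite_cst.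
by under eq_fun do rewrite big_cons; apply: translation_finiteD.
Qed.

Lemma translation_finite_prod (I : finType) (F : I -> gates R m -> R) :
  (forall i, translation_finite (F i)) -> translation_finite (fun z => \prod_i F i z).
Proof.
move=> HF; elim: (index_enum I) => [|j s IH].
  by under eq_fun do rewrite big_nil; apply: translation_finite_cst.
by under eq_fun do rewrite big_cons; apply: translation_finiteM.
Qed.

Lemma translation_finiteX f n : translation_finite f -> translation_finite (fun z => f z ^+ n).
Proof.
move=> Hf; elim: n => [|n IH]; first exact: (translation_finite_cst 1).
by under eq_fun do rewrite exprS; apply: translation_finiteM.
Qed.

(** Left multiplication acts on each column separately, so the 32 real entries of a gate span a
    stable space. *)
Lemma translation_finite_coord k x y :
  translation_finite (fun z => complex.Re (z k x y)) /\
  translation_finite (fun z => complex.Im (z k x y)).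
Proof.
pose phi (s : 'I_4 * 'I_4 * bool) (z : gates R m) :=
  if s.2 then complex.Re (z k s.1.1 s.1.2) else complex.Im (z k s.1.1 s.1.2).
have mphi s : measurable_fun setT (phi s : T -> R).
  by rewrite /phi; case: s => [[? ?] []] /=; [exact: measurable_ReT|exact: measurable_ImT].
have tphi h : exists M : 'I_4 * 'I_4 * bool -> 'I_4 * 'I_4 * bool -> R, forall z i,
      phi i (gmul h z) = \sum_j M i j * phi j z.
  exists (fun s t => (s.1.2 == t.1.2)%:R * (if s.2 then
      if t.2 then complex.Re (h k s.1.1 t.1.1) else - complex.Im (h k s.1.1 t.1.1)
    else if t.2 then complex.Im (h k s.1.1 t.1.1) else complex.Re (h k s.1.1 t.1.1))).
  move=> z [[u v] b].
  pose F (i : 'I_4) (j : 'I_4) (c : bool) : R := (v == j)%:R * (if b then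
      if c then complex.Re (h k u i) else - complex.Im (h k u i)
    else if c then complex.Im (h k u i) else complex.Re (h k u i)) * phi ((i, j), c) z.
  rewrite (eq_bigr (fun s => F s.1.1 s.1.2 s.2)); last by case=> [[]].
  rewrite -(pair_bigA _ (fun s c => F s.1 s.2 c)) /= -(pair_bigA _ (fun i j => \sum_c F i j c)) /=.
  transitivity (\sum_i \sum_c F i v c).
    rewrite /phi /gmul /= mxE complex_Re_sum complex_Im_sum; case: b @F => F; apply: eq_bigr => i _;
    rewrite big_bool /F /phi /= eqxx !mul1r ?complex_ReM ?complex_ImM ?mulNr //.
    by rewrite addrC.
  apply: eq_bigr => i _; rewrite [RHS](bigD1 v) //= [X in _ + X]big1 ?addr0 // => j jv.
  by rewrite big1 // => c _; rewrite /F eq_sym (negbTE jv) !mul0r.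
have pick s : translation_finite (phi s).
  exists ('I_4 * 'I_4 * bool)%type, phi, (fun t => (t == s)%:R); split=> // z.
  rewrite (bigD1 s) //= eqxx mul1r big1 ?addr0 // => t /negbTE->.
  by rewrite mul0r.
by split; [exact: (pick ((x, y), true))|exact: (pick ((x, y), false))].
Qed.

End Measurability.

Section NullSet.
Variables (R : realType) (d : measure_display) (Omega : measurableType d).
Variables (P : probability Omega R) (m : nat) (G : 'I_m -> Omega -> 'M[R[i]]_4).
Hypotheses (Gind : indep_gates P G) (Ghaar : forall k, haar_gate P (G k)).
Local Notation C := R[i].
Local Notation T := (g_sigma_algebraType (@rect R m)).
Implicit Types (h z : gates R m) (Z : set (gates R m)).

Definition is_SU_gates h : Prop := forall k, is_SU (h k).

Definition law (w : Omega) : gates R m := fun k => G k w.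

Lemma rect_setI : setI_closed (@rect R m).
Proof.
move=> Z Z' [B [bB ->]] [B' [bB' ->]]; exists (fun k => B k `&` B' k); split.
  by move=> k; apply: (@measurableI _ (g_sigma_algebraType (@gen4 R))); [exact: bB|exact: bB'].
apply/seteqP; split=> z /=; first by move=> [H H'] k; split; [exact: H|exact: H'].
by move=> H; split=> k; have [] := H k.
Qed.

Lemma rect_law (B : 'I_m -> set 'M[C]_4) : (forall k, borel_M4 (B k)) ->
  measurable (law @^-1` [set z | forall k, B k (z k)]) /\
  P (law @^-1` [set z | forall k, B k (z k)]) = (\prod_k P (G k @^-1` B k))%E.
Proof.
move=> bB.
have E : law @^-1` [set z | forall k, B k (z k)] =
    \bigcap_(k in [set k | k \in [set: 'I_m]%SET]) (G k @^-1` B k).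
  apply/seteqP; split=> w /= H k; first by move=> _; apply: H.
  by apply: H; rewrite /= inE.
split; last first.
  rewrite E (Gind [set: 'I_m]%SET bB); apply: eq_bigl => k.
  by rewrite inE.
rewrite E; apply: fin_bigcap_measurable => [|k _]; first exact: finite_finset.
by have [mG _] := Ghaar k; apply: mG.
Qed.

(** Dynkin's theorem extends this from rectangles, where independence reduces it to the invariance
    of each single gate. *)
Lemma law_invariant h Z : is_SU_gates h -> (@rect R m).-sigma.-measurable Z ->
  [/\ measurable (law @^-1` Z), measurable (law @^-1` [set z | Z (gmul h z)]) &
    P (law @^-1` [set z | Z (gmul h z)]) = P (law @^-1` Z)].
Proof.
move=> hSU.
pose Q (Z : set (gates R m)) := [/\ measurable (law @^-1` Z),
  measurable (law @^-1` [set z | Z (gmul h z)]) &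
  P (law @^-1` [set z | Z (gmul h z)]) = P (law @^-1` Z)].
apply: (@dynkin_induction _ T (@rect R m) Q) => //.
- exact: rect_setI.
- by split; rewrite ?preimage_setT //; exact: measurableT.
- move=> _ [B [bB ->]].
  pose B' k : set 'M[C]_4 := [set M | B k (h k *m M)].
  have bB' k : borel_M4 (B' k) by apply: borel_M4_mul.
  have [mB PB] := rect_law bB; have [mB' PB'] := rect_law bB'.
  split=> //; rewrite PB; etransitivity; first exact: PB'.
  apply: eq_bigr => k _; have [_ [_ inv]] := Ghaar k.
  (* [haar_gate] speaks of images under left multiplication; the preimage under [h k] is the image
     under its adjoint. *)
  rewrite -(inv (adjmx (h k)) (B k)) ?is_SU_adj //; congr (P (_ @^-1` _)).
  have /andP[/eqP h1 _] := hSU k; have h2 := mulmx1C h1.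
  apply/seteqP; split=> M /=.
    by move=> BM; exists (h k *m M) => //; rewrite mulmxA h2 mul1mx.
  by move=> [N BN <-]; rewrite /B' /= mulmxA h1 mul1mx.
- move=> S mS [m1 m2 E].
  have E1 : law @^-1` (~` S) = ~` (law @^-1` S) by [].
  have E2 : law @^-1` [set z | (~` S) (gmul h z)] = ~` (law @^-1` [set z | S (gmul h z)]) by [].
  rewrite /Q E1 E2; split; [exact: measurableC|exact: measurableC|].
  by rewrite !probability_setC // E.
- move=> F mF tF HF.
  have E1 : law @^-1` (\bigcup_k F k) = \bigcup_k (law @^-1` F k) by rewrite preimage_bigcup.
  have E2 : law @^-1` [set z | (\bigcup_k F k) (gmul h z)] =
      \bigcup_k (law @^-1` [set z | F k (gmul h z)]) by [].
  have m1 k : measurable (law @^-1` F k) by have [] := HF k.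
  have m2 k : measurable (law @^-1` [set z | F k (gmul h z)]) by have [] := HF k.
  rewrite /Q E1 E2; split; [exact: bigcup_measurable|exact: bigcup_measurable|].
  have disj (u : Omega -> gates R m) : trivIset setT (fun k => u @^-1` F k).
    apply/trivIsetP => i j _ _ ij; have /trivIsetP/(_ i j I I ij) := tF.
    move=> H; apply/seteqP; split=> // w [/= w1 w2].
    by have : (F i `&` F j) (u w) by []; rewrite H.
  rewrite (measure_semi_bigcup P m2 (disj (fun w => gmul h (law w)))); last exact: bigcup_measurable.
  rewrite (measure_semi_bigcup P m1 (disj law)); last exact: bigcup_measurable.
  by apply: eq_eseriesr => k _; have [] := HF k.
Qed.

(** Pigeonhole for probabilities: almost disjoint events add up to at most 1. *)
Lemma overlap_bound (A : nat -> set Omega) (p : R) N :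
  (forall i, measurable (A i)) -> (forall i, P (A i) = p%:E) ->
  (forall i j, (i < j < N)%N -> P (A i `&` A j) = 0%E) -> N%:R * p <= 1.
Proof.
move=> mA PA PI.
pose U k := \big[setU/set0]_(i < k) A i.
have mU k : measurable (U k) by apply: bigsetU_measurable.
have H k : (k <= N)%N -> P (U k) = (k%:R * p)%:E.
  elim: k => [|k IH] kN; first by rewrite /U big_ord0 measure0 mul0r.
  rewrite /U big_ord_recr /= -/(U k) measureUfinl //; last first.
    by rewrite (le_lt_trans (probability_le1 _ _)) // ltry.
  have null : P (U k `&` A k) = 0%E.
    apply/negligibleP; first exact: measurableI.
    apply: (@negligibleS _ _ _ P (\bigcup_i (if (i < k)%N then A i `&` A k else set0))).
      rewrite /U -bigcup_mkord => w [[i /= ik Ai] Ak].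
      by exists i => //; rewrite ik.
    apply: negligible_bigcup => i; case: ifP => ik; last exact: negligible_set0.
    by apply/negligibleP; [exact: measurableI|apply: PI; rewrite ik].
  transitivity ((k%:R * p)%:E + p%:E - 0%:E)%E.
    by congr (_ + _ - _)%E; [exact/IH/ltnW|exact: PA|exact: null].
  by rewrite sube0 -EFinD -[in RHS]addn1 natrD mulrDl mul1r.
by have := probability_le1 P (mU N); rewrite H // lee_fin.
Qed.

(* Among the linear conditions W on phi that imply f = 0 and hold with positive probability, take
   one of maximal rank. By left invariance the translates of its zero set by powers of an N!-th
   root of h cannot be almost disjoint, so by maximality the zero set is stable under some power
   r^c with c <= N, hence under h = r^(N!). As h is arbitrary, it then contains SU(4)^m. *)
Lemma law_null f : translation_finite f -> (exists2 g, is_SU_gates g & f g != 0) ->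
  measurable (law @^-1` [set z | f z = 0]) /\ P (law @^-1` [set z | f z = 0]) = 0%E.
Proof.
move=> [I [phi [a [mphi tphi fE]]]] [g0 g0SU fg0].
pose phv z : 'cV[R]_#|I| := \col_r phi (enum_val r) z.
pose Zs (W : 'M[R]_#|I|) : set (gates R m) := [set z | W *m phv z = 0].
have mZ W : (@rect R m).-sigma.-measurable (Zs W).
  pose s z : R := \sum_r (\sum_l W r l * phi (enum_val l) z) ^+ 2.
  have ms : measurable_fun setT (s : T -> R).
    apply: measurable_sum => r; apply: measurable_funX.
    by apply: measurable_sum => l; apply: measurable_funM.
  have -> : Zs W = s @^-1` [set 0].
    have E z r : (W *m phv z) r 0 = \sum_l W r l * phi (enum_val l) z.
      by rewrite mxE; apply: eq_bigr => l _; rewrite mxE.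
    apply/seteqP; split=> z /= H.
      by rewrite /s big1 // => r _; rewrite -E H mxE expr0n.
    apply/matrixP => r c; rewrite (ord1 c) E mxE.
    move/eqP: H; rewrite psumr_eq0 => [|l _]; last exact: sqr_ge0.
    by move/allP/(_ r); rewrite mem_index_enum sqrf_eq0 => /(_ isT)/eqP.
  by have := ms measurableT [set 0] (measurable_set1 0); rewrite setTI.
have one_SU : is_SU_gates (fun=> 1%:M) by move=> k; rewrite is_SU1.
have mlaw W : measurable (law @^-1` Zs W) by have [] := law_invariant one_SU (mZ W).
have /choice[Mx MxE] h : exists M : 'M[R]_#|I|, forall z, phv (gmul h z) = M *m phv z.
  have [M ME] := tphi h; exists (\matrix_(r, l) M (enum_val r) (enum_val l)) => z.
  apply/matrixP => r c; rewrite !mxE ME (reindex (@enum_val _ I)) /=; last first.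
    by apply: onW_bij; exact: enum_val_bij.
  by apply: eq_bigr => l _; rewrite !mxE.
have transl W h z : Zs W (gmul h z) <-> Zs (W *m Mx h) z.
  by rewrite /Zs /= MxE mulmxA.
pose av : 'rV[R]_#|I| := \row_r a (enum_val r).
have avE z : (av *m phv z) 0 0 = f z.
  rewrite mxE fE [RHS](reindex (@enum_val _ I)) /=; last first.
    by apply: onW_bij; exact: enum_val_bij.
  by apply: eq_bigr => l _; rewrite !mxE.
have sub_zero (k1 k2 : nat) (W1 : 'M[R]_(k1, #|I|)) (W2 : 'M[R]_(k2, #|I|)) z :
    (W1 <= W2)%MS -> W2 *m phv z = 0 -> W1 *m phv z = 0.
  by move=> /submxP[D ->] H; rewrite -mulmxA H mulmx0.
have Z0E : Zs <<av>>%MS = [set z | f z = 0].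
  apply/seteqP; split=> z /= H.
    by rewrite -avE (sub_zero _ _ av <<av>>%MS) ?genmxE // mxE.
  apply: (sub_zero _ _ _ av); first by rewrite genmxE.
  by apply/matrixP => i j; rewrite !ord1 avE H mxE.
rewrite -Z0E; split=> //; apply: contrapT => P0.
pose good (W : 'M[R]_#|I|) := (av <= W)%MS /\ P (law @^-1` Zs W) <> 0%E.
have [W [Wa PW] Wmax] : exists2 W, good W & forall W', good W' -> (\rank W' <= \rank W)%N.
  pose Q r := `[< exists2 W, good W & \rank W = r >].
  have exQ : exists r, Q r.
    by exists (\rank <<av>>%MS); apply/asboolP; exists <<av>>%MS => //; split; rewrite ?genmxE.
  have bQ r : Q r -> (r <= #|I|)%N by move=> /asboolP[W _ <-]; apply: rank_leq_row.
  case: (ex_maxnP exQ bQ) => r /asboolP[W gW <-] H; exists W => // W' gW'.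
  by apply: H; apply/asboolP; exists W'.
have stable h : is_SU_gates h -> forall z, Zs W z -> Zs W (gmul h z).
  move=> hSU.
  pose p := fine (P (law @^-1` Zs W)).
  have pE : P (law @^-1` Zs W) = p%:E by rewrite /p fineK // fin_num_measure.
  have p0 : 0 < p.
    rewrite lt_neqAle; apply/andP; split; last by rewrite /p fine_ge0.
    by apply/eqP => p0; apply: PW; rewrite pE -p0.
  have [N Np] : exists N : nat, 1 < N%:R * p.
    exists (Num.bound p^-1); rewrite mulrC -ltr_pdivrMl // mulr1.
    apply: le_lt_trans (archi_boundP _); first by [].
    by rewrite invr_ge0 ltW.
  have /choice[r rE] k : exists r : 'M[C]_4, is_SU r /\ r ^+ N`! = h k.
    by have [r rS rE] := is_SU_root (fact_gt0 N) (hSU k); exists r.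
  pose pw (j : nat) : gates R m := fun k => r k ^+ j.
  have pwS j : is_SU_gates (pw j).
    move=> k; rewrite /pw; elim: j => [|j IH]; first by rewrite expr0 is_SU1.
    by rewrite exprS -mulmxE is_SUM //; have [] := rE k.
  have pwD i j z : gmul (pw i) (gmul (pw j) z) = gmul (pw (i + j)%N) z.
    by apply/funext => k; rewrite /gmul /pw mulmxA exprD mulmxE.
  pose E j := [set z | Zs W (gmul (pw j) z)].
  have EZ j : E j = Zs (W *m Mx (pw j)) by apply/seteqP; split=> z /= /transl.
  have [i [j [ij PE]]] : exists i j, (i < j < N)%N /\ P (law @^-1` (E i `&` E j)) <> 0%E.
    apply: contrapT => H.
    suff : N%:R * p <= 1 by rewrite leNgt Np.
    apply: (@overlap_bound (fun j => law @^-1` E j)) => [j|j|i j ij].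
    - by rewrite EZ; apply: mlaw.
    - by rewrite -pE; have [_ _] := law_invariant (pwS j) (mZ W).
    - by apply: contrapT => PE; apply: H; exists i, j.
  have /andP[ij' jN] := ij; pose c := (j - i)%N.
  pose W' := (W + W *m Mx (pw c))%MS.
  have W'E : Zs W' = Zs W `&` E c.
    apply/seteqP; split=> z; rewrite EZ /= => H.
      by split; apply: (sub_zero _ _ _ _ _ _ H); rewrite ?addsmxSl ?addsmxSr.
    case: H => H1 H2; rewrite /Zs /= /W'.
    have /sub_addsmxP[u uE] := submx_refl (W + W *m Mx (pw c))%MS.
    by rewrite uE mulmxDl -(mulmxA u.1) H1 -(mulmxA u.2) H2 !mulmx0 addr0.
  have W'good : good W'.
    split; first exact: submx_trans Wa (addsmxSl _ _).
    (* Translation by [pw i] turns the zero set of [W'] into the intersection of [E i] and [E j], so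
       by invariance its probability is not 0 either. *)
    have [_ _ Einv] := law_invariant (pwS i) (mZ W').
    rewrite -Einv W'E; apply: contra_not PE => <-; congr (P _).
    apply/seteqP; split=> w /=; rewrite /E /= pwD (addnC c) /c subnKC //; exact: ltnW.
  have W'W : (W' <= W)%MS.
    have := mxrank_leqif_sup (addsmxSl W (W *m Mx (pw c))).
    by case=> le eq; rewrite -eq eqn_leq le Wmax.
  have stepc z : Zs W z -> Zs W (gmul (pw c) z).
    move=> H; apply/transl; apply: (sub_zero _ _ _ _ _ _ H).
    exact: submx_trans (addsmxSr _ _) W'W.
  have iterc l z : Zs W z -> Zs W (gmul (pw (l * c)%N) z).
    elim: l => [|l IH] H.
      by rewrite mul0n (_ : gmul _ z = z) //; apply/funext => k; rewrite /gmul /pw expr0 mul1mx.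
    by rewrite mulSn -pwD; apply/stepc/IH.
  move=> z /(iterc (N`! %/ c)%N); rewrite divnK; last first.
    by apply: dvdn_fact; rewrite /c subn_gt0 ij' (leq_trans (leq_subr _ _)) // ltnW.
  rewrite (_ : gmul _ z = gmul h z) //.
  by apply/funext => k; rewrite /gmul /pw; have [_ ->] := rE k.
have [w Ww] : exists w, Zs W (law w).
  apply: contrapT => H; apply: PW; rewrite (_ : law @^-1` Zs W = set0) ?measure0 //.
  by apply/seteqP; split=> w //= Ww; apply: H; exists w.
(* [h] carries the point [law w] of the stable zero set to [g0], where [f] does not vanish. *)
pose h : gates R m := fun k => g0 k *m adjmx (law w k).
have wSU k : is_SU (law w k) by have [_ [HS _]] := Ghaar k; apply: HS.
have hSU : is_SU_gates h by move=> k; rewrite is_SUM // is_SU_adj.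
have := stable h hSU _ Ww.
have -> : gmul h (law w) = g0.
  apply/funext => k; rewrite /gmul /h -mulmxA.
  by have /andP[/eqP/mulmx1C-> _] := wSU k; rewrite mulmx1.
move=> Z0; move/negP: fg0; apply; rewrite -avE (sub_zero _ _ _ _ _ Wa Z0) mxE.
exact: eqxx.
Qed.

End NullSet.

(** * Circuit complexity *)

Section Assembly.
Variable R : realType.
Local Notation C := R[i].

Definition translation_finiteC m (F : gates R m -> C) : Prop :=
  translation_finite (fun z => complex.Re (F z)) /\
  translation_finite (fun z => complex.Im (F z)).

Lemma translation_finiteC_cst m (c : C) : translation_finiteC (fun _ : gates R m => c).
Proof. by split; apply: translation_finite_cst. Qed.

Lemma translation_finiteC_sum m (I : finType) (F : I -> gates R m -> C) :
  (forall i, translation_finiteC (F i)) -> translation_finiteC (fun z => \sum_i F i z).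
Proof.
move=> H; split.
  by under eq_fun do rewrite complex_Re_sum; apply: translation_finite_sum => i; case: (H i).
by under eq_fun do rewrite complex_Im_sum; apply: translation_finite_sum => i; case: (H i).
Qed.

Lemma translation_finiteCM m (F H : gates R m -> C) :
  translation_finiteC F -> translation_finiteC H -> translation_finiteC (fun z => F z * H z).
Proof.
move=> [F1 F2] [H1 H2]; split.
  under eq_fun do rewrite complex_ReM -mulN1r; apply: translation_finiteD; apply: translation_finiteM => //.
    exact: translation_finite_cst.
  exact: translation_finiteM.
by under eq_fun do rewrite complex_ImM; apply: translation_finiteD; apply: translation_finiteM.
Qed.

Lemma translation_finite_circuit n m (s : seq (('I_n * 'I_n) * 'I_m)) i j :
  translation_finiteC (fun z : gates R m =>
    circuit_unitary [seq (x.1, z x.2) | x <- s] i j).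
Proof.
elim: s i j => [|[[a b] k] s IH] i j; first exact: translation_finiteC_cst.
under eq_fun do rewrite /= mxE.
apply: translation_finiteC_sum => l; apply: translation_finiteCM; first exact: IH.
under eq_fun do rewrite mxE.
case: [forall q, (q != a) && (q != b) ==> _]; last exact: translation_finiteC_cst.
exact: translation_finite_coord.
Qed.

Lemma translation_finite_real_linear m p q (M : gates R m -> 'M[C]_(p, q)) f :
  (forall i j, translation_finiteC (fun z => M z i j)) -> real_linear f ->
  translation_finite (fun z => f (M z)).
Proof.
move=> HM fl.
have E z : f (M z) = \sum_(ij : 'I_p * 'I_q)
   (complex.Re (M z ij.1 ij.2) * f (delta_mx ij.1 ij.2) +
    complex.Im (M z ij.1 ij.2) * f (Complex 0 1 *: delta_mx ij.1 ij.2)).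
  rewrite big_split /= -!(real_linear_sum _ _ fl) -fl.1; congr f.
  rewrite -big_split [LHS]matrix_sum_delta pair_big /=; apply: eq_bigr => -[i j] _ /=.
  rewrite scalerA -scalerDl; congr (_ *: _).
  by case: (M z i j) => x y; apply/eqP; rewrite eq_complex /=; apply/andP; split; apply/eqP; ring.
under eq_fun do rewrite E.
apply: translation_finite_sum => -[i j] /=; have [HR HI] := HM i j.
by apply: translation_finiteD; apply: translation_finiteM => //; apply: translation_finite_cst.
Qed.

Lemma translation_finite_hom_eval m T k (q : {ffun 'I_T -> 'I_k} -> R)
    (v : 'I_T.+1 -> gates R m -> R) : (forall i, translation_finite (v i)) ->
  translation_finite (fun z => hom_eval q (v^~ z)).
Proof.
move=> Hv; apply: translation_finite_sum => e.
apply: translation_finiteM; first exact: translation_finite_cst.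
apply: translation_finiteM; last exact: translation_finiteX.
by apply: translation_finite_prod => i; apply: translation_finiteX.
Qed.

Lemma flatten_slices n (A : architecture n) L T :
  flatten (mkseq (slice A L) T) = take (T * L) A.
Proof.
elim: T => [|T IH]; first by rewrite mul0n take0.
by rewrite mkseqS flatten_rcons IH mulSn addnC takeD.
Qed.

(** The matrix [B] treats both complexities at once: it is the identity for unitaries and [ket0] for
    states. *)
Lemma ae_circuit_size n (A : architecture n) T L d (Omega : measurableType d)
    (P : probability Omega R) (G : 'I_(size A) -> Omega -> 'M[C]_4)
    m (B : 'M[C]_(2 ^ n, m)) D0 :
  (1 < n)%N -> wf_arch A -> size A = (T * L)%N ->
  (forall k, (k < T)%N -> causal_slice (slice A L k)) ->
  indep_gates P G -> (forall k, haar_gate P (G k)) ->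
  orbit_dim B D0 -> (T < D0)%N ->
  {ae P, forall w, forall c : circuit R n, valid_circuit c ->
     circuit_unitary c *m B = circuit_unitary (random_circuit A G w) *m B ->
     (T <= 9 * size c + 3 * n)%N}.
Proof.
move=> n1 wA szA cA Gind Ghaar HB TD.
pose sl := mkseq (slice A L) T.
have slA : flatten sl = A by rewrite flatten_slices -szA take_size.
have szsl : size sl = T by rewrite size_mkseq.
have Hsl S : S \in sl -> wf_arch S /\ causal_slice S.
  move=> /mapP[k]; rewrite mem_iota add0n => /andP[_ kT] ->; split; last exact: cA.
  apply/allP => x xS; apply: (allP wA); exact: mem_drop (mem_take xS).
pose bad (A' : architecture n) w := exists c : circuit R n, [/\ valid_circuit c, map fst c = A' &
  circuit_unitary c *m B = circuit_unitary (random_circuit A G w) *m B].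
have main (A' : architecture n) : (9 * size A' + 3 * n < T)%N ->
    {ae P, forall w, ~ bad A' w}.
  move=> lt; have [wA'|nwA'] := boolP (wf_arch A'); last first.
    apply: aeW => w [c [cv cA' _]]; move/negP: nwA'; apply; rewrite /wf_arch -cA' all_map.
    by apply: sub_all cv => x /andP[].
  have := @separating_polynomial R n m B D0 sl A' n1 HB Hsl; rewrite szsl => /(_ TD wA' lt).
  move=> [k [q [f [fl q0 [gs [szgs SUgs qgs]]]]]].
  pose U (z : gates R (size A)) := circuit_unitary (zip A [seq z k | k <- enum 'I_(size A)]).
  have UE (z : gates R (size A)) : U z = circuit_unitary
      [seq (x.1, z x.2) | x <- zip A (enum 'I_(size A))].
    rewrite /U; congr circuit_unitary.
    have zip_mapr (t : architecture n) s :
      zip t [seq z k | k <- s] = [seq (x.1, z x.2) | x <- zip t s].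
      by elim: t s => [|x t IH] [|y s] //=; rewrite IH.
    exact: zip_mapr.
  pose F z := hom_eval q (fun i => f i (U z *m B)).
  have tF : translation_finite F.
    apply: translation_finite_hom_eval => i; apply: translation_finite_real_linear => // a b.
    under eq_fun do rewrite mxE.
    apply: translation_finiteC_sum => l; apply: translation_finiteCM; last exact: translation_finiteC_cst.
    under eq_fun do rewrite UE; exact: translation_finite_circuit.
  have F0 : exists2 g, is_SU_gates g & F g != 0.
    exists (fun k => nth 1%:M gs k).
      by move=> k'; apply: (allP SUgs); apply: mem_nth; rewrite szgs slA.
    rewrite /F /U (_ : [seq _ | k <- enum 'I_(size A)] = gs); last first.
      rewrite -[RHS](mkseq_nth 1%:M) szgs slA /mkseq -val_enum_ord -map_comp.
      by apply: eq_map.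
    by rewrite slA in qgs.
  have [mF PF] := law_null Gind Ghaar tF F0.
  exists (law G @^-1` [set z | F z = 0]); split=> // w /= /contrapT[c [cv cA' cE]].
  rewrite /F /U; have -> : circuit_unitary (zip A [seq law G w k | k <- enum 'I_(size A)]) *m B =
      circuit_unitary c *m B by rewrite cE.
  exact: q0.
(* Architectures are enumerated by their codes, so that the exceptional sets form a countable
   union. *)
have : {ae P, forall w, forall l : nat, forall A' : architecture n, unpickle l = Some A' ->
    (9 * size A' + 3 * n < T)%N -> ~ bad A' w}.
  apply: ae_foralln => l; case E : (@unpickle (architecture n) l) => [A'|]; last first.
    by apply: aeW => w A'.
  have [lt|ge] := boolP (9 * size A' + 3 * n < T)%N; last first.
    by apply: aeW => w A1 [<-] lt; rewrite lt in ge.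
  by apply: filterS (main A' lt) => w nb A1 [<-].
apply: filterS => w H c cv cE; rewrite leqNgt; apply/negP => lt.
apply: (H (pickle (map fst c : architecture n)) (map fst c)); rewrite ?pickleK ?size_map //.
by exists c.
Qed.

Lemma complexity_bound n T L s : (0 < L)%N -> (T <= 9 * s + 3 * n)%N ->
  (T * L)%:R / (9 * L%:R) - n%:R / 3 <= s%:R :> R.
Proof.
move=> L0; rewrite -(ler_nat R) natrD !natrM => H.
have L0' : L%:R != 0 :> R by rewrite pnatr_eq0 -lt0n.
have -> : T%:R * L%:R / (9 * L%:R) = T%:R / 9 :> R by field.
by lra.
Qed.

End Assembly.

Theorem theorem1 (R : realType) (n : nat) (A : architecture n) (T L : nat)
  (d : measure_display) (Omega : measurableType d) (P : probability Omega R)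
  (G : 'I_(size A) -> Omega -> 'M[R[i]]_4) :
  (0 < n)%N -> ~~ odd n ->
  wf_arch A ->
  (0 < L)%N -> size A = (T * L)%N ->
  (forall k, (k < T)%N -> causal_slice (slice A L k)) ->
  indep_gates P G -> (forall k, haar_gate P (G k)) ->
  ((T < 4 ^ n - 1)%N ->
     {ae P, forall w, ((size A)%:R / (9 * L%:R) - n%:R / 3)%:E
                        <= Cu (circuit_unitary (random_circuit A G w))}%E) /\
  ((T < 2 ^ n.+1 - 1)%N ->
     {ae P, forall w, ((size A)%:R / (9 * L%:R) - n%:R / 3)%:E
                        <= Cstate (circuit_unitary (random_circuit A G w) *m ket0 R n)}%E).
Proof.
move=> n0 nodd wA L0 szA cA Gind Ghaar.
have n1 : (1 < n)%N by case: (n) n0 nodd => [|[|k]].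
split=> TD.
- have := ae_circuit_size n1 wA szA cA Gind Ghaar (@orbit_dim_unitary R n)
    (leq_trans TD (leq_subr _ _)).
  apply: filterS => w H; apply: le_ereal_inf_tmp => _ [c [cv cE] <-].
  by rewrite lee_fin szA complexity_bound // H // cE.
- have := ae_circuit_size n1 wA szA cA Gind Ghaar (@orbit_dim_state R n n1)
    (leq_trans TD (leq_subr _ _)).
  apply: filterS => w H; apply: le_ereal_inf_tmp => _ [c [cv cE] <-].
  by rewrite lee_fin szA complexity_bound // H // cE.
Qed.
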